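(* Let $I\subset\mathbb{R}$ be an open interval (not assumed bounded), let $(u_0,v_0,w_0)\in (H^2\cap H_0^1)(I)\times H_0^1(I)\times H_0^1(I)$ with $u_0$ complex-valued and $v_0,w_0$ real-valued, and let $(u,v,w)$ be the unique solution of $$\begin{cases}\partial_t u=i\partial_x^2 u-ivu, & (t,x)\in\mathbb{R}\times I,\\ \partial_t v=-\partial_x w, & (t,x)\in\mathbb{R}\times I,\\ \partial_t w=-\partial_x v-\partial_x(|u|^2), & (t,x)\in\mathbb{R}\times I,\\ (u(0,x),v(0,x),w(0,x))=(u_0(x),v_0(x),w_0(x)), & x\in I,\\ u(t,x)=v(t,x)=w(t,x)=0, & t\in\mathbb{R},\ x\in\partial I,\end{cases}$$ in the class $C(\mathbb{R};(H^2\cap H_0^1)(I)\times H_0^1(I)\times H_0^1(I))\cap C^1(\mathbb{R};L^2(I)\times L^2(I)\times L^2(I))$. Then there exists $C=C(\|u_0\|_{H^2},\|v_0\|_{H^1},\|w_0\|_{H^1})>0$ such that $$\|u(t)\|_{H^2}+\|v(t)\|_{H^1}+\|w(t)\|_{H^1}\le C(1+|t|^2)\quad\text{for all } t\in\mathbb{R}.$$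
   Context: Here $u$ is complex-valued and $v,w$ are real-valued; norms are over $I$. The notation $C=C(a,b,c)$ means a constant depending only on $a,b,c$. The existence and uniqueness of the solution in the stated class is the global well-posedness theorem of the same paper. The Dirichlet boundary conditions are encoded by membership in $H_0^1(I)$. *)

(* Defs.v *)
From HB Require Import structures.
From mathcomp Require Import all_boot all_order all_algebra.
From mathcomp Require Import complex.
From mathcomp Require Import all_classical all_reals all_analysis.

Set Implicit Arguments.
Unset Strict Implicit.
Unset Printing Implicit Defensive.

Import Order.TTheory GRing.Theory Num.Theory.
Import numFieldNormedType.Exports.

Local Open Scope classical_set_scope.
Local Open Scope ring_scope.
Local Open Scope complex_scope.

Import ComplexField.Normc.

(* Elements of function spaces over an interval I are represented by
   functions on R of which only the restriction to I (Borel) matters: f \_ I extends f by 0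
   outside I, and equality of classes is almost everywhere equality on I. *)

Section real_valued.
Context {R : realType} (I : set R).
Implicit Types f g phi : R -> R.
Local Notation mu := (@lebesgue_measure R).

Definition L2 f : Prop := f \_ I \in Lfun mu 2%:E.

Definition L2norm f : R := fine ('N[mu]_2%:E [EFin \o (f \_ I)])%E.

Definition test_function phi : Prop :=
  [/\ forall n x, derivable (derive1n n phi) x 1,
      compact (closure [set x | phi x != 0]) &
      closure [set x | phi x != 0] `<=` I].

(* Meant for f and g in L2, so that both integrands are integrable. *)
Definition is_weak_derivative f g : Prop :=
  forall phi, test_function phi ->
    \int[mu]_(x in I) (f x * derive1 phi x) = - \int[mu]_(x in I) (g x * phi x).

(* A representative of the weak derivative of f when f has one in L2(I)
   (it is then unique up to null sets), and the zero function otherwise. *)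
Definition wderiv f : R -> R :=
  xget (cst 0) [set g | L2 g /\ is_weak_derivative f g].

Definition H1 f : Prop := L2 f /\ exists2 g, L2 g & is_weak_derivative f g.

Definition H1norm f : R :=
  Num.sqrt (L2norm f ^+ 2 + L2norm (wderiv f) ^+ 2).

Definition H2 f : Prop := H1 f /\ H1 (wderiv f).

(* The closure of the test functions in H1. *)
Definition H10 f : Prop :=
  H1 f /\ forall e : R, 0 < e ->
    exists2 phi, test_function phi & H1norm (f \- phi) < e.

End real_valued.

(* Complex-valued functions: C is identified with R^2, so that membership and
   weak derivatives are taken separately on real and imaginary parts. *)
Section complex_valued.
Context {R : realType} (I : set R).
Implicit Types f : R -> R[i].

Definition ReF f : R -> R := fun x => complex.Re (f x).
Definition ImF f : R -> R := fun x => complex.Im (f x).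

Definition L2C f : Prop := L2 I (ReF f) /\ L2 I (ImF f).
Definition H2C f : Prop := H2 I (ReF f) /\ H2 I (ImF f).
Definition H10C f : Prop := H10 I (ReF f) /\ H10 I (ImF f).

Definition wderivC f : R -> R[i] :=
  fun x => wderiv I (ReF f) x +i* wderiv I (ImF f) x.

Definition L2normC f : R := L2norm I (fun x => normc (f x)).

Definition H2normC f : R :=
  Num.sqrt (L2normC f ^+ 2 + L2normC (wderivC f) ^+ 2
            + L2normC (wderivC (wderivC f)) ^+ 2).

End complex_valued.

Section curves.
Context {R : realType} {V : lmodType R} (N : (R -> V) -> R).
Implicit Types z dz : R -> R -> V.

(* Continuity, and derivability with derivative dz, of a curve t |-> z t in
   the space of functions normed by N. *)
Definition curve_continuous z : Prop :=
  forall t, N (z s \- z t) @[s --> t] --> (0 : R).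

Definition curve_derivative z dz : Prop :=
  forall t, N (fun x => h^-1 *: (z (t + h) x - z t x) - dz t x)
    @[h --> 0^'] --> (0 : R).

End curves.

Section system.
Context {R : realType} (I : set R).
Local Notation mu := (@lebesgue_measure R).

(* (u, v, w) belongs to C(R; (H2 /\ H10) x H10 x H10) and to
   C1(R; L2 x L2 x L2), with time derivative (du, dv, dw). *)
Definition in_class (u du : R -> R -> R[i]) (v dv w dw : R -> R -> R) : Prop :=
  [/\ (forall t, [/\ H2C I (u t), H10C I (u t), H10 I (v t) & H10 I (w t)]),
      [/\ @curve_continuous R (Rcomplex R) (H2normC I) u,
          @curve_continuous R R^o (H1norm I) v &
          @curve_continuous R R^o (H1norm I) w],
      (forall t, [/\ L2C I (du t), L2 I (dv t) & L2 I (dw t)]),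
      [/\ @curve_continuous R (Rcomplex R) (L2normC I) du,
          @curve_continuous R R^o (L2norm I) dv &
          @curve_continuous R R^o (L2norm I) dw] &
      [/\ @curve_derivative R (Rcomplex R) (L2normC I) u du,
          @curve_derivative R R^o (L2norm I) v dv &
          @curve_derivative R R^o (L2norm I) w dw]].

(* The boundary conditions are part of in_class, through H10. *)
Definition is_solution (u0 : R -> R[i]) (v0 w0 : R -> R)
    (u : R -> R -> R[i]) (v w : R -> R -> R) : Prop :=
  exists du dv dw,
    [/\ in_class u du v dv w dw,
        (forall t, {ae mu, forall x, I x ->
           du t x = 'i * wderivC I (wderivC I (u t)) x
                    - 'i * (v t x)%:C * u t x}),
        (forall t, {ae mu, forall x, I x -> dv t x = - wderiv I (w t) x}),
        (forall t, {ae mu, forall x, I x ->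
           dw t x = - wderiv I (v t) x
                    - wderiv I (fun y => normc (u t y) ^+ 2) x}) &
        {ae mu, forall x, I x ->
           [/\ u 0 x = u0 x, v 0 x = v0 x & w 0 x = w0 x]}].

End system.

(* Main.v *)
Require Import Defs.
From HB Require Import structures.
From mathcomp Require Import all_boot all_order all_algebra.
From mathcomp Require Import complex.
From mathcomp Require Import all_classical all_reals all_analysis.
From mathcomp Require Import measurable_realfun ring lra.
Set Implicit Arguments.
Unset Strict Implicit.
Unset Printing Implicit Defensive.

Import Order.TTheory GRing.Theory Num.Theory.
Import numFieldNormedType.Exports.
Local Open Scope classical_set_scope.
Local Open Scope ring_scope.
Local Open Scope complex_scope.

(** Write [u = a + i b] with [a] and [b] real. The proof combines two conservation laws
with a differential inequality for a second-order energy.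

The mass, the integral of [|u|^2], is conserved ([mass_conserved]), and so is the energy,
the integral of [|u_x|^2 + v |u|^2 + (v^2 + w^2) / 2] ([energy_conserved]). The interaction
[v |u|^2] is absorbed by interpolation ([interaction_bound]). Hence the norm of [u] in H1
and those of [v] and [w] in L2 are bounded for all times by a constant that depends on the
initial data ([low_order_norms]).

The remaining norms are controlled by the second-order energy
[E = 2 |u_t|^2 + |w_x|^2 + |v_x|^2] (norms in L2), because [u_xx] differs from [- i u_t] by
the bounded term [v u]. Its time derivative is the integral of
[4 v_t (|u|^2 v + |u_x|^2)] ([is_derive_energy2]): the terms with derivatives of higher
order cancel. Put [y = (1 + E)^(1/4)]. Then [v_t = - w_x] is of size [y^2] in L2, and [|u_x|^2]
is of size [y], since the Gagliardo-Nirenberg inequality bounds [u_x] uniformly by the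
square root of the norm of [u_xx]. Therefore [4 y^3 y' = E'] is of size [y^3], the function
[y] grows at most linearly ([root4_growth]), and [y^2], which bounds the norms of [u_t],
[v_x] and [w_x], at most quadratically.

The solution is too irregular for this computation: [u_t], [v_x] and [w_x] are continuous
curves in L2 without time derivatives. The norm of [u_t] is therefore replaced by that of
the difference quotient of [u], and the wave part of [E] by an antisymmetric difference
quotient of the pairing [<w_x, v>]. For these regularized quantities the cancellations are
exact identities between inner products ([diffq_balance], [cross_balance]). The derivatives
converge jointly in the time and in the step, because a curve with a continuous derivative
is strictly differentiable ([strict_derL2]), and this is enough to differentiate the limit
([is_derive_regularization]).

The functions [u], [v] and [w] are limits in H1 of test functions, which gives their uniform
bounds ([H10_sup]) and the integrations by parts without boundary terms ([ibp]). The function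
[u_x] does not vanish at the boundary, and its uniform bound ([gagliardo_nirenberg]) is
obtained from averages: by Lebesgue differentiation the averages over short intervals bound
the function ([avg_bound]), and averages over nested intervals are compared by means of the
weak derivative ([avg_oscillation]). *)

(** * Square-integrable functions *)

Section almost_everywhere.
Context {R : realType}.
Local Notation mu := (@lebesgue_measure R).
Implicit Types P Q : R -> Prop.

Lemma aeS P Q : (forall x, P x -> Q x) ->
  {ae mu, forall x, P x} -> {ae mu, forall x, Q x}.
Proof. by move=> PQ; apply: filterS; first exact: (ae_filter_ringOfSetsType mu). Qed.

Lemma aeI P Q : {ae mu, forall x, P x} -> {ae mu, forall x, Q x} ->
  {ae mu, forall x, P x /\ Q x}.
Proof.
have F := ae_filter_ringOfSetsType mu.
by move=> HP HQ; apply: filterS2 HP HQ.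
Qed.

Lemma aeW P : (forall x, P x) -> {ae mu, forall x, P x}.
Proof.
have F := ae_filter_ringOfSetsType mu.
by move=> HP; apply: nearW.
Qed.

End almost_everywhere.

Section square_integrable.
Context {R : realType} (I : set R) (mI : measurable I).
Local Notation mu := (@lebesgue_measure R).
Local Notation L2 := (L2 I).
Local Notation L2norm := (L2norm I).
Implicit Types (f g h p : R -> R) (c M : R).

Definition L1 f := mu.-integrable I (EFin \o f).

Definition J f : R := \int[mu]_(x in I) f x.

Definition inner f g : R := J (f * g).
Local Notation ip := inner.

Lemma measurable_sqr f : measurable_fun I f -> measurable_fun I (f ^+ 2).
Proof. by move=> mf; rewrite expr2; exact: measurable_funM. Qed.

Lemma restrict_sqr f : EFin \o (fun x => (f \_ I) x ^+ 2) = (EFin \o (f ^+ 2)) \_ I.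
Proof.
apply/funext => x; rewrite /patch /=; case: ifP => // _.
by rewrite expr0n.
Qed.

(** The library works with functions on the whole line, extended by zero outside
the domain; integrals over [I] are more convenient here. *)
Lemma L2P f : L2 f <-> measurable_fun I f /\ L1 (f ^+ 2).
Proof.
split.
  move=> L2f; split.
    move: L2f => /andP[/[!inE]/= H _].
    exact: (iffRL (measurable_restrictT f mI)).
  move: (Lfun2_integrable_sqr L2f); rewrite restrict_sqr.
  by move=> H; apply: (iffRL (integrable_mkcond (mu := mu) (EFin \o (f ^+ 2)) mI)).
move=> [mf if2]; apply/andP; split; rewrite inE/=.
  exact: (iffLR (measurable_restrictT f mI)).
rewrite /finite_norm unlock poweR_lty//.
have := iffLR (integrable_mkcond (mu := mu) (EFin \o (f ^+ 2)) mI) if2.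
move/integrableP => [_].
apply: le_lt_trans; apply: ge0_le_integral => //.
- by move=> x _; exact: poweR_ge0.
- have mfI : measurable_fun setT (f \_ I) by exact: (iffLR (measurable_restrictT f mI)).
  apply/measurable_EFinP; apply: (measurableT_comp (measurable_powR 2)).
  exact: measurableT_comp.
- apply: measurableT_comp => //; apply: (iffLR (measurable_restrictT _ mI)).
  by apply/measurable_EFinP; exact: measurable_sqr.
- move=> x _ /=; rewrite /patch/=; case: ifP => _ /=.
    by rewrite lee_fin -[X in _ `^ X]/(2%:R) powR_mulrn// real_normK ?num_real// ger0_norm// sqr_ge0.
  by rewrite normr0 powR0//.
Qed.

Lemma L2_measurable f : L2 f -> measurable_fun I f.
Proof. by case/L2P. Qed.

Lemma L2_sqr f : L2 f -> L1 (f ^+ 2).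
Proof. by case/L2P. Qed.

Lemma restrictD f g : (f + g) \_ I = f \_ I + g \_ I.
Proof. by apply/funext => x; rewrite /patch/= !fctE; case: ifP => //; rewrite addr0. Qed.

Lemma restrictZ c f : (c *: f) \_ I = c *: (f \_ I).
Proof. by apply/funext => x; rewrite /patch/= !fctE; case: ifP => //; rewrite scaler0. Qed.

Lemma L20 : L2 0.
Proof.
rewrite /Defs.L2 (_ : 0 \_ I = 0); first exact: (Lfun_submod_closed mu (lee1n 2)).1.
by apply/funext => x; rewrite /patch; case: ifP.
Qed.

Lemma L2D f g : L2 f -> L2 g -> L2 (f + g).
Proof. by rewrite /Defs.L2 restrictD; exact: (Lfun_addr_closed mu (lee1n 2)).2. Qed.

Lemma L2Z c f : L2 f -> L2 (c *: f).
Proof.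
move=> f2; rewrite /Defs.L2 restrictZ -[X in X \in _]addr0.
by apply: (Lfun_submod_closed mu (lee1n 2)).2 => //; exact: (Lfun_submod_closed mu (lee1n 2)).1.
Qed.

Lemma L2N f : L2 f -> L2 (- f).
Proof. by rewrite -scaleN1r; exact: L2Z. Qed.

Lemma L2B f g : L2 f -> L2 g -> L2 (f - g).
Proof. by move=> L2f /L2N; exact: L2D. Qed.

Lemma L2M f g : L2 f -> L2 g -> L1 (f * g).
Proof.
move=> L2f L2g; have := Lfun2_mul_Lfun1 L2f L2g => /Lfun1_integrable.
rewrite (_ : EFin \o _ = (EFin \o (f * g)) \_ I).
  by move=> H; apply: (iffRL (integrable_mkcond (mu := mu) _ mI)).
apply/funext => x; rewrite /patch /=; case: ifP => // _.
by rewrite mul0r.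
Qed.

Lemma L1D f g : L1 f -> L1 g -> L1 (f + g).
Proof. by move=> f1 g1; exact: (@integrableD _ _ _ mu I mI (EFin \o f) (EFin \o g) f1 g1). Qed.

Lemma L1Z c f : L1 f -> L1 (c *: f).
Proof. by move=> f1; exact: (@integrableZl _ _ _ mu I mI c (EFin \o f) f1). Qed.

Lemma JD f g : L1 f -> L1 g -> J (f + g) = J f + J g.
Proof. exact: RintegralD. Qed.

Lemma JZ c f : L1 f -> J (c *: f) = c * J f.
Proof. by move=> f1; rewrite -RintegralZl. Qed.

Lemma J_ae f g : measurable_fun I f -> measurable_fun I g ->
  {ae mu, forall x, I x -> f x = g x} -> J f = J g.
Proof.
move=> mf mg fg; congr fine; apply: ae_eq_integral => //.
- exact/measurable_EFinP.
- exact/measurable_EFinP.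
- suff : {ae mu, forall x, I x -> (f x)%:E = (g x)%:E} by [].
  by move: fg; apply: aeS => x H /H ->.
Qed.

Lemma ipC f g : ip f g = ip g f.
Proof. by rewrite /inner mulrC. Qed.

Lemma ipDl f g h : L2 f -> L2 g -> L2 h -> ip (f + g) h = ip f h + ip g h.
Proof. by move=> *; rewrite /inner mulrDl JD//; exact: L2M. Qed.

Lemma ipZl c f h : L2 f -> L2 h -> ip (c *: f) h = c * ip f h.
Proof.
move=> *; rewrite /inner (_ : (c *: f) * h = c *: (f * h)) ?JZ//; first exact: L2M.
by apply/funext => x; rewrite !fctE /GRing.scale/= mulrA.
Qed.

Lemma ipNl f h : L2 f -> L2 h -> ip (- f) h = - ip f h.
Proof. by move=> *; rewrite -scaleN1r ipZl// mulN1r. Qed.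

Lemma ipBl f g h : L2 f -> L2 g -> L2 h -> ip (f - g) h = ip f h - ip g h.
Proof. by move=> f2 g2 h2; rewrite ipDl ?ipNl//; exact: L2N. Qed.

Lemma ipDr f g h : L2 f -> L2 g -> L2 h -> ip h (f + g) = ip h f + ip h g.
Proof. by move=> *; rewrite ipC ipDl// !(ipC h). Qed.

Lemma ipZr c f h : L2 f -> L2 h -> ip h (c *: f) = c * ip h f.
Proof. by move=> *; rewrite ipC ipZl// !(ipC h). Qed.

Lemma ipNr f h : L2 f -> L2 h -> ip h (- f) = - ip h f.
Proof. by move=> *; rewrite ipC ipNl// !(ipC h). Qed.

Lemma ipBr f g h : L2 f -> L2 g -> L2 h -> ip h (f - g) = ip h f - ip h g.
Proof. by move=> *; rewrite ipC ipBl// !(ipC h). Qed.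

Lemma ip_ge0 f : 0 <= ip f f.
Proof. by apply: Rintegral_ge0 => x _; rewrite -expr2; exact: sqr_ge0. Qed.

Lemma ip_ae f g h : L2 f -> L2 g -> L2 h ->
  {ae mu, forall x, I x -> f x = g x} -> ip f h = ip g h.
Proof.
move=> f2 g2 h2 fg; apply: J_ae.
- by apply: measurable_funM; exact: L2_measurable.
- by apply: measurable_funM; exact: L2_measurable.
- by move: fg; apply: aeS => x /[apply]; rewrite !fctE => ->.
Qed.

Lemma L2norm_ge0 f : 0 <= L2norm f.
Proof. by rewrite fine_ge0// Lnorm_ge0. Qed.

Lemma L2norm_sqr f : L2 f -> L2norm f ^+ 2 = ip f f.
Proof.
move=> f2; have := poweR_Lnorm mu (EFin \o f \_ I) (lt0r_neq0 (ltr0n R 2)).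
have fnum : ('N[mu]_2%:E[EFin \o f \_ I] \is a fin_num)%E.
  by rewrite ge0_fin_numE ?Lnorm_ge0//; move: f2 => /andP[_]; rewrite inE.
rewrite -(fineK fnum) -/(Defs.L2norm I f) => /(congr1 fine).
rewrite poweR_EFin powR_mulrn ?L2norm_ge0//= => ->.
rewrite /inner /J Rintegral_mkcond; congr fine; apply: eq_integral => x _ /=.
rewrite powR_mulrn//  real_normK ?num_real// /patch; case: ifP => _ //.
by rewrite expr0n.
Qed.

(** The quadratic form is positive on [<g, g> f - <f, g> g]; when [<g, g>] vanishes,
it is positive on [f - c g] for every [c], which forces [<f, g> = 0]. *)
Lemma ip_sqr_le f g : L2 f -> L2 g -> ip f g ^+ 2 <= ip f f * ip g g.
Proof.
move=> f2 g2; have [g0|g0] := eqVneq (ip g g) 0; last first.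
  have g_gt0 : 0 < ip g g by rewrite lt_def g0 ip_ge0.
  have := ip_ge0 (ip g g *: f - ip f g *: g).
  rewrite !(ipBl, ipBr, ipZl, ipZr)//; do ?[exact: L2Z|exact: L2B|apply: L2B; exact: L2Z].
  rewrite (ipC g f) => H.
  have : 0 <= ip g g * (ip f f * ip g g - ip f g ^+ 2) by apply: le_trans H _; lra.
  by rewrite pmulr_rge0// subr_ge0.
have H c : 0 <= ip f f - 2 * c * ip f g.
  have := ip_ge0 (f - c *: g).
  rewrite !(ipBl, ipBr, ipZl, ipZr)//; do ?[exact: L2Z|exact: L2B|apply: L2B => //; exact: L2Z].
  by rewrite (ipC g f) g0; lra.
rewrite g0 mulr0; have [->|fg0] := eqVneq (ip f g) 0; first by rewrite expr0n.
have := H ((ip f f + 1) / (2 * ip f g)).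
have -> : 2 * ((ip f f + 1) / (2 * ip f g)) * ip f g = ip f f + 1 by field; exact: fg0.
by lra.
Qed.

Lemma ip_le f g : L2 f -> L2 g -> `|ip f g| <= L2norm f * L2norm g.
Proof.
move=> f2 g2; rewrite -ler_sqr ?nnegrE ?mulr_ge0 ?L2norm_ge0//.
by rewrite real_normK ?num_real// exprMn !L2norm_sqr//; exact: ip_sqr_le.
Qed.

Lemma L2normN f : L2norm (- f) = L2norm f.
Proof.
rewrite /Defs.L2norm -[in RHS]oppe_Lnorm; congr (fine (Lnorm _ _ _)).
apply/funext => x; rewrite /patch/=; case: ifP => _ //.
by rewrite oppr0.
Qed.

Lemma L2normZ c f : L2 f -> L2norm (c *: f) = `|c| * L2norm f.
Proof.
move=> f2; apply/eqP; rewrite -(@eqrXn2 _ 2)// ?mulr_ge0 ?L2norm_ge0//.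
rewrite exprMn !L2norm_sqr//; last exact: L2Z.
rewrite real_normK ?num_real// ipZl//; last exact: L2Z.
by rewrite ipZr// mulrA expr2.
Qed.

Lemma L2norm_triangle f g : L2 f -> L2 g ->
  L2norm (f + g) <= L2norm f + L2norm g.
Proof.
move=> f2 g2; rewrite -ler_sqr ?nnegrE ?addr_ge0 ?L2norm_ge0//.
rewrite sqrrD !L2norm_sqr//; last exact: L2D.
rewrite ipDl//; last exact: L2D.
rewrite !ipDr// (ipC g f).
have := le_trans (ler_norm _) (ip_le f2 g2); lra.
Qed.

Lemma L2_mulB M p f : measurable_fun I p ->
  {ae mu, forall x, I x -> `|p x| <= M} -> L2 f -> L2 (p * f).
Proof.
move=> mp pM f2; apply/L2P.
have mpf : measurable_fun I (p * f).
  by apply: measurable_funM => //; exact: L2_measurable.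
split => //; apply/integrableP; split.
  by apply/measurable_EFinP; exact: measurable_sqr.
have /integrableP[mf iM] := L1Z (M ^+ 2) (L2_sqr f2).
apply: le_lt_trans iM; apply: ae_ge0_le_integral => //.
- by apply: measurableT_comp => //; apply/measurable_EFinP; exact: measurable_sqr.
- exact: measurableT_comp.
- move: pM; apply: aeS => x /[apply] pMx; rewrite lee_fin.
  rewrite /comp/=.
  have -> : ((p * f) ^+ 2) x = (p x * f x) ^+ 2 by [].
  have -> : (M ^+ 2 *: f ^+ 2) x = M ^+ 2 * f x ^+ 2 by [].
  rewrite (@ger0_norm _ ((p x * f x) ^+ 2)) ?sqr_ge0//.
  have M0 : 0 <= M ^+ 2 * f x ^+ 2 by apply: mulr_ge0; exact: sqr_ge0.
  rewrite (ger0_norm M0).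
  have -> : (p x * f x) ^+ 2 = p x ^+ 2 * f x ^+ 2 by ring.
  rewrite ler_wpM2r ?sqr_ge0// -[leLHS]real_normK ?num_real//.
  by rewrite lerXn2r ?nnegrE// (le_trans _ pMx).
Qed.

Lemma L2norm_mulB M p f : measurable_fun I p -> 0 <= M ->
  {ae mu, forall x, I x -> `|p x| <= M} -> L2 f ->
  L2norm (p * f) <= M * L2norm f.
Proof.
move=> mp M0 pM f2; have pf2 := L2_mulB mp pM f2.
rewrite -ler_sqr ?nnegrE ?mulr_ge0 ?L2norm_ge0//.
rewrite exprMn !L2norm_sqr// -ipZl//.
rewrite /inner /J; apply: fine_le.
- by apply: integrable_fin_num => //; exact: L2M.
- apply: integrable_fin_num => //; apply: L2M => //; exact: L2Z.
apply: ae_ge0_le_integral => //.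
- by move=> x _; rewrite lee_fin !fctE -expr2 sqr_ge0.
- by apply/measurable_EFinP; apply: measurable_funM; exact: L2_measurable.
- by move=> x _; rewrite lee_fin !fctE /= -mulrA mulr_ge0 ?sqr_ge0// -expr2 sqr_ge0.
- apply/measurable_EFinP; apply: measurable_funM; apply: L2_measurable => //.
  exact: L2Z.
- move: pM; apply: aeS => x /[apply] pMx; rewrite lee_fin.
  have -> : (p * f * (p * f)) x = p x ^+ 2 * f x ^+ 2.
    by rewrite !fctE; ring.
  have -> : ((M ^+ 2 *: f) * f) x = M ^+ 2 * f x ^+ 2.
    by rewrite !fctE /GRing.scale/=; ring.
  rewrite ler_wpM2r ?sqr_ge0// -[leLHS]real_normK ?num_real//.
  by rewrite lerXn2r ?nnegrE// (le_trans _ pMx).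
Qed.

Lemma ip_swap f g h : ip f (h * g) = ip g (h * f).
Proof. by rewrite /inner; congr J; ring. Qed.

End square_integrable.

(** * Flat functions *)

Section flat_functions.
Context {R : realType}.
Implicit Types (p : {poly R}) (x y : R).

(** The functions [p(1/x) exp(-1/x)] of the positive half-line; with polynomial
factors allowed, the family is stable under differentiation. *)
Definition flat p x : R := if 0 < x then p.[x^-1] * expR (- x^-1) else 0.

Lemma expr_expRN_bounded n y : 0 < y -> y ^+ n * expR (- y) <= n`!%:R.
Proof.
move=> y0; rewrite expRN ler_pdivrMr ?expR_gt0//.
case: n => [|n].
  by rewrite expr0 mul1r (le_trans _ (expR_ge1Dx _))// lerDl ltW.
have n0 : 0 < (n.+1)`!%:R :> R by rewrite ltr0n fact_gt0.
rewrite mulrC -ler_pdivrMr// (le_trans _ (expR_ge1Dxn n (ltW y0)))//.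
by rewrite lerDr.
Qed.

Lemma flat_bounded p : exists2 C, 0 <= C & forall x, `|flat p x| <= C.
Proof.
exists (\sum_(i < size p) `|p`_i| * (i : nat)`!%:R).
  by apply: sumr_ge0 => i _; rewrite mulr_ge0.
move=> x; rewrite /flat; case: ifPn => [x0|_]; last first.
  by rewrite normr0; apply: sumr_ge0 => i _; rewrite mulr_ge0.
rewrite normrM [X in _ * X]ger0_norm ?expR_ge0// horner_coef.
apply: le_trans (_ : (\sum_(i < size p) `|p`_i| * x^-1 ^+ i) * expR (- x^-1) <= _).
  rewrite ler_wpM2r ?expR_ge0// (le_trans (ler_norm_sum _ _ _))//.
  apply: ler_sum => i _; rewrite normrM normrX [X in _ * X ^+ _]ger0_norm//.
  by rewrite invr_ge0 ltW.
rewrite mulr_suml; apply: ler_sum => i _; rewrite -mulrA ler_wpM2l//.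
by apply: expr_expRN_bounded; rewrite invr_gt0.
Qed.

(** Since [flat p] is [x ^+ 2] times the bounded function [flat ('X^2 * p)], its
derivative at 0 vanishes. *)
Lemma is_derive_flat0 p : is_derive (0 : R) 1 (flat p) 0.
Proof.
have [C C0 HC] := flat_bounded ('X^2 * p).
have flatE x : `|flat p x| <= C * x ^+ 2.
  have := HC x; rewrite /flat; case: ifPn => [x0|_ _]; last first.
    by rewrite normr0 mulr_ge0// sqr_ge0.
  rewrite hornerM hornerXn -mulrA normrM => H.
  rewrite -ler_pdivrMr ?exprn_gt0// mulrC -exprVn.
  by rewrite -{1}[x^-1 ^+ 2]ger0_norm// sqr_ge0.
have cvg0 : h^-1 *: (flat p (h + 0) - flat p 0) @[h --> (0:R)^'] --> (0:R).
  apply/cvgr0Pnorm_le => e e0; near=> h.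
  have h0 : h != 0 by near: h; exact: nbhs_dnbhs_neq.
  rewrite addr0 {2}/flat ltxx subr0 normrZ normfV ler_pdivrMl ?normr_gt0//.
  rewrite (le_trans (flatE h))// -real_normK ?num_real// expr2 mulrCA ler_wpM2l//.
  have Ch : `|h| <= e / (C + 1).
    by near: h; apply: dnbhs0_le; rewrite divr_gt0// ltr_wpDl.
  rewrite (le_trans (ler_wpM2l C0 Ch))// mulrA ler_pdivrMr ?ltr_wpDl//.
  by rewrite mulrC ler_wpM2l ?lerDl// ltW.
have E : (fun h : R => h^-1 *: (flat p (h + 0) - flat p 0)) =
   (fun h : R => h^-1 *: ((flat p \o shift 0) (h *: 1) - flat p 0)).
  by apply/funext => h; rewrite /= [h *: 1]mulr1.
split; first by apply/cvg_ex; exists 0; rewrite -E.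
by apply/cvg_lim => //; rewrite -E.
Unshelve. all: by end_near. Qed.

Lemma is_derive_flat p x : is_derive x 1 (flat p) (flat ('X^2 * (p - p^`())) x).
Proof.
have [x0|x0|->] := ltrgtP x 0.
- rewrite {2}/flat ltNge (ltW x0)/=.
  apply: (@near_eq_is_derive _ _ _ (cst 0)); rewrite ?oner_eq0//.
  near=> y; rewrite /flat/= ifF//; apply/negbTE; rewrite -leNgt ltW//.
  by near: y; exact: lt_nbhsl.
- rewrite {2}/flat x0.
  have H : is_derive x 1 (fun y => p.[y^-1] * expR (- y^-1))
     (('X^2 * (p - p^`())).[x^-1] * expR (- x^-1)).
    have iV : is_derive x 1 (fun y => y^-1) (- x ^- 2).
      have H : (id x : R) != 0 by rewrite gt_eqF.
      apply: is_derive_eq (is_deriveV H (is_derive_id x (1 : R))) _.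
      by rewrite /GRing.scale/= mulr1.
    have iP := is_derive1_comp (is_derive_poly p x^-1) iV.
    have iE := @is_derive1_comp _ expR (fun y => - y^-1) x _ _ (is_derive_expR (- x^-1)) (is_deriveN iV).
    apply: is_derive_eq (is_deriveM iP iE) _.
    rewrite hornerM hornerXn hornerD hornerN /GRing.scale/= -exprVn; ring.
  apply: (@near_eq_is_derive _ _ _ (fun y => p.[y^-1] * expR (- y^-1))); rewrite ?oner_eq0//.
  near=> y; rewrite /flat/= ifT//.
  by near: y; exact: lt_nbhsr.
- rewrite {2}/flat ltxx; exact: is_derive_flat0.
Unshelve. all: by end_near. Qed.

End flat_functions.

(** * Bump functions *)

Section smooth_functions.
Context {R : realType}.
Implicit Types (f g : R -> R) (p q : {poly R}) (n : nat) (x c d : R).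

(** Closure of smoothness under sums and products needs no Leibniz formula in this
form: a derivative is merely required to exist and to be smooth to the lower order. *)
Fixpoint nsmooth n f : Prop :=
  if n is m.+1 then
    exists2 g, (forall x, is_derive x (1 : R) f (g x)) & nsmooth m g
  else True.

Definition smooth f := forall n, nsmooth n f.

Lemma nsmoothW n f : nsmooth n.+1 f -> nsmooth n f.
Proof.
elim: n f => [//|n IH] f [g fg gn]; exists g => //; exact: IH.
Qed.

Lemma smooth_derivable f : smooth f -> forall n x, derivable (derive1n n f) x 1.
Proof.
move=> + n; move=> /(_ n.+1); elim: n f => [|n IH] f [g fg gn] x.
  by have [] := fg x.
rewrite derive1Sn; suff -> : derive1 f = g by exact: IH.
by apply/funext => y; rewrite derive1E; have [_] := fg y.
Qed.

Lemma derivable_smooth f : (forall n x, derivable (derive1n n f) x 1) -> smooth f.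
Proof.
move=> + n; elim: n f => [//|n IH] f df; exists (derive1 f).
  by move=> x; split; [exact: (df 0%N)|rewrite derive1E].
by apply: IH => m x; rewrite -derive1Sn; exact: df.
Qed.

Lemma nsmoothD n f g : nsmooth n f -> nsmooth n g -> nsmooth n (f + g).
Proof.
elim: n f g => [//|n IH] f g [f' ff' f'n] [g' gg' g'n].
by exists (f' + g'); [move=> x; exact: is_deriveD|exact: IH].
Qed.

Lemma nsmoothM n f g : nsmooth n f -> nsmooth n g -> nsmooth n (f * g).
Proof.
elim: n f g => [//|n IH] f g /[dup] fn [f' ff' f'n] /[dup] gn [g' gg' g'n].
exists (f * g' + g * f'); first by move=> x; exact: is_deriveM.
by apply: nsmoothD; apply: IH => //; exact: nsmoothW.
Qed.

Lemma nsmooth_poly n p : nsmooth n (horner p).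
Proof.
elim: n p => [//|n IH] p; exists (horner p^`()) => // x; exact: is_derive_poly.
Qed.

Lemma nsmooth_flat n p q : nsmooth n (flat p \o horner q).
Proof.
elim: n p => [//|n IH] p.
exists ((flat ('X^2 * (p - p^`())) \o horner q) * horner q^`()); last first.
  by apply: nsmoothM; [exact: IH|exact: nsmooth_poly].
by move=> x; apply: is_derive1_comp; exact: is_derive_flat.
Qed.

Lemma smoothM f g : smooth f -> smooth g -> smooth (f * g).
Proof. by move=> sf sg n; exact: nsmoothM. Qed.

Lemma smoothD f g : smooth f -> smooth g -> smooth (f + g).
Proof. by move=> sf sg n; exact: nsmoothD. Qed.

Lemma smooth_cst c : smooth (cst c).
Proof.
move=> n; rewrite (_ : cst c = horner c%:P); first exact: nsmooth_poly.
by apply/funext => x; rewrite hornerC.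
Qed.

Lemma smoothZ c f : smooth f -> smooth (c *: f).
Proof. by move=> sf; have := smoothM (smooth_cst c) sf. Qed.

(** A smooth function supported in [[c, d]]; it increases to the indicator of
[]c, d[] as [k] tends to infinity. *)
Definition bump c d k : R -> R :=
  flat 1 \o horner (k.+1%:R *: (('X - c%:P) * (d%:P - 'X))).

Lemma smooth_bump c d k : smooth (bump c d k).
Proof. by move=> n; exact: nsmooth_flat. Qed.

Lemma bumpE c d k x : c < d -> bump c d k x =
  if c < x < d then expR (- (k.+1%:R * ((x - c) * (d - x)))^-1) else 0.
Proof.
move=> cd; rewrite /bump /flat /= -polyC1 hornerZ hornerM.
rewrite !(hornerD, hornerN, hornerX, hornerC) mul1r pmulr_rgt0 ?ltr0n//; congr (if _ then _ else _).
have [xc|cx] := leP x c => /=.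
  apply/negbTE; rewrite -leNgt mulr_le0_ge0// ?subr_le0// subr_ge0.
  by rewrite (le_trans xc)// ltW.
by rewrite pmulr_rgt0 subr_gt0.
Qed.

Lemma bump_ge0 c d k x : c < d -> 0 <= bump c d k x.
Proof. by move=> cd; rewrite bumpE//; case: ifP => // _; exact: expR_ge0. Qed.

Lemma bump_le1 c d k x : c < d -> bump c d k x <= 1.
Proof.
move=> cd; rewrite bumpE//; case: ifP => // /andP[cx xd].
by rewrite -expR0 ler_expR oppr_le0 invr_ge0 !mulr_ge0// subr_ge0 ltW.
Qed.

Lemma bump_out c d k x : c < d -> x \notin `]c, d[ -> bump c d k x = 0.
Proof. by move=> cd; rewrite in_itv/= bumpE// => /negbTE ->. Qed.

Lemma bump_cvg c d x : c < x < d -> bump c d k x @[k --> \oo] --> (1 : R).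
Proof.
move=> /[dup] cxd /andP[cx xd]; have cd := lt_trans cx xd.
have -> : (fun k => bump c d k x) =
    (fun k => expR (- (((x - c) * (d - x))^-1 * harmonic k))).
  by apply/funext => k; rewrite bumpE// cxd invfM mulrC.
rewrite -expR0; apply: continuous_cvg; first exact: continuous_expR.
rewrite -oppr0; apply: cvgN; rewrite -(mulr0 ((x - c) * (d - x))^-1).
by apply: cvgM; [exact: cvg_cst|exact: cvg_harmonic].
Qed.

End smooth_functions.

#[global] Opaque bump.

(** * Test functions *)

Section test_functions.
Context {R : realType} (I : set R) (oI : open I) (iI : is_interval I).
Local Notation mu := (@lebesgue_measure R).
Local Notation test := (test_function I).
Local Notation L2norm := (L2norm I).
Implicit Types (phi f g : R -> R) (x c d p q : R).

Let mI : measurable I := open_measurable oI.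

Lemma test_smooth phi : test phi -> smooth phi.
Proof. by case=> dphi _ _; exact: derivable_smooth. Qed.

Lemma test_is_derive phi x : test phi -> is_derive x (1 : R) phi (derive1 phi x).
Proof.
by case=> dphi _ _; split; [exact: (dphi 0%N)|rewrite derive1E].
Qed.

Lemma is_derive_continuous f g : (forall x, is_derive x (1 : R) f (g x)) ->
  continuous f.
Proof. by move=> fg x; apply/differentiable_continuous/derivable1_diffP; case: (fg x). Qed.

Lemma test_continuous phi : test phi -> continuous phi.
Proof. by move=> tphi; apply: is_derive_continuous => x; exact: test_is_derive. Qed.

Lemma test_intro phi c d : smooth phi -> (forall x, x \notin `[c, d] -> phi x = 0) ->
  `[c, d] `<=` I -> test phi.
Proof.
move=> sphi phi0 cdI.
have S : closure [set x | phi x != 0] `<=` `[c, d].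
  rewrite closureEbigcap => x; apply; split; first exact: itv_closed.
  move=> y /= phiy; apply/negPn/negP => /phi0 py.
  by rewrite py eqxx in phiy.
split; [exact: smooth_derivable| |exact: subset_trans cdI].
by apply: subclosed_compact S; [exact: closed_closure|exact: segment_compact].
Qed.

Lemma test_derive phi : test phi -> test (derive1 phi).
Proof.
move=> /[dup] tphi [dphi cphi KI].
have S : closure [set x | derive1 phi x != 0] `<=` closure [set x | phi x != 0].
  rewrite closureEbigcap => x; apply; split; first exact: closed_closure.
  move=> y /= phiy; apply/not_notP => Ny; move/negP : phiy; apply.
  rewrite derive1E (@near_eq_derive _ _ _ _ (cst 0)) ?derive_cst//.
  have : nbhs y (~` closure [set x | phi x != 0]).
    by apply: open_nbhs_nbhs; split => //; exact/closed_openC/closed_closure.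
  apply: filterS => z Nz; apply/eqP/negPn/negP => phiz; apply: Nz.
  exact: subset_closure.
split; first by move=> n x; rewrite -derive1Sn; exact: dphi.
  by apply: subclosed_compact S; [exact: closed_closure|].
exact: subset_trans KI.
Qed.

(** By compactness of the support and openness of the domain; an interval [[c, d]]
of this kind is where the primitives of test functions can be computed. *)
Lemma test_supp phi p q : test phi -> I p -> I q ->
  exists c d, [/\ c < p, q < d, I c, I d & forall x, x \notin `]c, d[ -> phi x = 0].
Proof.
move=> [dphi cphi KI] Ip Iq; set K := closure _ in cphi KI.
suff [c0 [d0 [c0p qd0 Ic0 Id0 H]]] : exists c0 d0, [/\ c0 <= p, q <= d0, I c0, I d0 &
    forall x, K x -> c0 <= x <= d0].
  have [e e0 ceI] : exists2 e : R, 0 < e & I (c0 - e).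
    have [e /= e0 H1] := oI Ic0; exists (e / 2); first by rewrite divr_gt0.
    apply: H1; rewrite /ball/= opprB addrC subrK gtr0_norm ?divr_gt0//.
    by rewrite ltr_pdivrMr// ltr_pMr// ltr1n.
  have [e' e'0 deI] : exists2 e : R, 0 < e & I (d0 + e).
    have [e2 /= e20 H1] := oI Id0; exists (e2 / 2); first by rewrite divr_gt0.
    apply: H1; rewrite /ball/= opprD addNKr normrN gtr0_norm ?divr_gt0//.
    by rewrite ltr_pdivrMr// ltr_pMr// ltr1n.
  exists (c0 - e), (d0 + e'); split => //.
  - by rewrite ltrBlDr (le_lt_trans c0p)// ltrDl.
  - by rewrite (le_lt_trans qd0)// ltrDl.
  move=> x; rewrite in_itv/= => Nx; apply/eqP/negPn/negP => phix.
  have /H/andP[cx xd] : K x by exact: subset_closure.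
  move/negP: Nx; apply; apply/andP; split.
    by rewrite ltrBlDr (le_lt_trans cx)// ltrDl.
  by rewrite (le_lt_trans xd)// ltrDl.
have [K0|K0] := pselect (K !=set0); last first.
  exists p, q; split => // x Kx; exfalso; apply: K0; by exists x.
have cid : {within K, continuous (@id R)} by apply: continuous_subspaceT => x; exact: cvg_id.
have [m mK Hm] := compact_EVT_min K0 cphi cid.
have [M MK HM] := compact_EVT_max K0 cphi cid.
exists (Num.min p m), (Num.max q M); rewrite ge_min lexx le_max lexx; split => //.
- by rewrite /Num.min; case: ifP => // _; apply: KI; exact: set_mem.
- by rewrite /Num.max; case: ifP => // _; apply: KI; exact: set_mem.
- move=> x /mem_set Kx; rewrite ge_min le_max (Hm _ Kx) (HM _ Kx).
  by rewrite !orbT.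
Qed.

Lemma test_L2 phi : test phi -> L2 I phi.
Proof.
move=> /[dup] tphi [dphi cphi KI].
have cont := test_continuous tphi.
have cont2 : continuous (phi ^+ 2).
  by move=> x; rewrite expr2; apply: cvgM; exact: cont.
apply/L2P => //; split.
  by apply: measurable_funTS; exact: continuous_measurable_fun.
set K := closure _ in cphi KI.
have mK : measurable K by apply: closed_measurable; exact: closed_closure.
have iK : mu.-integrable K (EFin \o (phi ^+ 2)).
  by apply: continuous_compact_integrable => //; exact: continuous_subspaceT.
rewrite /L1.
have E : EFin \o (phi ^+ 2) = (EFin \o (phi ^+ 2)) \_ K.
  apply/funext => x; rewrite /patch; case: ifPn => // /negP xK.
  have -> : (EFin \o phi ^+ 2) x = ((phi x) ^+ 2)%:E by [].
  suff -> : phi x = 0 by rewrite expr0n.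
  apply/eqP/negPn/negP => phix; apply: xK; apply/mem_set; exact: subset_closure.
rewrite E; apply/integrable_restrict => //.
by apply: integrableS iK => //; exact: measurableI.
Qed.

Lemma Rintegral_indic (A : set R) f : A `<=` I ->
  \int[mu]_(x in A) f x = J I (\1_A * f).
Proof.
move=> AI; rewrite /J Rintegral_mkcond [RHS]Rintegral_mkcond.
congr (Rintegral _ _ _); apply/funext => x; rewrite /patch !fctE indicE.
have [xA|xA] := boolP (x \in A); last by rewrite mul0r; case: ifP.
by rewrite mul1r ifT//; apply/mem_set/AI/set_mem.
Qed.

Lemma indic_le1 (A : set R) : {ae mu, forall x, I x -> `|\1_A x : R| <= 1}.
Proof.
by apply: aeW => x _; rewrite indicE; case: (_ \in _); rewrite ?normr1 ?normr0.
Qed.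

Lemma L2_indic (A : set R) f : measurable A -> L2 I f -> L2 I (\1_A * f).
Proof.
by move=> mA f2; apply: (L2_mulB mI _ (indic_le1 A)) => //.
Qed.

Lemma L2norm_indic (A : set R) f : measurable A -> L2 I f -> L2norm (\1_A * f) <= L2norm f.
Proof.
move=> mA f2; rewrite -[leRHS]mul1r.
by apply: L2norm_mulB => //; exact: indic_le1.
Qed.

(** The square of [phi] is the integral of its derivative from the left end of
the support. *)
Lemma test_sqr_le phi x : test phi -> I x ->
  phi x ^+ 2 <= 2 * (L2norm phi * L2norm (derive1 phi)).
Proof.
move=> tphi Ix; have [c [d [cx xd Ic Id phi0]]] := test_supp tphi Ix Ix.
have t' := test_derive tphi.
have p2 := test_L2 tphi; have p2' := test_L2 t'.
have D y : is_derive y (1 : R) (phi * phi) (2 * (phi y * derive1 phi y)).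
  have H := test_is_derive y tphi.
  by apply: is_derive_eq (is_deriveM H H) _; rewrite /GRing.scale/=; ring.
have F : \int[mu]_(y in `[c, x]) (2 * (phi y * derive1 phi y)) = phi x ^+ 2.
  rewrite /Rintegral (@continuous_FTC2 _ _ (phi * phi))//.
  - rewrite !fctE/= (phi0 c) ?mul0r ?subr0//.
    by rewrite in_itv/= ltxx.
  - apply: continuous_subspaceT => y; apply: cvgM; first exact: cvg_cst.
    by apply: cvgM; exact: test_continuous.
  - split.
    + by move=> y _; case: (D y).
    + by apply: cvg_at_right_filter; exact: (is_derive_continuous D).
    + by apply: cvg_at_left_filter; exact: (is_derive_continuous D).
  - by move=> y _; rewrite derive1E; case: (D y).
have cxI : `[c, x] `<=` I.
  by move=> y /=; rewrite in_itv/= => /andP[cy yx]; apply: (iI Ic Ix); rewrite cy.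
rewrite -F Rintegral_indic//.
have -> : J I (\1_`[c, x] * (fun y => 2 * (phi y * derive1 phi y))) =
          2 * inner I (\1_`[c, x] * phi) (derive1 phi).
  rewrite /inner -JZ//; last by apply: L2M => //; exact: L2_indic.
  by congr J; apply/funext => y; rewrite !fctE /GRing.scale/=; ring.
rewrite ler_wpM2l// (le_trans (ler_norm _))// (le_trans (ip_le mI _ _))//.
  exact: L2_indic.
by rewrite ler_wpM2r ?L2norm_ge0// L2norm_indic.
Qed.

End test_functions.

(** * Averages over short intervals *)

Section averages.
Context {R : realType} (I : set R) (oI : open I).
Local Notation mu := (@lebesgue_measure R).
Local Notation test := (test_function I).
Local Notation L2 := (L2 I).
Local Notation L2norm := (L2norm I).
Local Notation ip := (inner I).
Implicit Types (phi f g : R -> R) (x c d : R).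

Let mI : measurable I := open_measurable oI.

Lemma L2_itv c d : L2 \1_`]c, d[.
Proof.
apply/L2P => //; split; first by apply: measurable_funTS; exact: measurable_indic.
rewrite /L1 (_ : EFin \o _ = EFin \o \1_`]c, d[).
  by apply: integrableS (integrable_indic_itv c d false true).
apply/funext => x /=; rewrite expr2 /GRing.mul/= indicE.
by case: (_ \in _); rewrite ?mulr1 ?mulr0.
Qed.

Lemma L2norm_itv c d : c < d -> `]c, d[ `<=` I ->
  L2norm \1_`]c, d[ = Num.sqrt (d - c).
Proof.
move=> cd cdI; apply/eqP; rewrite -(@eqrXn2 _ 2)// ?L2norm_ge0// ?sqrtr_ge0//.
rewrite sqr_sqrtr ?subr_ge0 1?ltW// L2norm_sqr//; last exact: L2_itv.
rewrite /inner /= -Rintegral_indic// Rintegral_mkcond.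
rewrite (_ : _ \_ _ = (cst 1 : R -> R) \_ `]c, d[); last first.
  apply/funext => x; rewrite /patch; case: ifPn => // xcd.
  by rewrite indicE xcd.
rewrite -Rintegral_mkcond Rintegral_cst// mul1r.
have /= := @lebesgue_measure_itv R `]c, d[; rewrite lte_fin cd => H.
by rewrite [X in fine X]H.
Qed.

(** Dominated convergence: pairings with test functions determine the integrals
over intervals, hence the function. *)
Lemma cvg_bump f c d : L2 f -> c < d ->
  ip f (bump c d k) @[k --> \oo] --> ip f \1_`]c, d[.
Proof.
move=> f2 cd; have mf := L2_measurable mI f2.
have L1f : mu.-integrable I (fun x => `|(EFin \o (f * \1_`]c, d[)%R) x|)%E.
  by apply: integrable_abse; exact: (L2M mI f2 (L2_itv c d)).
have mb k : measurable_fun I (bump c d k).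
  apply: measurable_funTS; apply: continuous_measurable_fun.
  by have [g bg _] := smooth_bump c d k 1%N; exact: is_derive_continuous bg.
apply: fine_cvg; rewrite fineK; last first.
  by apply: integrable_fin_num => //; exact: (L2M mI f2 (L2_itv c d)).
apply: (@dominated_cvg _ _ _ mu I mI _ (EFin \o (f * \1_`]c, d[)%R) (fun x => `|(EFin \o (f * \1_`]c, d[)%R) x|)%E) => //.
- by move=> k; apply/measurable_EFinP; exact: (measurable_funM mf (mb k)).
- move=> x Ix; apply: cvg_EFin; first by near=> k.
  rewrite /comp/=; apply: cvgM; first exact: cvg_cst.
  rewrite indicE; have [|xcd] := boolP (x \in _).
    by rewrite inE/= in_itv/=; exact: bump_cvg.
  apply: cvg_near_cst; near=> k; rewrite bump_out//.
  by apply: contra xcd => xcd; apply/mem_set.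
- move=> k x Ix; rewrite /= lee_fin !fctE indicE.
  have [xcd|xcd] := boolP (x \in _).
    rewrite mulr1 normrM ler_piMr// ger0_norm ?bump_ge0// ?bump_le1//.
  rewrite bump_out// ?mulr0 ?normr0//.
  by apply: contra xcd => xcd; apply/mem_set.
Unshelve. all: by end_near. Qed.

(** On a compact set, [|y| <= 1 + y^2] reduces integrability to that of the square. *)
Lemma L2_locally_integrable f : L2 f -> locally_integrable setT (f \_ I).
Proof.
move=> f2; split; [|exact: openT|].
  exact: (iffLR (measurable_restrictT _ mI) (L2_measurable mI f2)).
move=> K _ cK; have mK : measurable K by apply: compact_measurable.
have mfI : measurable_fun setT (f \_ I).
  exact: (iffLR (measurable_restrictT _ mI) (L2_measurable mI f2)).
have mfK : measurable_fun K (f \_ I) := measurable_funS measurableT (@subsetT _ K) mfI.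
have i2 : mu.-integrable K (EFin \o (fun x => (f \_ I) x ^+ 2)).
  by apply: (@integrableS _ _ _ mu setT K _ measurableT mK (@subsetT _ _) (Lfun2_integrable_sqr f2)).
have i1 : mu.-integrable K (EFin \o cst 1).
  apply/integrableP; split; first by apply/measurable_EFinP; exact: measurable_cst.
  under eq_integral do rewrite /= normr1.
  by rewrite integral_cst// mul1e; exact: compact_finite_measure.
have /integrableP[_] := L1D mK i1 i2.
apply: le_lt_trans; apply: ge0_le_integral => //.
- by apply/measurable_EFinP; exact: (measurableT_comp (@normr_measurable R setT) mfK).
- apply: measurableT_comp => //; apply/measurable_EFinP.
  exact: (measurable_funD (measurable_cst (1 : R)) (measurable_funX 2 mfK)).
- move=> x _; set y := (f \_ I) x; rewrite lee_fin.
  suff H : `|y| <= 1 + y ^+ 2 by apply: le_trans H (ler_norm _).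
  by rewrite -[y ^+ 2]real_normK ?num_real//; have := sqr_ge0 (`|y| - 1); nra.
Qed.

(** Lebesgue differentiation, along shrinking intervals centred at almost every point. *)
Lemma avg_bound f (M delta : R) : 0 < delta -> L2 f ->
  (forall c d, c < d -> d - c <= delta -> `[c, d] `<=` I ->
     `|ip f \1_`]c, d[ | <= M * (d - c)) ->
  {ae mu, forall x, I x -> `|f x| <= M}.
Proof.
move=> delta0 f2 favg.
pose r k : R := k.+1%:R^-1.
have r0 k : 0 < r k by rewrite invr_gt0.
pose E x k := ball x (r k).
have hE x : nicely_shrinking x (E x).
  split; first by move=> k; exact: measurable_ball.
  exists (1, fun k => PosNum (r0 k)); split => //=.
  - exact: cvg_harmonic.
  - by move=> k.
  - by move=> k; rewrite mul1e.
have := lebesgue_differentiation (L2_locally_integrable f2).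
apply: aeS => x /(nice_lebesgue_differentiation hE (L2_locally_integrable f2)).
move=> cvgf Ix; rewrite patchE mem_set// in cvgf.
have [e /= e0 eI] := oI Ix.
have near_avg : \forall k \near \oo, `|(fine \o (fun k => ((mu (E x k))^-1 *
    \int[mu]_(y in E x k) ((f \_ I) y)%:E)%E)) k| <= M.
  near=> k.
  have rk : r k < Num.min e (delta / 2).
    near: k; have := cvg_harmonic (R := R).
    move=> /cvgr0_norm_lt /(_ (Num.min e (delta / 2))).
    rewrite lt_min e0 divr_gt0// => /(_ isT); apply: filterS => n.
    by rewrite ger0_norm// invr_ge0.
  move: rk; rewrite lt_min => /andP[rke rkd].
  have cdI : `[x - r k, x + r k] `<=` I.
    move=> y /=; rewrite in_itv/= => /andP[xy yx]; apply: eI.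
    rewrite /ball/= distrC ltr_norml; apply/andP; split.
      by rewrite (lt_le_trans (_ : - e < - r k))// ?ltrN2//; lra.
    by rewrite (le_lt_trans _ rke)//; lra.
  have oI' : `]x - r k, x + r k[ `<=` I.
    by apply: subset_trans cdI; exact: subset_itv_oo_cc.
  have cd : x - r k < x + r k by have := r0 k; lra.
  have intE : (\int[mu]_(y in E x k) ((f \_ I) y)%:E =
      (ip f \1_`](x - r k), (x + r k)[)%:E)%E.
    rewrite /inner /J fineK; last first.
      by apply: integrable_fin_num => //; exact: (L2M mI f2 (L2_itv _ _)).
    rewrite [LHS]integral_mkcond [RHS]integral_mkcond; congr (integral _ _ _); apply/funext => y.
    rewrite /E ball_itv /patch/=.
    have -> z : (f * \1_`]x - r k, x + r k[) z = f z * (z \in `]x - r k, x + r k[%classic)%:R.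
      by rewrite -indicE.
    have [yE|yE] := boolP (y \in _).
      by rewrite (mem_set (oI' _ (set_mem yE))) mulr1.
    by rewrite mulr0; case: ifP.
  have muE : ((mu (E x k))^-1 = ((r k *+ 2)^-1)%:E)%E.
    rewrite /E lebesgue_measure_ball ?ltW// inver.
    by rewrite ifF//; apply/negbTE; rewrite mulrn_eq0/= gt_eqF.
  rewrite (_ : (fine \o _) k = (r k *+ 2)^-1 * ip f \1_`](x - r k), (x + r k)[); last first.
    by rewrite /comp intE muE.
  have r2 : 0 < r k *+ 2 by rewrite pmulrn_rgt0.
  rewrite normrM gtr0_norm ?invr_gt0// ler_pdivrMl//.
  have := favg _ _ cd _ cdI; have -> : x + r k - (x - r k) = r k *+ 2 by rewrite mulr2n; ring.
  rewrite [M * _]mulrC; apply.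
  by rewrite mulr2n; lra.
have cvgn := @cvg_norm _ _ _ \oo _ _ _ (@fine_cvg _ _ \oo _ _ _ cvgf).
have {}cvgn := cvgn eventually_filter eventually_filter.
rewrite -(cvg_lim _ cvgn)//; apply: limr_le => //.
by apply/cvg_ex; exists `|f x|.
Unshelve. all: by end_near. Qed.

End averages.

(** * Weak derivatives *)

Section weak_derivatives.
Context {R : realType} (I : set R) (oI : open I) (iI : is_interval I).
Local Notation mu := (@lebesgue_measure R).
Local Notation test := (test_function I).
Local Notation L2 := (L2 I).
Local Notation L2norm := (L2norm I).
Local Notation ip := (inner I).
Local Notation H1 := (H1 I).
Local Notation H10 := (H10 I).
Local Notation wderiv := (wderiv I).
Local Notation weak := (is_weak_derivative I).
Implicit Types (phi f g : R -> R) (x c d : R).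

Let mI : measurable I := open_measurable oI.

Lemma test_bump c d k : c < d -> `[c, d] `<=` I -> test (bump c d k).
Proof.
move=> cd cdI; apply: test_intro cdI; first exact: smooth_bump.
move=> x xcd; apply: bump_out => //; apply: contra xcd.
by rewrite !in_itv/= => /andP[/ltW -> /ltW ->].
Qed.

(** Bumps make all averages of [g] vanish. *)
Lemma test_orth0 g : L2 g -> (forall phi, test phi -> ip g phi = 0) ->
  {ae mu, forall x, I x -> g x = 0}.
Proof.
move=> g2 g0; have : {ae mu, forall x, I x -> `|g x| <= 0}.
  apply: (avg_bound oI (ltr01 : (0 : R) < 1)) => // c d cd _ cdI.
  rewrite mul0r normr_le0; apply/eqP.
  have <- := cvg_lim (@Rhausdorff R) (cvg_bump oI g2 cd).
  rewrite (_ : (fun k => _) = cst 0) ?lim_cst//.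
  by apply/funext => k; apply: g0; exact: test_bump.
by apply: aeS => x /[apply]; rewrite normr_le0 => /eqP.
Qed.

Lemma weak_unique f g g' : L2 g -> L2 g' -> weak f g -> weak f g' ->
  {ae mu, forall x, I x -> g x = g' x}.
Proof.
move=> g2 g'2 fg fg'.
have : {ae mu, forall x, I x -> (g - g') x = 0}.
  apply: test_orth0; first exact: L2B.
  move=> phi tphi; rewrite ipBl//; last exact: test_L2.
  by apply/eqP; rewrite subr_eq0 -eqr_opp; apply/eqP; rewrite -(fg _ tphi) (fg' _ tphi).
by apply: aeS => x /[apply] /eqP; rewrite !fctE subr_eq0 => /eqP.
Qed.

Lemma L2_wderiv f : L2 (wderiv f).
Proof.
rewrite /Defs.wderiv; case: xgetP => [g _ []//|_]; exact: L20.
Qed.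

Lemma weak_wderiv f : H1 f -> weak f (wderiv f).
Proof.
move=> [_ [g g2 fg]].
have [] // : (fun g => L2 g /\ weak f g) (wderiv f).
by apply: (@xgetPex _ (cst 0) [set g | L2 g /\ weak f g]); exists g.
Qed.

Lemma H1_L2 f : H1 f -> L2 f. Proof. by case. Qed.

Lemma H10_H1 f : H10 f -> H1 f. Proof. by case. Qed.

Lemma H1_intro f g : L2 f -> L2 g -> weak f g -> H1 f.
Proof. by move=> f2 g2 fg; split => //; exists g. Qed.

Lemma wderiv_ae f g : L2 g -> weak f g -> L2 f ->
  {ae mu, forall x, I x -> wderiv f x = g x}.
Proof.
move=> g2 fg f2; apply: (weak_unique (L2_wderiv f) g2 _ fg).
exact/weak_wderiv/(H1_intro f2 g2 fg).
Qed.

Lemma L2norm_ae f g : {ae mu, forall x, I x -> f x = g x} -> L2 f -> L2 g ->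
  L2norm f = L2norm g.
Proof.
move=> fg f2 g2; apply/eqP; rewrite -(@eqrXn2 _ 2)// ?L2norm_ge0//.
rewrite !L2norm_sqr//; apply/eqP.
by rewrite (ip_ae mI f2 g2 f2 fg) ipC (ip_ae mI f2 g2 g2 fg).
Qed.

Lemma weakB f g f' g' : L2 f -> L2 g -> L2 f' -> L2 g' ->
  weak f f' -> weak g g' -> weak (f - g) (f' - g').
Proof.
move=> f2 g2 f'2 g'2 ff' gg' phi tphi.
have p2 := test_L2 oI tphi; have p'2 := test_L2 oI (test_derive tphi).
have Hf : ip f (derive1 phi) = - ip f' phi := ff' _ tphi.
have Hg : ip g (derive1 phi) = - ip g' phi := gg' _ tphi.
have -> : \int[mu]_(x in I) ((f - g) x * derive1 phi x) = ip (f - g) (derive1 phi) by [].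
have -> : \int[mu]_(x in I) ((f' - g') x * phi x) = ip (f' - g') phi by [].
by rewrite !ipBl// Hf Hg; ring.
Qed.

Lemma weakD f g f' g' : L2 f -> L2 g -> L2 f' -> L2 g' ->
  weak f f' -> weak g g' -> weak (f + g) (f' + g').
Proof.
move=> f2 g2 f'2 g'2 ff' gg' phi tphi.
have p2 := test_L2 oI tphi; have p'2 := test_L2 oI (test_derive tphi).
have Hf : ip f (derive1 phi) = - ip f' phi := ff' _ tphi.
have Hg : ip g (derive1 phi) = - ip g' phi := gg' _ tphi.
have -> : \int[mu]_(x in I) ((f + g) x * derive1 phi x) = ip (f + g) (derive1 phi) by [].
have -> : \int[mu]_(x in I) ((f' + g') x * phi x) = ip (f' + g') phi by [].
by rewrite !ipDl// Hf Hg; ring.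
Qed.

Lemma weak_ae f g h : L2 f -> L2 g -> {ae mu, forall x, I x -> f x = g x} ->
  weak f h -> weak g h.
Proof.
move=> f2 g2 fg fh phi tphi.
have p'2 := test_L2 oI (test_derive tphi).
have Hf : ip f (derive1 phi) = - ip h phi := fh _ tphi.
have -> : \int[mu]_(x in I) (h x * phi x) = ip h phi by [].
by rewrite -Hf; exact/esym/(ip_ae mI f2 g2 p'2 fg).
Qed.

(** Almost everywhere equal functions have the same set of weak derivatives, and
the representative is chosen as a function of that set. *)
Lemma wderiv_congr f g : L2 f -> L2 g -> {ae mu, forall x, I x -> f x = g x} ->
  wderiv f = wderiv g.
Proof.
move=> f2 g2 fg; rewrite /Defs.wderiv; congr xget; apply/seteqP.
have gf : {ae mu, forall x, I x -> g x = f x} by apply: aeS fg => x H /H.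
by split=> h [h2 hw]; split => //; [exact: weak_ae fg hw|exact: weak_ae gf hw].
Qed.

Lemma H1B f g : H1 f -> H1 g -> H1 (f - g).
Proof.
move=> f1 g1; have [f2 g2] := (H1_L2 f1, H1_L2 g1).
apply: (@H1_intro _ (wderiv f - wderiv g)); [exact: L2B|exact: L2B (L2_wderiv _) (L2_wderiv _)|].
by apply: weakB => //; do ?[exact: L2_wderiv|exact: weak_wderiv].
Qed.

Lemma wderivB f g : H1 f -> H1 g ->
  {ae mu, forall x, I x -> wderiv (f - g) x = (wderiv f - wderiv g) x}.
Proof.
move=> f1 g1; have [f2 g2] := (H1_L2 f1, H1_L2 g1).
apply: wderiv_ae; [exact: L2B (L2_wderiv _) (L2_wderiv _)| |exact: L2B].
by apply: weakB => //; do ?[exact: L2_wderiv|exact: weak_wderiv].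
Qed.

Lemma weak_wderivB f g : H1 f -> H1 g -> H1 (wderiv f) -> H1 (wderiv g) ->
  weak (wderiv (f - g)) (wderiv (wderiv f) - wderiv (wderiv g)).
Proof.
move=> f1 g1 f'1 g'1.
have w := weakB (L2_wderiv f) (L2_wderiv g) (L2_wderiv (wderiv f)) (L2_wderiv (wderiv g))
  (weak_wderiv f'1) (weak_wderiv g'1).
apply: weak_ae w; [exact: L2B (L2_wderiv _) (L2_wderiv _)|exact: L2_wderiv|].
by apply: aeS (wderivB f1 g1) => x H /H.
Qed.

Lemma H1_wderivB f g : H1 f -> H1 g -> H1 (wderiv f) -> H1 (wderiv g) -> H1 (wderiv (f - g)).
Proof.
move=> f1 g1 f'1 g'1; apply: H1_intro (weak_wderivB f1 g1 f'1 g'1); first exact: L2_wderiv.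
exact: L2B (L2_wderiv _) (L2_wderiv _).
Qed.

Lemma L2norm_wderiv2B f g : H1 f -> H1 g -> H1 (wderiv f) -> H1 (wderiv g) ->
  L2norm (wderiv (wderiv (f - g))) = L2norm (wderiv (wderiv f) - wderiv (wderiv g)).
Proof.
move=> f1 g1 f'1 g'1; have d2 := L2B (L2_wderiv (wderiv f)) (L2_wderiv (wderiv g)).
by apply: L2norm_ae => //; [apply: wderiv_ae d2 (weak_wderivB _ _ _ _) _ => //|];
  exact: L2_wderiv.
Qed.

Lemma testM phi psi : smooth phi -> test psi -> test (phi * psi).
Proof.
move=> sphi tpsi; have [dpsi cpsi psiI] := tpsi.
have S : closure [set x | (phi * psi) x != 0] `<=` closure [set x | psi x != 0].
  apply: closure_subset => x /=; apply: contraNneq => psi0.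
  by rewrite !fctE psi0 mulr0.
split; [exact/smooth_derivable/smoothM/test_smooth/tpsi| |exact: subset_trans psiI].
by apply: subclosed_compact S; [exact: closed_closure|].
Qed.

Lemma int_derive_test phi : test phi -> J I (derive1 phi) = 0.
Proof.
move=> tphi; have t' := test_derive tphi.
have [[p Ip]|NI] := pselect (I !=set0); last first.
  rewrite /J (_ : I = set0) ?Rintegral_set0//.
  by apply/seteqP; split => // x Ix; apply: NI; exists x.
have [c [d [cp pd Ic Id phi0]]] := test_supp oI tphi Ip Ip.
have cd := lt_trans cp pd.
have D y : is_derive y (1 : R) phi (derive1 phi y) := test_is_derive y tphi.
have phic : phi c = 0 by apply: phi0; rewrite in_itv/= ltxx.
have phid : phi d = 0 by apply: phi0; rewrite in_itv/= ltxx andbF.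
have F : \int[mu]_(y in `[c, d]) derive1 phi y = 0.
  rewrite /Rintegral (@continuous_FTC2 _ _ phi)//.
  - by rewrite phic phid /= subrr.
  - by apply: continuous_subspaceT; exact: test_continuous t'.
  - split.
    + by move=> y _; case: (D y).
    + by apply: cvg_at_right_filter; exact: (is_derive_continuous D).
    + by apply: cvg_at_left_filter; exact: (is_derive_continuous D).
have cdI : `[c, d] `<=` I.
  by move=> y /=; rewrite in_itv/= => /andP[cy yd]; apply: (iI Ic Id); rewrite cy.
rewrite -F (Rintegral_indic _ cdI); congr J; apply/funext => y.
rewrite !fctE indicE; have [yc|yc] := boolP (y \in _); first by rewrite mul1r.
rewrite mul0r derive1E (@near_eq_derive _ _ _ _ (cst 0)) ?derive_cst//.
have : nbhs y (~` `[c, d]).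
  apply: open_nbhs_nbhs; split; first exact/closed_openC/itv_closed.
  by move=> H; move/negP: yc; apply; exact/mem_set.
apply: filterS => z Nz; apply: phi0; apply/negP; rewrite in_itv/= => /andP[cz zd].
by apply: Nz; rewrite /= in_itv/= !ltW.
Qed.

Lemma derive1_test_M phi psi : test phi -> test psi ->
  derive1 (phi * psi) = derive1 phi * psi + phi * derive1 psi.
Proof.
move=> tphi tpsi; apply/funext => x; rewrite derive1E.
have H1' := test_is_derive x tphi; have H2' := test_is_derive x tpsi.
have [_ ->] := is_deriveM H1' H2'.
by rewrite /GRing.scale/= !fctE/=; ring.
Qed.

Lemma weak_test phi : test phi -> weak phi (derive1 phi).
Proof.
move=> tphi psi tpsi.
have [t1 t2] := (test_derive tphi, test_derive tpsi).
have [p2 q2] := (test_L2 oI tphi, test_L2 oI tpsi).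
have [p2' q2'] := (test_L2 oI t1, test_L2 oI t2).
have -> : \int[mu]_(x in I) (phi x * derive1 psi x) = ip phi (derive1 psi) by [].
have -> : \int[mu]_(x in I) (derive1 phi x * psi x) = ip (derive1 phi) psi by [].
have := int_derive_test (testM (test_smooth tphi) tpsi).
rewrite derive1_test_M// JD//; [|exact: L2M|exact: L2M].
by rewrite -!/(inner _ _ _) => /eqP; rewrite addrC addr_eq0 => /eqP.
Qed.

Lemma H1_test phi : test phi -> H1 phi.
Proof.
move=> tphi; apply: (@H1_intro _ (derive1 phi)); first exact: test_L2.
  by apply/test_L2/test_derive.
exact: weak_test.
Qed.

Lemma L2norm_le_H1norm f : L2norm f <= H1norm I f.
Proof.
rewrite /H1norm -[leLHS](@ger0_norm _ (L2norm f)) ?L2norm_ge0// -sqrtr_sqr.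
by rewrite ler_wsqrtr// lerDl sqr_ge0.
Qed.

Lemma L2norm_wderiv_le_H1norm f : L2norm (wderiv f) <= H1norm I f.
Proof.
rewrite /H1norm -[leLHS](@ger0_norm _ (L2norm (wderiv f))) ?L2norm_ge0// -sqrtr_sqr.
by rewrite ler_wsqrtr// lerDr sqr_ge0.
Qed.

Lemma L2norm_wderivB f g : H1 f -> H1 g ->
  L2norm (wderiv (f - g)) = L2norm (wderiv f - wderiv g).
Proof.
by move=> f1 g1; apply: L2norm_ae (wderivB f1 g1) (L2_wderiv _) _;
  exact: L2B (L2_wderiv _) (L2_wderiv _).
Qed.

Lemma H10_approx f e : H10 f -> 0 < e ->
  exists phi, [/\ test phi, L2norm (f - phi) < e & L2norm (wderiv f - derive1 phi) < e].
Proof.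
move=> [f1 H] e0; have [phi tphi Hphi] := H _ e0.
exists phi; split => //; first exact: le_lt_trans (L2norm_le_H1norm _) Hphi.
have p1 := H1_test tphi; have t' := test_derive tphi.
have := le_lt_trans (L2norm_wderiv_le_H1norm _) Hphi.
rewrite L2norm_wderivB//; congr (_ < _); apply: L2norm_ae.
- have := wderiv_ae (test_L2 oI t') (weak_test tphi) (test_L2 oI tphi).
  by apply: aeS => x /[apply]; rewrite !fctE => ->.
- exact: L2B (L2_wderiv _) (L2_wderiv _).
- by apply: (L2B (L2_wderiv _)); exact: test_L2.
Qed.

(** Both terms are continuous in [f] for the H1 norm. *)
Lemma H10_limit A B : L2 A -> L2 B ->
  (forall phi, test phi -> ip A (derive1 phi) + ip B phi = 0) ->
  forall f, H10 f -> ip A (wderiv f) + ip B f = 0.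
Proof.
move=> A2 B2 AB f f10; have f2 := H1_L2 (H10_H1 f10).
apply/eqP; rewrite -normr_le0; apply/ler_addgt0Pl => e e0; rewrite addr0.
have K0 : 0 < L2norm A + L2norm B + 1 by rewrite ltr_wpDl// addr_ge0 ?L2norm_ge0.
have [phi [tphi p1 p2]] := H10_approx f10 (divr_gt0 e0 K0).
have [q1 q2] := (test_L2 oI tphi, test_L2 oI (test_derive tphi)).
have -> : ip A (wderiv f) + ip B f = ip A (wderiv f - derive1 phi) + ip B (f - phi).
  rewrite !ipBr//; last exact: L2_wderiv.
  by apply/eqP; rewrite -subr_eq0; have := AB _ tphi; set X := ip A (derive1 phi);
    set Y := ip B phi => XY; apply/eqP; rewrite -XY; ring.
rewrite (le_trans (ler_normD _ _))//.
have H1' := ip_le mI A2 (L2B (L2_wderiv f) q2).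
have H2' := ip_le mI B2 (L2B f2 q1).
rewrite (le_trans (lerD H1' H2'))//.
rewrite (le_trans (lerD (ler_wpM2l (L2norm_ge0 _ _) (ltW p2)) (ler_wpM2l (L2norm_ge0 _ _) (ltW p1))))//.
rewrite -mulrDl mulrA ler_pdivrMr// mulrC ler_wpM2l ?ltW//.
by rewrite ltrDl.
Qed.

(** Integration by parts; the boundary term vanishes as one factor is a limit of
test functions. *)
Lemma ibp f g : H10 f -> H1 g -> ip f (wderiv g) = - ip (wderiv f) g.
Proof.
move=> f10 g1; have g2 := H1_L2 g1.
have H phi : test phi -> ip g (derive1 phi) + ip (wderiv g) phi = 0.
  by move=> tphi; apply/eqP; rewrite addr_eq0; apply/eqP; exact: (weak_wderiv g1 tphi).
have := H10_limit g2 (L2_wderiv g) H f10.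
by rewrite ipC (ipC I (wderiv g)) addrC => /eqP; rewrite addr_eq0 => /eqP.
Qed.

Lemma H10B f g : H10 f -> H10 g -> H10 (f - g).
Proof.
move=> f10 g10; have [f1 g1] := (H10_H1 f10, H10_H1 g10).
split; first exact: H1B.
move=> e e0; have e4 : 0 < e / 4 by rewrite divr_gt0.
have [phi [tp p1 p2]] := H10_approx f10 e4.
have [psi [tq q1 q2]] := H10_approx g10 e4.
have tpq : test (phi - psi).
  rewrite -[- psi]scaleN1r -[-1 *: psi]/(cst (-1) * psi).
  have [d1 c1 i1] := tp.
  have [_ c2 i2] := testM (smooth_cst (-1)) tq.
  have S : closure [set x | (phi + cst (-1) * psi) x != 0] `<=`
      closure [set x | phi x != 0] `|` closure [set x | (cst (-1) * psi) x != 0].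
    rewrite -closureU; apply: closure_subset => x /= pq.
    have [p0|] := eqVneq (phi x) 0; last by left.
    by right; move: pq; rewrite !fctE p0 add0r.
  split.
  - apply: smooth_derivable; apply: smoothD; first exact: test_smooth tp.
    by apply: smoothM; [exact: smooth_cst|exact: test_smooth tq].
  - by apply: subclosed_compact S; [exact: closed_closure|exact: compactU].
  - by apply: subset_trans S _; rewrite subUset.
exists (phi - psi) => //.
have [f2 g2] := (H1_L2 f1, H1_L2 g1); have [h1 h2] := (test_L2 oI tp, test_L2 oI tq).
have [h1' h2'] := (test_L2 oI (test_derive tp), test_L2 oI (test_derive tq)).
have N1 : L2norm (f - g - (phi - psi)) < e / 2.
  have -> : f - g - (phi - psi) = (f - phi) + - (g - psi) by ring.
  rewrite (le_lt_trans (L2norm_triangle mI _ _))//; [exact: L2B|apply: L2N => //; exact: L2B|].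
  by rewrite L2normN; lra.
have N2 : L2norm (wderiv (f - g - (phi - psi))) < e / 2.
  have dpq : {ae mu, forall x, I x -> wderiv (f - g - (phi - psi)) x =
      ((wderiv f - derive1 phi) + - (wderiv g - derive1 psi)) x}.
    apply: wderiv_ae.
    - by apply: L2D => //; [|apply: L2N => //]; apply: L2B => //; exact: L2_wderiv.
    - have -> : wderiv f - derive1 phi + - (wderiv g - derive1 psi) =
         (wderiv f - wderiv g) - (derive1 phi - derive1 psi) by ring.
      apply: weakB; do ?[exact: L2B|exact: L2_wderiv|apply: L2B => //; exact: L2_wderiv].
        by apply: weakB => //; do ?[exact: L2_wderiv|exact: weak_wderiv].
      by apply: weakB => //; exact: weak_test.
    - by apply: L2B => //; exact: L2B.
  rewrite (L2norm_ae dpq (L2_wderiv _)); last first.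
    by apply: L2D => //; [|apply: L2N => //]; apply: L2B => //; exact: L2_wderiv.
  rewrite (le_lt_trans (L2norm_triangle mI _ _))//.
  - by apply: L2B => //; exact: L2_wderiv.
  - by apply: L2N => //; apply: L2B => //; exact: L2_wderiv.
  by rewrite L2normN; lra.
rewrite /H1norm -[ltRHS](@gtr0_norm _ e)// -sqrtr_sqr ltr_sqrt ?exprn_gt0//.
have := L2norm_ge0 I (f - g - (phi - psi)).
have := L2norm_ge0 I (wderiv (f - g - (phi - psi))).
by move: N1 N2; set X := L2norm _; set Y := L2norm _; nra.
Qed.

Lemma test_bounded phi : test phi -> exists2 M, 0 <= M & forall x, I x -> `|phi x| <= M.
Proof.
move=> tphi; exists (Num.sqrt (2 * (L2norm phi * L2norm (derive1 phi)))); first exact: sqrtr_ge0.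
by move=> x Ix; rewrite -sqrtr_sqr ler_wsqrtr//; exact: test_sqr_le.
Qed.

Lemma L2_testM phi f : test phi -> L2 f -> L2 (phi * f).
Proof.
move=> tphi f2; have [M M0 HM] := test_bounded tphi.
apply: (L2_mulB mI (L2_measurable mI (test_L2 oI tphi)) _ f2).
by apply: aeW; exact: HM.
Qed.

(** For a test function [g] the product rule is the definition of the weak
derivative of [f] tested against [phi * g]; the general case follows by density. *)
Lemma weakM f g : H1 f -> H10 g -> weak (f * g) (wderiv f * g + f * wderiv g).
Proof.
move=> f1 g10 phi tphi; have f2 := H1_L2 f1; have g2 := H1_L2 (H10_H1 g10).
have t' := test_derive tphi.
have A2 : L2 (phi * f) by exact: L2_testM.
have B2 : L2 (derive1 phi * f + phi * wderiv f).
  by apply: L2D => //; apply: L2_testM => //; exact: L2_wderiv.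
have H psi : test psi -> ip (phi * f) (derive1 psi) + ip (derive1 phi * f + phi * wderiv f) psi = 0.
  move=> tpsi; have tt := testM (test_smooth tphi) tpsi.
  have := weak_wderiv f1 tt.
  rewrite -/(J I (f * derive1 (phi * psi))) -/(J I (wderiv f * (phi * psi))).
  rewrite derive1_test_M// mulrDr.
  have [p2 p2'] := (test_L2 oI tpsi, test_L2 oI (test_derive tpsi)).
  have -> : f * (derive1 phi * psi) + f * (phi * derive1 psi) =
     (derive1 phi * f) * psi + (phi * f) * derive1 psi by ring.
  have -> : wderiv f * (phi * psi) = (phi * wderiv f) * psi by ring.
  have B21 : L2 (derive1 phi * f) by exact: L2_testM.
  have B22 : L2 (phi * wderiv f) by apply: L2_testM => //; exact: L2_wderiv.
  rewrite JD//; [|exact: L2M|exact: L2M]; rewrite -!/(inner _ _ _) ipDl//.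
  by move=> E; rewrite addrA [X in X + _]addrC E addNr.
have := H10_limit A2 B2 H g10.
rewrite /inner -JD//; [|by apply: L2M => //; exact: L2_wderiv|exact: L2M] => E.
rewrite -/(J I (f * g * derive1 phi)) -/(J I ((wderiv f * g + f * wderiv g) * phi)).
apply/eqP; rewrite -addr_eq0 -JD//.
- by rewrite -E; apply/eqP; congr J; ring.
- have -> : f * g * derive1 phi = (derive1 phi * f) * g by ring.
  by apply: L2M => //; exact: L2_testM.
- have -> : (wderiv f * g + f * wderiv g) * phi = (phi * wderiv f) * g + (phi * f) * wderiv g by ring.
  apply: L1D => //; apply: L2M => //; do ?exact: L2_wderiv.
  by apply: L2_testM => //; exact: L2_wderiv.
Qed.

Lemma ip_itv_le f K c d : c < d -> `]c, d[ `<=` I -> 0 <= K -> L2 f ->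
  (forall x, I x -> `|f x| <= K) -> `|ip f \1_`]c, d[ | <= K * (d - c).
Proof.
move=> cd cdI K0 f2 fK; have i2 := L2_itv oI c d.
have -> : ip f \1_`]c, d[ = ip (f * \1_`]c, d[) \1_`]c, d[.
  rewrite /inner -mulrA (_ : \1_`]c, d[ * \1_`]c, d[ = \1_`]c, d[)//.
  apply/funext => x; rewrite [LHS]/GRing.mul/= indicE.
  by case: (_ \in _); rewrite ?mulr1 ?mulr0.
have mf := L2_measurable mI f2; have fK' := aeW fK.
rewrite (le_trans (ip_le mI (L2_mulB mI mf fK' i2) i2))//.
rewrite (le_trans (ler_wpM2r (L2norm_ge0 _ _) (L2norm_mulB mI mf K0 fK' i2)))//.
by rewrite -mulrA -expr2 L2norm_itv// sqr_sqrtr// subr_ge0 ltW.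
Qed.

(** The parameter [l] balances the two norms; the choice of [l] that optimizes the
bound gives the multiplicative form of the inequality. For a test function it
follows from [test_sqr_le], and averages over intervals pass to the limit. *)
Lemma H10_sup f (l : R) : H10 f -> 0 < l ->
  {ae mu, forall x, I x -> `|f x| <= l * L2norm f + l^-1 * L2norm (wderiv f)}.
Proof.
move=> f10 l0; have f2 := H1_L2 (H10_H1 f10).
apply: (avg_bound oI (ltr01 : (0 : R) < 1)) => // c d cd _ cdI.
have cdI' : `]c, d[ `<=` I by apply: subset_trans cdI; exact: subset_itv_oo_cc.
set N := L2norm f; set N' := L2norm (wderiv f).
apply/ler_addgt0Pl => e e0.
pose K := Num.sqrt (d - c) + (l + l^-1) * (d - c).
have K0 : 0 < K.
  rewrite ltr_wpDl ?sqrtr_ge0// mulr_gt0 ?subr_gt0// addr_gt0// invr_gt0//.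
have [phi [tphi p1 p2]] := H10_approx f10 (divr_gt0 e0 K0).
set e' := e / K in p1 p2.
have [q1 q2] := (test_L2 oI tphi, test_L2 oI (test_derive tphi)).
have i2 := L2_itv oI c d; have w2 := L2_wderiv f.
have n1 : L2norm phi <= N + e'.
  have -> : phi = f + - (f - phi) by ring.
  rewrite (le_trans (L2norm_triangle mI f2 _))//; first by apply: L2N => //; exact: L2B.
  by rewrite lerD2l L2normN ltW.
have n2 : L2norm (derive1 phi) <= N' + e'.
  have -> : derive1 phi = wderiv f + - (wderiv f - derive1 phi) by ring.
  rewrite (le_trans (L2norm_triangle mI w2 _))//; first by apply: L2N => //; exact: L2B.
  by rewrite lerD2l L2normN ltW.
have supphi x : I x -> `|phi x| <= l * L2norm phi + l^-1 * L2norm (derive1 phi).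
  move=> Ix; rewrite -ler_sqr ?nnegrE// ?addr_ge0 ?mulr_ge0 ?L2norm_ge0 ?invr_ge0 ?(ltW l0)//.
  rewrite real_normK ?num_real// (le_trans (test_sqr_le oI iI tphi Ix))//.
  rewrite sqrrD.
  have -> : l * L2norm phi * (l^-1 * L2norm (derive1 phi)) = L2norm phi * L2norm (derive1 phi).
    by field; rewrite gt_eqF.
  have := sqr_ge0 (l * L2norm phi); have := sqr_ge0 (l^-1 * L2norm (derive1 phi)).
  by lra.
have -> : ip f \1_`]c, d[ = ip (f - phi) \1_`]c, d[ + ip phi \1_`]c, d[.
  by rewrite ipBl// subrK.
have B1 := ip_le mI (L2B f2 q1) i2; rewrite L2norm_itv// in B1.
have B2 : `|ip phi \1_`]c, d[ | <= (l * L2norm phi + l^-1 * L2norm (derive1 phi)) * (d - c).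
  apply: ip_itv_le => //; rewrite addr_ge0// mulr_ge0 ?L2norm_ge0 ?invr_ge0 ?(ltW l0)//.
rewrite (le_trans (ler_normD _ _))// (le_trans (lerD B1 B2))//.
have eK : e = e' * Num.sqrt (d - c) + (l * e' + l^-1 * e') * (d - c).
  have e'K : e' * K = e by rewrite divfK// gt_eqF.
  by rewrite -{1}e'K /K; ring.
rewrite {1}eK -addrA lerD// ?ler_wpM2r ?sqrtr_ge0 ?(ltW p1)//.
rewrite -mulrDl ler_wpM2r ?subr_ge0 ?(ltW cd)//.
have l'0 : 0 < l^-1 by rewrite invr_gt0.
have := ler_wpM2l (ltW l0) n1; have := ler_wpM2l (ltW l'0) n2.
by rewrite !mulrDr; lra.
Qed.

End weak_derivatives.

(** * Uniform bounds on derivatives *)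

Section bump_primitive.
Context {R : realType}.
Local Notation mu := (@lebesgue_measure R).
Implicit Types c d x z : R.

Definition prim_bump c d k z := \int[mu]_(x in `]-oo, z]) bump c d k x.

Lemma continuous_bump c d k : continuous (bump c d k).
Proof. by have [g bg _] := smooth_bump c d k 1%N; exact: is_derive_continuous bg. Qed.

Lemma integrable_bump c d k : c < d -> mu.-integrable setT (EFin \o bump c d k).
Proof.
move=> cd; have := integrable_indic_itv c d false true.
apply: le_integrable => //.
  apply/measurable_EFinP; apply: continuous_measurable_fun; exact: continuous_bump.
move=> x _ /=; rewrite lee_fin indicE; have [xcd|xcd] := boolP (x \in _).
  by rewrite normr1 ger0_norm ?bump_ge0// bump_le1.
by rewrite bump_out ?normr0//; apply: contra xcd => xcd; apply/mem_set.
Qed.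

Lemma integrable_bumpS (A : set R) c d k : c < d -> measurable A ->
  mu.-integrable A (EFin \o bump c d k).
Proof.
move=> cd mA.
exact: (@integrableS _ _ _ mu setT A _ measurableT mA (@subsetT _ _) (integrable_bump k cd)).
Qed.

Lemma is_derive_prim_bump c d k z : c < d ->
  is_derive z (1 : R) (prim_bump c d k) (bump c d k z).
Proof.
move=> cd; have z1 : z < z + 1 by rewrite ltrDl.
have [|||d1 d2] := @continuous_FTC1 R (bump c d k) -oo%O z (z + 1) z1.
- by apply: integrable_bumpS.
- by rewrite ltNyr.
- exact: (@continuous_bump c d k z).
by split; [exact: d1|rewrite -derive1E; exact: d2].
Qed.

Lemma prim_bump_ge0 c d k z : c < d -> 0 <= prim_bump c d k z.
Proof. by move=> cd; apply: Rintegral_ge0 => x _; exact: bump_ge0. Qed.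

Lemma prim_bump_le c d k z : c < d -> prim_bump c d k z <= \int[mu]_x bump c d k x.
Proof.
move=> cd; rewrite /prim_bump Rintegral_mkcond; apply: le_Rintegral => //.
- rewrite -restrict_EFin; apply/integrable_restrict => //.
  by apply: integrable_bumpS => //; exact: measurableI.
- exact: integrable_bump.
- by move=> x _; rewrite /patch; case: ifP => // _; exact: bump_ge0.
Qed.

Lemma prim_bump_left c d k z : c < d -> z <= c -> prim_bump c d k z = 0.
Proof.
move=> cd zc; rewrite /prim_bump (@eq_Rintegral _ _ _ _ _ (cst 0)) ?Rintegral_cst ?mul0r//.
move=> x; rewrite inE/= in_itv/= => xz; apply: bump_out => //.
by rewrite in_itv/= ltNge (le_trans xz zc).
Qed.

Lemma prim_bump_right c d k z : c < d -> d <= z ->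
  prim_bump c d k z = \int[mu]_x bump c d k x.
Proof.
move=> cd dz; rewrite /prim_bump Rintegral_mkcond; apply: eq_Rintegral => x _.
rewrite /patch; case: ifPn => // xz; rewrite bump_out//.
apply: contra xz => /=; rewrite in_itv/= => /andP[_ xd]; apply/mem_set.
by rewrite /= in_itv/= (le_trans _ dz)// ltW.
Qed.

End bump_primitive.

#[global] Opaque prim_bump.

Section gagliardo_nirenberg.
Context {R : realType} (I : set R) (oI : open I) (iI : is_interval I).
Local Notation mu := (@lebesgue_measure R).
Local Notation test := (test_function I).
Local Notation L2 := (L2 I).
Local Notation L2norm := (L2norm I).
Local Notation ip := (inner I).
Local Notation H1 := (H1 I).
Local Notation H10 := (H10 I).
Local Notation wderiv := (wderiv I).
Implicit Types (phi f g a : R -> R) (x c d p q s : R).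

Let mI : measurable I := open_measurable oI.

(** The mass of a bump, as a pairing to which [cvg_bump] applies. *)
Lemma int_bump_ip c d p q k : p < q -> c <= p -> q <= d -> `]c, d[ `<=` I ->
  \int[mu]_x bump p q k x = ip \1_`]c, d[ (bump p q k).
Proof.
move=> pq cp qd cdI; rewrite /inner /J [RHS]Rintegral_mkcond.
apply: eq_Rintegral => x _; rewrite /patch.
have -> : (\1_`]c, d[ * bump p q k) x = (x \in `]c, d[%classic)%:R * bump p q k x.
  by rewrite -indicE.
have [xpq|xpq] := boolP (x \in `]p, q[); last by rewrite bump_out// mulr0; case: ifP.
have xcd : `]c, d[%classic x.
  move: xpq; rewrite /= !in_itv/= => /andP[px xq].
  by rewrite (le_lt_trans cp px) (lt_le_trans xq qd).
by rewrite !mem_set//; [rewrite mul1r|exact: cdI].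
Qed.

Lemma cross_le (A B Z Z' : R) : 0 <= A -> A <= Z -> 0 <= B -> B <= Z' ->
  `|Z' * A - Z * B| <= Z * Z'.
Proof.
move=> A0 AZ B0 BZ.
have Z0 := le_trans A0 AZ; have Z'0 := le_trans B0 BZ.
have := ler_wpM2l Z'0 AZ; have := mulr_ge0 Z'0 A0.
have := ler_wpM2l Z0 BZ; have := mulr_ge0 Z0 B0.
by move=> *; rewrite ler_norml; apply/andP; split; lra.
Qed.

(** The difference of two normalized bumps has a compactly supported primitive. It is
a test function, so that the weak derivative of [f] bounds the difference between the
averages of [f] over the two intervals. *)
Lemma avg_oscillation f c d p q : H1 f -> p < q -> c <= p -> q <= d -> `[c, d] `<=` I ->
  `|(d - c) * ip f \1_`]p, q[ - (q - p) * ip f \1_`]c, d[ | <=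
    L2norm (wderiv f) * ((q - p) * (d - c) * Num.sqrt (d - c)).
Proof.
move=> f1 pq cp qd cdI; have f2 := H1_L2 f1.
have cd : c < d by apply: le_lt_trans cp _; exact: lt_le_trans pq qd.
have cdI' : `]c, d[ `<=` I by apply: subset_trans cdI; exact: subset_itv_oo_cc.
have i2 := L2_itv oI c d; have j2 := L2_itv oI p q.
have [Z1 Z1E] : exists Z : nat -> R, forall k, Z k = ip \1_`]c, d[ (bump p q k).
  by exists (fun k => ip \1_`]c, d[ (bump p q k)) => k; exact: erefl.
have [Z2 Z2E] : exists Z : nat -> R, forall k, Z k = ip \1_`]c, d[ (bump c d k).
  by exists (fun k => ip \1_`]c, d[ (bump c d k)) => k; exact: erefl.
have cZ1 : Z1 k @[k --> \oo] --> q - p.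
  rewrite (funext Z1E).
  have -> : q - p = ip \1_`]c, d[ \1_`]p, q[.
    have -> : q - p = ip \1_`]p, q[ \1_`]p, q[.
      rewrite -L2norm_sqr// L2norm_itv ?sqr_sqrtr ?subr_ge0 ?(ltW pq)//.
      apply: subset_trans cdI' => x /=; rewrite !in_itv/= => /andP[px xq].
      by rewrite (le_lt_trans cp px) (lt_le_trans xq qd).
    rewrite /inner; congr J; apply/funext => x; rewrite !fctE !indicE.
    have [/set_mem xpq|] := boolP (x \in `]p, q[%classic); last by rewrite !mulr0.
    rewrite !mulr1 mem_set//; move: xpq; rewrite /= !in_itv/= => /andP[px xq].
    by rewrite (le_lt_trans cp px) (lt_le_trans xq qd).
  exact: cvg_bump.
have cZ2 : Z2 k @[k --> \oo] --> d - c.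
  rewrite (funext Z2E).
  have -> : d - c = ip \1_`]c, d[ \1_`]c, d[.
    by rewrite -L2norm_sqr// L2norm_itv ?sqr_sqrtr ?subr_ge0 ?(ltW cd).
  exact: cvg_bump.
have main k : `|Z2 k * ip f (bump p q k) - Z1 k * ip f (bump c d k)| <=
    L2norm (wderiv f) * (Z1 k * Z2 k * Num.sqrt (d - c)).
  have ZE1 : Z1 k = \int[mu]_x bump p q k x by rewrite Z1E (@int_bump_ip c d).
  have ZE2 : Z2 k = \int[mu]_x bump c d k x by rewrite Z2E (@int_bump_ip c d).
  pose psi : R -> R := Z2 k *: bump p q k - Z1 k *: bump c d k.
  have [phi [phiE D]] : exists phi : R -> R,
      (forall x, phi x = Z2 k * prim_bump p q k x - Z1 k * prim_bump c d k x) /\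
      (forall x, is_derive x (1 : R) phi (psi x)).
    exists (Z2 k *: prim_bump p q k - Z1 k *: prim_bump c d k); split => // x.
    have H1' := is_derive_prim_bump k x pq; have H2' := is_derive_prim_bump k x cd.
    by apply: is_deriveB; apply: is_deriveZ.
  have dphi : derive1 phi = psi.
    by apply/funext => x; rewrite derive1E; case: (D x).
  have phi0 x : x \notin `]c, d[ -> phi x = 0.
    rewrite in_itv/= negb_and -!leNgt => /orP[xc|dx]; rewrite phiE.
      rewrite (prim_bump_left k pq (le_trans xc cp)) (prim_bump_left k cd xc).
      by rewrite !mulr0 subrr.
    rewrite (prim_bump_right k pq (le_trans qd dx)) (prim_bump_right k cd dx).
    by rewrite -ZE1 -ZE2 mulrC subrr.
  have sphi : smooth phi.
    move=> [//|n]; exists psi => //.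
    by apply: smoothD; [|rewrite -scaleNr]; apply: smoothZ; exact: smooth_bump.
  have tphi : test phi.
    apply: test_intro sphi _ cdI => x xcd; apply: phi0; apply: contra xcd.
    by rewrite !in_itv/= => /andP[/ltW -> /ltW ->].
  have Zge1 : 0 <= Z1 k by rewrite ZE1; apply: Rintegral_ge0 => x _; exact: bump_ge0.
  have Zge2 : 0 <= Z2 k by rewrite ZE2; apply: Rintegral_ge0 => x _; exact: bump_ge0.
  have phile x : I x -> `|phi x| <= Z1 k * Z2 k.
    move=> _; rewrite phiE ler_norml.
    rewrite -ler_norml; apply: cross_le; rewrite ?prim_bump_ge0//.
      by rewrite ZE1 prim_bump_le.
    by rewrite ZE2 prim_bump_le.
  have nphi : L2norm phi <= Z1 k * Z2 k * Num.sqrt (d - c).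
    have -> : phi = phi * \1_`]c, d[.
      apply/funext => x; rewrite !fctE indicE.
      have [|xcd] := boolP (x \in `]c, d[%classic); first by rewrite mulr1.
      by rewrite mulr0 phi0//; apply: contra xcd => xcd; apply/mem_set.
    rewrite -(L2norm_itv oI cd cdI'); apply: L2norm_mulB => //; last exact: aeW phile.
      exact: (L2_measurable mI (test_L2 oI tphi)).
    exact: mulr_ge0.
  have := weak_wderiv f1 tphi.
  rewrite -/(J I (f * derive1 phi)) -/(J I (wderiv f * phi)) -!/(inner _ _ _) dphi.
  have tb1 : test (bump p q k).
    apply: test_bump => // x /=; rewrite in_itv/= => /andP[px xq]; apply: cdI.
    by rewrite /= in_itv/= (le_trans cp px) (le_trans xq qd).
  have tb2 : test (bump c d k) by exact: test_bump.
  have [b1 b2] := (test_L2 oI tb1, test_L2 oI tb2).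
  rewrite /psi ipBr//; [|exact: L2Z|exact: L2Z].
  rewrite !ipZr// => ->; rewrite normrN.
  rewrite (le_trans (ip_le mI (L2_wderiv _ _) (test_L2 oI tphi)))//.
  by rewrite ler_wpM2l ?L2norm_ge0.
have cb1 := cvg_bump oI f2 pq; have cb2 := cvg_bump oI f2 cd.
have cL : `|Z2 k * ip f (bump p q k) - Z1 k * ip f (bump c d k)| @[k --> \oo] -->
    `|(d - c) * ip f \1_`]p, q[ - (q - p) * ip f \1_`]c, d[ |.
  by apply: cvg_norm; apply: cvgB; apply: cvgM.
have cR : L2norm (wderiv f) * (Z1 k * Z2 k * Num.sqrt (d - c)) @[k --> \oo] -->
    L2norm (wderiv f) * ((q - p) * (d - c) * Num.sqrt (d - c)).
  by apply: cvgM; [exact: cvg_cst|apply: cvgM; [exact: cvgM|exact: cvg_cst]].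
by apply: (ler_cvg_to cL cR); apply: nearW => k; exact: main.
Qed.

Lemma interval_segment p q : I p -> I q -> `[p, q] `<=` I.
Proof.
by move=> Ip Iq x /=; rewrite in_itv/= => /andP[px xq]; apply: (iI Ip Iq); rewrite px.
Qed.

(** Let [[p, q]] be a short interval. If [I] contains an interval of length [s ^+ 2] with
an end at [p] or [q] and containing [[p, q]], the average over that interval is bounded by
the norm of the derivative. Otherwise [I] is short, and the derivative of [a] has mean
zero on [I], up to the approximation of [a] by a test function. *)
Lemma gagliardo_nirenberg a s : H10 a -> H1 (wderiv a) -> 0 < s ->
  {ae mu, forall x, I x -> `|wderiv a x| <=
    s^-1 * L2norm (wderiv a) + 2 * s * L2norm (wderiv (wderiv a))}.
Proof.
move=> a10 f1 s0; set f := wderiv a in f1 *; have f2 := H1_L2 f1.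
set N := L2norm f; set N' := L2norm (wderiv f).
have N0 : 0 <= N by exact: L2norm_ge0.
have N'0 : 0 <= N' by exact: L2norm_ge0.
have d0 : 0 < s ^+ 2 by rewrite exprn_gt0.
apply: (avg_bound oI d0) => // p q pq qps pqI.
have qp0 : 0 < q - p by rewrite subr_gt0.
have Ip : I p by apply: pqI; rewrite /= in_itv/= lexx ltW.
have Iq : I q by apply: pqI; rewrite /= in_itv/= lexx ltW.
have long c d : c <= p -> q <= d -> I c -> I d -> d - c = s ^+ 2 ->
    `|ip f \1_`]p, q[ | <= (s^-1 * N + 2 * s * N') * (q - p).
  move=> cp qd Ic Id dcs; have cd : c < d by rewrite -subr_gt0 dcs.
  have cdI := interval_segment Ic Id.
  have cdI' : `]c, d[ `<=` I by apply: subset_trans cdI; exact: subset_itv_oo_cc.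
  have := avg_oscillation f1 pq cp qd cdI.
  have := ip_le mI f2 (L2_itv oI c d); rewrite L2norm_itv// dcs sqrtr_sqr (gtr0_norm s0).
  set A := ip _ _; set B := ip _ _; rewrite -/N -/N' => HA HB.
  have : s ^+ 2 * `|B| <= (q - p) * (N * s) + N' * ((q - p) * s ^+ 2 * s).
    rewrite -[s ^+ 2 in X in X <= _](gtr0_norm d0) -normrM.
    have -> : s ^+ 2 * B = (s ^+ 2 * B - (q - p) * A) + (q - p) * A by ring.
    rewrite (le_trans (ler_normD _ _))// [leRHS]addrC lerD//.
    by rewrite normrM (gtr0_norm qp0) ler_wpM2l ?(ltW qp0).
  rewrite -ler_pdivlMl// => /le_trans; apply.
  rewrite [X in X <= _](_ : _ = (s^-1 * N + s * N') * (q - p)); last by field; rewrite gt_eqF.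
  by rewrite ler_wpM2r ?(ltW qp0)// lerD2l ler_wpM2r// ler_pMl// ler1n.
have [Ips|NIps] := pselect (I (p + s ^+ 2)).
  by apply: (long p (p + s ^+ 2)) => //; [lra|ring].
have [Iqs|NIqs] := pselect (I (q - s ^+ 2)).
  by apply: (long (q - s ^+ 2) q) => //; [lra|ring].
have short c d : I c -> I d -> c <= p -> q <= d -> d - c <= (2 * s) ^+ 2.
  move=> Ic Id cp qd.
  have dp : d < p + s ^+ 2.
    rewrite ltNge; apply/negP => psd; apply: NIps; apply: (iI Ip Id).
    by rewrite psd lerDl ltW.
  have qc : q - s ^+ 2 < c.
    rewrite ltNge; apply/negP => cqs; apply: NIqs; apply: (iI Ic Iq).
    by rewrite cqs gerBl ltW.
  by lra.
apply/ler_addgt0Pl => e e0.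
have e'0 : 0 < e / (2 * s) by rewrite divr_gt0// mulr_gt0.
have [phi [tphi _ p2]] := H10_approx oI iI a10 e'0.
have [c [d [cp qd Ic Id phi0]]] := test_supp oI (test_derive tphi) Ip Iq.
have cd : c < d by rewrite (lt_trans cp)// (lt_trans pq).
have cdI := interval_segment Ic Id.
have cdI' : `]c, d[ `<=` I by apply: subset_trans cdI; exact: subset_itv_oo_cc.
have t' := test_derive tphi; have q2 := test_L2 oI t'; have i2 := L2_itv oI c d.
have mean0 : ip (derive1 phi) \1_`]c, d[ = 0.
  rewrite -(int_derive_test oI iI tphi) /inner; congr J; apply/funext => x.
  rewrite !fctE indicE; have [|xcd] := boolP (x \in `]c, d[%classic); first by rewrite mulr1.
  by rewrite mulr0 phi0//; apply: contra xcd => xcd; apply/mem_set.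
have w2 := L2_wderiv I a.
have HB : `|ip f \1_`]c, d[ | <= e / (2 * s) * Num.sqrt (d - c).
  have -> : ip f \1_`]c, d[ = ip (f - derive1 phi) \1_`]c, d[.
    by rewrite ipBl// mean0 subr0.
  rewrite (le_trans (ip_le mI (L2B f2 q2) i2))// L2norm_itv//.
  by rewrite ler_wpM2r ?sqrtr_ge0// ltW.
have dc2s : Num.sqrt (d - c) <= 2 * s.
  rewrite -[leRHS]gtr0_norm ?mulr_gt0// -sqrtr_sqr ler_wsqrtr//.
  by apply: short => //; exact: ltW.
have := avg_oscillation f1 pq (ltW cp) (ltW qd) cdI.
move: HB; set A := ip _ _; set B := ip _ _; rewrite -/N' => HB HA.
have dc0 : 0 < d - c by rewrite subr_gt0.
have S0 := sqrtr_ge0 (d - c); set S := Num.sqrt (d - c) in HA HB dc2s S0.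
have e1 : `|A| <= e.
  rewrite (le_trans HB)// (le_trans (ler_wpM2l (ltW e'0) dc2s))// divfK//.
  by rewrite gt_eqF// mulr_gt0.
have : (d - c) * `|B| <= (d - c) * (e + 2 * s * N' * (q - p)).
  rewrite -[X in X * `|B|](gtr0_norm dc0) -normrM.
  have -> : (d - c) * B = ((d - c) * B - (q - p) * A) + (q - p) * A by ring.
  rewrite (le_trans (ler_normD _ _))// [leRHS]mulrDr addrC lerD//.
    rewrite normrM (gtr0_norm qp0); apply: ler_pM => //; rewrite ?(ltW qp0)//.
    by apply: lerB; exact: ltW.
  rewrite (le_trans HA)//.
  have := mulr_ge0 (mulr_ge0 N'0 (ltW (mulr_gt0 qp0 dc0))) (_ : 0 <= 2 * s - S).
  by rewrite subr_ge0 => /(_ dc2s); lra.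
rewrite ler_pM2l// => /le_trans; apply; rewrite lerD2l ler_wpM2r ?(ltW qp0)//.
by rewrite lerDr mulr_ge0// invr_ge0 ltW.
Qed.

End gagliardo_nirenberg.

(** * Differentiation by regularization *)

Section scalar_calculus.
Context {R : realType}.
Implicit Types (f g : R -> R) (t h : R).

Lemma is_derive_lim f t l :
  h^-1 * (f (t + h) - f t) @[h --> (0 : R)^'] --> l -> is_derive t (1 : R) f l.
Proof.
have -> : (fun h : R => h^-1 * (f (t + h) - f t)) =
    (fun h : R => h^-1 *: ((f \o shift t) (h *: 1) - f t)).
  by apply/funext => h; rewrite /= [h *: 1]mulr1 (addrC t h).
by move=> H; split; [apply/cvg_ex; exists l|apply/cvg_lim].
Qed.

Lemma is_derive_cvg f t l : is_derive t (1 : R) f l ->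
  h^-1 * (f (t + h) - f t) @[h --> (0 : R)^'] --> l.
Proof.
have -> : (fun h : R => h^-1 * (f (t + h) - f t)) =
    (fun h : R => h^-1 *: ((f \o shift t) (h *: 1) - f t)).
  by apply/funext => h; rewrite /= [h *: 1]mulr1 (addrC t h).
by move=> [df <-].
Qed.

Lemma is_derive_shift f t h l : is_derive (t + h) (1 : R) f l ->
  is_derive t (1 : R) (fun s => f (s + h)) l.
Proof.
move=> H; have D : is_derive t (1 : R) (fun s : R => s + h) 1.
  apply: is_derive_eq (is_deriveD (is_derive_id t (1 : R)) (is_derive_cst h t (1 : R))) _.
  by rewrite addr0.
by have := is_derive1_comp (g := fun s => s + h) H D; rewrite mulr1.
Qed.

Lemma MVT_between f g t h : (forall s, is_derive s (1 : R) f (g s)) ->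
  exists2 c, `|c - t| <= `|h| & f (t + h) - f t = g c * h.
Proof.
move=> fg; have cf : continuous f by exact: is_derive_continuous fg.
have [h0|h0|->] := ltrgtP h 0; last 1 first.
- exists t; first by rewrite subrr normr0.
  by rewrite addr0 subrr mulr0.
- have th : t + h < t by rewrite gtrDl.
  have [c] := MVT th (fun x _ => fg x) (continuous_subspaceT cf).
  rewrite in_itv/= => /andP[c1 c2] E; exists c.
    by rewrite ltr0_norm ?subr_lt0// ltr0_norm//; lra.
  by rewrite -opprB E; ring.
- have th : t < t + h by rewrite ltrDl.
  have [c] := MVT th (fun x _ => fg x) (continuous_subspaceT cf).
  rewrite in_itv/= => /andP[c1 c2] E; exists c.
    by rewrite gtr0_norm ?subr_gt0// gtr0_norm//; lra.
  by rewrite E; ring.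
Qed.

Lemma derive0_cst f : (forall t, is_derive t (1 : R) f 0) -> forall t, f t = f 0.
Proof.
move=> f0 t; have [c _] := @MVT_between f (cst 0) 0 t f0.
by rewrite add0r mul0r => /eqP; rewrite subr_eq0 => /eqP.
Qed.

(** A local antiderivative suffices, on a neighbourhood of [t] that contains the
arguments [s] and [s + h] of the regularization below. *)
Lemma continuous_antiderivative f : continuous f ->
  forall t, exists K : R -> R, forall s, t - 2 < s < t + 2 -> is_derive s (1 : R) K (f s).
Proof.
move=> cf t; exists (fun y => \int[@lebesgue_measure R]_(x in `[t - 3, y]) f x).
move=> s /andP[ts st].
have st3 : s < t + 3 by lra.
have [|||d1 d2] := @continuous_FTC1 R f (BLeft (t - 3)) s (t + 3) st3.
- apply: continuous_compact_integrable; first exact: segment_compact.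
  exact: continuous_subspaceT.
- by rewrite lte_fin; lra.
- exact: (cf s).
by split; [exact: d1|rewrite -derive1E; exact: d2].
Qed.

(** At fixed [k] the mean value theorem compares [Q h (t + k) - Q h t] with [l k], up to
an error that joint convergence makes uniform in [h]; then [h] tends to 0. *)
Lemma is_derive_regularization (Q q : R -> R -> R) (G : R -> R) (l t : R) :
  (forall h s, 0 < `|h| < 1 -> `|s - t| < 1 -> is_derive s (1 : R) (Q h) (q h s)) ->
  (forall s, `|s - t| < 1 -> Q h s @[h --> (0 : R)^'] --> G s) ->
  q p.1 p.2 @[p --> filter_prod (0 : R)^' (nbhs t)] --> l ->
  is_derive t (1 : R) G l.
Proof.
move=> Qq QG ql; apply: is_derive_lim; apply/cvgrPdist_le => e e0.
have /cvgrPdist_le/(_ _ e0) := ql.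
move=> [[A B] /= [A0 Bt] AB].
have [d1 /= d10 Hd1] := Bt.
near=> k.
have k0 : k != 0 by near: k; exact: nbhs_dnbhs_neq.
have kd1 : `|k| < d1 by near: k; exact: dnbhs0_lt.
have k1 : `|k| < 1 by near: k; exact: dnbhs0_lt.
rewrite -[X in `|X|](_ : (k^-1 * (l * k - (G (t + k) - G t))) = _); last first.
  by rewrite mulrBr mulrCA mulVf// mulr1.
rewrite normrM normfV ler_pdivrMl ?normr_gt0//.
have cv : `|l * k - (Q h (t + k) - Q h t)| @[h --> (0 : R)^'] -->
   `|l * k - (G (t + k) - G t)|.
  apply: cvg_norm; apply: cvgB; first exact: cvg_cst.
  apply: cvgB; apply: QG; last by rewrite subrr normr0.
  by rewrite addrC addKr.
rewrite -(cvg_lim _ cv)//; apply: limr_le.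
  by apply/cvg_ex; exists `|l * k - (G (t + k) - G t)|.
near=> h.
have h0 : 0 < `|h| by rewrite normr_gt0; near: h; exact: nbhs_dnbhs_neq.
have h1 : `|h| < 1 by near: h; exact: dnbhs0_lt.
have Ah : A h by near: h.
(* The mean value theorem on the segment between t and t + k, where Q h is derivable. *)
pose P := fun x => Q h (t + x * k).
have tk (x : R) : 0 <= x <= 1 -> `|(t + x * k) - t| < Num.min 1 d1.
  move=> /andP[x0 x1]; rewrite addrC addKr normrM ger0_norm// lt_min.
  have H : x * `|k| <= `|k| by rewrite ler_piMl.
  by rewrite (le_lt_trans H k1) (le_lt_trans H kd1).
have DP (x : R) : 0 <= x <= 1 -> is_derive x (1 : R) P (q h (t + x * k) * k).
  move=> x01; have := tk _ x01; rewrite lt_min => /andP[tx1 _].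
  have D1 : is_derive x (1 : R) (fun x => t + x * k) k.
    have D2 := is_deriveM (is_derive_id x (1 : R)) (is_derive_cst k x (1 : R)).
    apply: is_derive_eq (is_deriveD (is_derive_cst t x (1 : R)) D2) _.
    by rewrite /GRing.scale/= mulr0 !add0r mulr1.
  have hh : 0 < `|h| < 1 by rewrite h0.
  exact: (@is_derive1_comp _ (Q h) (fun x => t + x * k) x _ _ (Qq h _ hh tx1) D1).
have [||c] := @MVT _ P (fun x => q h (t + x * k) * k) 0 1 ltr01.
- by move=> x; rewrite in_itv/= => /andP[/ltW x0 /ltW x1]; apply: DP; rewrite x0.
- apply: derivable_within_continuous => x; rewrite in_itv/= => x01.
  by have [] := DP x x01.
rewrite in_itv/= => /andP[/ltW c0 /ltW c1]; rewrite subr0 mulr1 /P mul0r addr0 mul1r => ->.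
rewrite -mulrBl normrM mulrC ler_wpM2l//.
have c01 : 0 <= c <= 1 by rewrite c0.
have := tk _ c01; rewrite lt_min => /andP[_ tc].
apply: (AB (h, t + c * k)); split => //=.
by apply: Hd1; rewrite /ball_/= distrC.
Unshelve. all: by end_near. Qed.

End scalar_calculus.

(** * Convergence in L2 and uniform convergence *)

Section curves_in_L2.
Context {R : realType} (I : set R) (oI : open I) (iI : is_interval I).
Local Notation mu := (@lebesgue_measure R).
Local Notation L2 := (L2 I).
Local Notation L2norm := (L2norm I).
Local Notation ip := (inner I).
Local Notation H1 := (H1 I).
Local Notation H10 := (H10 I).
Local Notation wderiv := (wderiv I).

Let mI : measurable I := open_measurable oI.

Definition Linf (f : R -> R) := measurable_fun I f /\
  exists2 M : R, 0 <= M & {ae mu, forall x, I x -> `|f x| <= M}.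

Definition cvgL2 {T} (F : set_system T) (z : T -> R -> R) (l : R -> R) :=
  [/\ (forall s, L2 (z s)), L2 l & L2norm (z s - l) @[s --> F] --> (0 : R)].

Definition cvgLinf {T} (F : set_system T) (z : T -> R -> R) (l : R -> R) :=
  [/\ (forall s, Linf (z s)), Linf l & forall e : R, 0 < e ->
     \forall s \near F, {ae mu, forall x, I x -> `|(z s - l) x| <= e}].

Lemma L2_Linf f g : Linf f -> L2 g -> L2 (f * g).
Proof. by move=> [mf [M M0 fM]] g2; exact: L2_mulB fM g2. Qed.

Lemma LinfB f g : Linf f -> Linf g -> Linf (f - g).
Proof.
move=> [mf [M M0 fM]] [mg [N N0 gN]]; split; first exact: measurable_funB.
exists (M + N); first exact: addr_ge0.
apply: aeS (aeI fM gN) => x [fx gx] Ix.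
by rewrite (le_trans (ler_normB _ _))// lerD ?fx ?gx.
Qed.

Lemma LinfD f g : Linf f -> Linf g -> Linf (f + g).
Proof.
move=> [mf [M M0 fM]] [mg [N N0 gN]]; split; first exact: measurable_funD.
exists (M + N); first exact: addr_ge0.
apply: aeS (aeI fM gN) => x [fx gx] Ix.
by rewrite (le_trans (ler_normD _ _))// lerD ?fx ?gx.
Qed.

Lemma H10_Linf f : H10 f -> Linf f.
Proof.
move=> f10; split; first exact: (L2_measurable mI (H1_L2 (H10_H1 f10))).
exists (1 * L2norm f + 1^-1 * L2norm (wderiv f)).
  by rewrite addr_ge0// mulr_ge0 ?L2norm_ge0// invr1.
exact: H10_sup.
Qed.

Lemma wderiv_Linf a : H10 a -> H1 (wderiv a) -> Linf (wderiv a).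
Proof.
move=> a10 a1; split; first exact: (L2_measurable mI (L2_wderiv _ _)).
exists (1^-1 * L2norm (wderiv a) + 2 * 1 * L2norm (wderiv (wderiv a))).
  by rewrite addr_ge0// mulr_ge0 ?L2norm_ge0// ?invr1 ?mulr1.
exact: gagliardo_nirenberg.
Qed.

Section filtered.
Context {T : Type} (F : set_system T) {FF : Filter F}.
Implicit Types (z y p : T -> R -> R) (l m q : R -> R).

Lemma cvgL2_squeeze z l (u : T -> R) : (forall s, L2 (z s)) -> L2 l ->
  (\forall s \near F, L2norm (z s - l) <= u s) -> u s @[s --> F] --> (0 : R) ->
  cvgL2 F z l.
Proof.
move=> z2 l2 zu u0; split => //.
apply: (squeeze_cvgr _ (cvg_cst 0) u0).
by apply: filterS zu => s ->; rewrite L2norm_ge0.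
Qed.

Lemma cvgL2_cst l : L2 l -> cvgL2 F (fun=> l) l.
Proof.
move=> l2; apply: (@cvgL2_squeeze _ _ (cst 0)) => //; last exact: cvg_cst.
apply: nearW => s; rewrite subrr.
by have := L2normZ mI 0 l2; rewrite scale0r normr0 mul0r => ->.
Qed.

Lemma cvgL2_D z y l m : cvgL2 F z l -> cvgL2 F y m ->
  cvgL2 F (fun s => z s + y s) (l + m).
Proof.
move=> [z2 l2 zl] [y2 m2 ym].
apply: (@cvgL2_squeeze _ _ (fun s => L2norm (z s - l) + L2norm (y s - m))).
- by move=> s; exact: L2D.
- exact: L2D.
- apply: nearW => s; have -> : z s + y s - (l + m) = (z s - l) + (y s - m) by ring.
  by apply: L2norm_triangle => //; exact: L2B.
- by rewrite -[X in _ --> X]addr0; exact: cvgD.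
Qed.

Lemma cvgL2_Z c z l : cvgL2 F z l -> cvgL2 F (fun s => c *: z s) (c *: l).
Proof.
move=> [z2 l2 zl].
apply: (@cvgL2_squeeze _ _ (fun s => `|c| * L2norm (z s - l))).
- by move=> s; exact: L2Z.
- exact: L2Z.
- apply: nearW => s; rewrite -scalerBr L2normZ//; exact: L2B.
- by rewrite -[X in _ --> X](mulr0 `|c|); apply: cvgM => //; exact: cvg_cst.
Qed.

Lemma cvgL2_N z l : cvgL2 F z l -> cvgL2 F (fun s => - z s) (- l).
Proof.
rewrite -scaleN1r => /(cvgL2_Z (-1)).
by rewrite (_ : (fun s => -1 *: z s) = (fun s => - z s))//; apply/funext => s; rewrite scaleN1r.
Qed.

Lemma cvgL2_B z y l m : cvgL2 F z l -> cvgL2 F y m ->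
  cvgL2 F (fun s => z s - y s) (l - m).
Proof. by move=> zl /cvgL2_N; exact: cvgL2_D. Qed.

(** From [p z - q l = (p - q)(z - l) + q (z - l) + (p - q) l], where each product has a
bounded factor and a factor in L2. *)
Lemma cvgL2_M p z q l : cvgLinf F p q -> cvgL2 F z l ->
  cvgL2 F (fun s => p s * z s) (q * l).
Proof.
move=> [pi qi pq] [z2 l2 zl].
split; [by move=> s; exact: L2_Linf|exact: L2_Linf|].
have [mq [M M0 qM]] := qi.
have K0 : 0 < M + L2norm l + 2 by rewrite ltr_wpDl// addr_ge0// L2norm_ge0.
apply/cvgr0Pnorm_le => e e0.
pose e' := Num.min 1 (e / (M + L2norm l + 2)).
have e'0 : 0 < e' by rewrite lt_min ltr01 divr_gt0.
have He : e' * (M + L2norm l + 2) <= e.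
  by rewrite -ler_pdivlMr// ge_min lexx orbT.
have e'1 : e' <= 1 by rewrite ge_min lexx.
near=> s; rewrite ger0_norm ?L2norm_ge0//.
have zs : L2norm (z s - l) <= e'.
  rewrite -[leLHS]ger0_norm ?L2norm_ge0//; near: s.
  by move/cvgr0_norm_le : zl; apply.
have ps : {ae mu, forall x, I x -> `|(p s - q) x| <= e'} by near: s; exact: pq.
have D2 : L2 (z s - l) by exact: L2B.
have mpq : measurable_fun I (p s - q) by case: (LinfB (pi s) qi).
have -> : p s * z s - q * l = (p s - q) * (z s - l) + (q * (z s - l) + (p s - q) * l) by ring.
have A1 := L2_mulB mI mpq ps D2; have A2 := L2_Linf qi D2; have A3 := L2_mulB mI mpq ps l2.
rewrite (le_trans (L2norm_triangle mI A1 (L2D A2 A3)))//.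
have := L2norm_triangle mI A2 A3.
have := L2norm_mulB mI mpq (ltW e'0) ps D2; have := L2norm_mulB mI mpq (ltW e'0) ps l2.
have := L2norm_mulB mI mq M0 qM D2; have := L2norm_ge0 I l; have := L2norm_ge0 I (z s - l).
move: zs He; set X := L2norm (z s - l); set Y := L2norm l => zs He X0 Y0 h1 h2 h3 h4.
have : e' * X <= e' by rewrite ler_piMr ?(ltW e'0)// (le_trans zs).
have : M * X <= M * e' by rewrite ler_wpM2l.
by lra.
Unshelve. all: by end_near. Qed.

Lemma cvgL2_ip z y l m : cvgL2 F z l -> cvgL2 F y m ->
  ip (z s) (y s) @[s --> F] --> ip l m.
Proof.
move=> [z2 l2 zl] [y2 m2 ym]; apply/subr_cvg0.
have B s : `|ip (z s) (y s) - ip l m| <= L2norm (z s - l) * (L2norm (y s - m) + L2norm m)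
    + L2norm l * L2norm (y s - m).
  have D1 : L2 (z s - l) by exact: L2B.
  have D2 : L2 (y s - m) by exact: L2B.
  have -> : ip (z s) (y s) - ip l m = ip (z s - l) (y s) + ip l (y s - m).
    by rewrite ipBl// ipBr//; ring.
  rewrite (le_trans (ler_normD _ _))// lerD//; last exact: ip_le.
  rewrite (le_trans (ip_le mI D1 (y2 s)))// ler_wpM2l ?L2norm_ge0//.
  by rewrite -[X in L2norm X <= _](subrK m) L2norm_triangle.
apply: norm_cvg0; apply: (squeeze_cvgr _ (cvg_cst 0)).
  by apply: nearW => s; rewrite normr_ge0 /=; exact: B.
rewrite [X in _ --> X](_ : _ = 0 * (0 + L2norm m) + L2norm l * 0); last by ring.
apply: cvgD; apply: cvgM => //; last exact: cvg_cst.
by apply: cvgD => //; exact: cvg_cst.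
Qed.

Lemma cvgLinf_cst q : Linf q -> cvgLinf F (fun=> q) q.
Proof.
move=> qi; split => // e e0; apply: nearW => s; apply: aeW => x _.
by rewrite !fctE subrr normr0 ltW.
Qed.

Lemma cvgLinf_D p z q l : cvgLinf F p q -> cvgLinf F z l ->
  cvgLinf F (fun s => p s + z s) (q + l).
Proof.
move=> [pi qi pq] [zi li zl]; split; [by move=> s; exact: LinfD|exact: LinfD|].
move=> e e0; have e2 : 0 < e / 2 by rewrite divr_gt0.
apply: filterS2 (pq _ e2) (zl _ e2) => s H1' H2'; apply: aeS (aeI H1' H2') => x [px zx] Ix.
rewrite (_ : (p s + z s - (q + l)) x = (p s - q) x + (z s - l) x); last by rewrite !fctE; ring.
by rewrite (le_trans (ler_normD _ _))// [leRHS](splitr e) lerD ?px ?zx.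
Qed.

(** The difference belongs to H1_0, where [H10_sup] bounds it uniformly. *)
Lemma cvgLinf_H10 z l : (forall s, H10 (z s)) -> H10 l -> cvgL2 F z l ->
  cvgL2 F (fun s => wderiv (z s)) (wderiv l) -> cvgLinf F z l.
Proof.
move=> z10 l10 [_ _ zl] [_ _ zl1].
split; [by move=> s; exact: H10_Linf|exact: H10_Linf|].
move=> e e0; have e2 : 0 < e / 2 by rewrite divr_gt0.
near=> s.
have h1 : L2norm (z s - l) <= e / 2.
  by rewrite -[leLHS]ger0_norm ?L2norm_ge0//; near: s; move/cvgr0_norm_le : zl; apply.
have h2 : L2norm (wderiv (z s - l)) <= e / 2.
  rewrite L2norm_wderivB//; [|exact: H10_H1|exact: H10_H1].
  by rewrite -[leLHS]ger0_norm ?L2norm_ge0//; near: s; move/cvgr0_norm_le : zl1; apply.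
have := H10_sup oI iI (H10B oI iI (z10 s) l10) ltr01.
by apply: aeS => x /[apply] H; rewrite (le_trans H)// invr1 !mul1r [leRHS](splitr e) lerD.
Unshelve. all: by end_near. Qed.

(** The derivative of a function in H1_0 need not vanish at the boundary, so that
[H10_sup] is replaced by [gagliardo_nirenberg]. *)
Lemma cvgLinf_wderiv z l : (forall s, H10 (z s) /\ H1 (wderiv (z s))) -> H10 l -> H1 (wderiv l) ->
  cvgL2 F (fun s => wderiv (z s)) (wderiv l) ->
  cvgL2 F (fun s => wderiv (wderiv (z s))) (wderiv (wderiv l)) ->
  cvgLinf F (fun s => wderiv (z s)) (wderiv l).
Proof.
move=> z10 l10 l1 [_ _ zl] [_ _ zl1].
split; [by move=> s; case: (z10 s) => *; exact: wderiv_Linf|exact: wderiv_Linf|].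
move=> e e0; have e3 : 0 < e / 3 by rewrite divr_gt0.
near=> s; have [zs10 zs1] := z10 s.
have dz := wderivB oI (H10_H1 zs10) (H10_H1 l10).
have H1d := H1_wderivB oI (H10_H1 zs10) (H10_H1 l10) zs1 l1.
have h1 : L2norm (wderiv (z s - l)) <= e / 3.
  rewrite L2norm_wderivB//; [|exact: H10_H1|exact: H10_H1].
  by rewrite -[leLHS]ger0_norm ?L2norm_ge0//; near: s; move/cvgr0_norm_le : zl; apply.
have h2 : L2norm (wderiv (wderiv (z s - l))) <= e / 3.
  rewrite L2norm_wderiv2B//; [|exact: H10_H1|exact: H10_H1].
  by rewrite -[leLHS]ger0_norm ?L2norm_ge0//; near: s; move/cvgr0_norm_le : zl1; apply.
apply: aeS (aeI dz (gagliardo_nirenberg oI iI (H10B oI iI zs10 l10) H1d ltr01)).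
move=> x [dzx H] Ix; rewrite -(dzx Ix) (le_trans (H Ix))// invr1 mul1r mulr1.
by rewrite (le_trans (lerD h1 (ler_wpM2l _ h2)))//; lra.
Unshelve. all: by end_near. Qed.

End filtered.

End curves_in_L2.

(** * Differentiable curves in L2 *)

Section L2_derivatives.
Context {R : realType} (I : set R) (oI : open I).
Local Notation L2 := (L2 I).
Local Notation L2norm := (L2norm I).
Local Notation ip := (inner I).
Implicit Types (z y : R -> R -> R) (t h : R).

Let mI : measurable I := open_measurable oI.

Definition contL2 z := forall t, cvgL2 I (nbhs t) z (z t).

Definition diffq z h t : R -> R := h^-1 *: (z (t + h) - z t).

Definition derL2 z z' := forall t, cvgL2 I (0 : R)^' (fun h => diffq z h t) (z' t).

Lemma contL2_L2 z : contL2 z -> forall t, L2 (z t).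
Proof. by move=> zc t; have [] := zc t. Qed.

Lemma derL2_L2 z z' : derL2 z z' -> forall t, L2 (z' t).
Proof. by move=> zc t; have [] := zc t. Qed.

Lemma L2_diffq z h t : (forall t, L2 (z t)) -> L2 (diffq z h t).
Proof. by move=> z2; apply: L2Z; exact: L2B. Qed.

Section filtered.
Context {T : Type} (F : set_system T) {FF : Filter F}.

Lemma cvgL2_comp z (g : T -> R) t : contL2 z -> g s @[s --> F] --> t ->
  cvgL2 I F (fun s => z (g s)) (z t).
Proof.
move=> /(_ t) [z2 l2 zt] gt; split => //.
exact: (cvg_comp g (fun s => L2norm (z s - z t)) gt zt).
Qed.

End filtered.

Lemma cvg_shift0 t : t + h @[h --> (0 : R)^'] --> t.
Proof.
rewrite -[X in _ --> X]addr0; apply: cvgD; first exact: cvg_cst.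
by apply: cvg_within.
Qed.

Lemma joint_filter t : Filter (filter_prod (0 : R)^' (nbhs t)).
Proof. exact: filter_prod_filter. Qed.

Lemma cvg_joint_snd t : p.2 @[p --> filter_prod (0 : R)^' (nbhs t)] --> t.
Proof. exact: cvg_snd. Qed.

Lemma cvg_joint_sum t : p.2 + p.1 @[p --> filter_prod (0 : R)^' (nbhs t)] --> t.
Proof.
have F := joint_filter t.
rewrite -[X in _ --> X]addr0; apply: cvgD; first exact: cvg_snd.
by apply: (cvg_trans (cvg_fst (F := (0 : R)^'))); apply: cvg_within.
Qed.

Lemma derL2_ip z z' y y' t : contL2 z -> contL2 y -> derL2 z z' -> derL2 y y' ->
  is_derive t (1 : R) (fun t => ip (z t) (y t)) (ip (z' t) (y t) + ip (z t) (y' t)).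
Proof.
move=> zc yc dz dy; apply: is_derive_lim.
have -> : (fun h => h^-1 * (ip (z (t + h)) (y (t + h)) - ip (z t) (y t))) =
    (fun h => ip (diffq z h t) (y (t + h)) + ip (z t) (diffq y h t)).
  apply/funext => h; have [z2 y2] := (contL2_L2 zc, contL2_L2 yc).
  rewrite /diffq ipZl//; [|exact: L2B]; rewrite ipZr//; [|exact: L2B].
  by rewrite ipBl// ipBr//; ring.
apply: cvgD.
  by apply: (cvgL2_ip oI (dz t)); exact: (cvgL2_comp yc (@cvg_shift0 t)).
by apply: (cvgL2_ip oI _ (dy t)); apply: cvgL2_cst => //; exact: (contL2_L2 zc).
Qed.

Lemma derL2_sqr z z' t : contL2 z -> derL2 z z' ->
  is_derive t (1 : R) (fun t => ip (z t) (z t)) (2 * ip (z t) (z' t)).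
Proof.
move=> zc dz; have := derL2_ip t zc zc dz dz.
by rewrite ipC -mulr2n mulr_natl.
Qed.

Lemma derL2_D z z' y y' : derL2 z z' -> derL2 y y' ->
  derL2 (fun t => z t + y t) (fun t => z' t + y' t).
Proof.
move=> dz dy t; rewrite (_ : (fun h => _) = (fun h => diffq z h t + diffq y h t)).
  by apply: cvgL2_D.
by apply/funext => h; rewrite /diffq -scalerDr; congr (_ *: _); ring.
Qed.

Lemma derL2_Z c z z' : derL2 z z' -> derL2 (fun t => c *: z t) (fun t => c *: z' t).
Proof.
move=> dz t; rewrite (_ : (fun h => _) = (fun h => c *: diffq z h t)).
  by apply: cvgL2_Z.
by apply/funext => h; rewrite /diffq -scalerBr !scalerA mulrC.
Qed.

Lemma derL2_shift c z z' : derL2 z z' -> derL2 (fun t => z (t + c)) (fun t => z' (t + c)).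
Proof.
move=> dz t; rewrite (_ : (fun h => _) = (fun h => diffq z h (t + c))); first exact: dz.
by apply/funext => h; rewrite /diffq addrAC.
Qed.

Lemma derL2_diffq c z z' : derL2 z z' -> derL2 (diffq z c) (diffq z' c).
Proof.
move=> dz; apply: derL2_Z.
have H := derL2_D (derL2_shift c dz) (derL2_Z (-1) dz).
move=> t; have := H t; rewrite !scaleN1r.
rewrite (_ : (fun h => diffq (fun t => z (t + c) + -1 *: z t) h t) =
   (fun h => diffq (fun t => z (t + c) - z t) h t))//.
by apply/funext => h; rewrite /diffq !scaleN1r.
Qed.

Lemma contL2_Z c z : contL2 z -> contL2 (fun t => c *: z t).
Proof. by move=> zc t; apply: cvgL2_Z. Qed.

Lemma contL2_shift c z : contL2 z -> contL2 (fun t => z (t + c)).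
Proof.
move=> zc t; apply: (cvgL2_comp zc); apply: cvgD; [exact: cvg_id|exact: cvg_cst].
Qed.

Lemma contL2_B z y : contL2 z -> contL2 y -> contL2 (fun t => z t - y t).
Proof. by move=> zc yc t; apply: cvgL2_B. Qed.

Lemma contL2_diffq c z : contL2 z -> contL2 (diffq z c).
Proof. by move=> zc; apply: contL2_Z; apply: contL2_B => //; exact: contL2_shift. Qed.

(** The scalar mean value theorem is applied to the pairing of the curve with the error
term itself, which is held fixed. *)
Lemma strict_derL2 z z' t : contL2 z -> derL2 z z' -> contL2 z' ->
  cvgL2 I (filter_prod (0 : R)^' (nbhs t)) (fun p => diffq z p.1 p.2) (z' t).
Proof.
move=> zc dz z'c; have z2 := contL2_L2 zc; have z'2 := contL2_L2 z'c.
split; [by move=> s; exact: L2_diffq|exact: z'2|].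
have F := joint_filter t.
apply/cvgr0Pnorm_le => e e0.
have [_ _ /cvgr0_norm_le/(_ e e0)] := z'c t => -[d /= d0 Hd].
have d20 : 0 < d / 2 by rewrite divr_gt0.
exists ([set h : R | `|h| < d / 2 /\ h != 0], [set s : R | `|s - t| < d / 2]).
  split => /=.
    near=> h; split; first by near: h; exact: dnbhs0_lt.
    by near: h; exact: nbhs_dnbhs_neq.
  by exists (d / 2) => //= s /=; rewrite distrC.
move=> [h s] /= [[hd h0] sd].
set phi := diffq z h s - z' t.
have phi2 : L2 phi by apply: L2B => //; exact: L2_diffq.
have cst_der : derL2 (fun=> phi) (fun=> 0).
  move=> r; rewrite (_ : (fun h => _) = (fun h => 0)); first by apply: cvgL2_cst => //; exact: L20.
  by apply/funext => k; rewrite /diffq subrr scaler0.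
have cst_cont : contL2 (fun=> phi) by move=> r; apply: cvgL2_cst.
pose f r := ip (z r) phi - r * ip (z' t) phi.
have Df r : is_derive r (1 : R) f (ip (z' r - z' t) phi).
  have D1 := derL2_ip r zc cst_cont dz cst_der.
  have D2 := is_deriveM (is_derive_id r (1 : R)) (is_derive_cst (ip (z' t) phi) r (1 : R)).
  apply: is_derive_eq (is_deriveB D1 D2) _.
  rewrite ipBl// /GRing.scale/= mulr0 add0r mulr1.
  by have := ipZr mI 0 phi2 (z2 r); rewrite scale0r mul0r => ->; rewrite addr0.
have [c cs Hc] := MVT_between s h Df.
have E : ip phi phi = ip (z' c - z' t) phi.
  apply: (mulfI h0); rewrite [RHS]mulrC -Hc /f {1}/phi /diffq ipBl//; last exact: L2_diffq.
  rewrite ipZl//; last exact: L2B.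
  by rewrite ipBl//; field.
have cd : L2norm (z' c - z' t) <= e.
  rewrite -[leLHS]ger0_norm ?L2norm_ge0//; apply: Hd => /=.
  rewrite (_ : t - c = (t - s) - (c - s)); last by ring.
  rewrite (le_lt_trans (ler_normB _ _))// [ltRHS](splitr d)//.
  by apply: ltrD; [rewrite distrC|exact: le_lt_trans cs hd].
rewrite ger0_norm ?L2norm_ge0//.
have [->|n0] := eqVneq (L2norm phi) 0; first exact: ltW.
have npos : 0 < L2norm phi by rewrite lt_def n0 L2norm_ge0.
rewrite -(ler_pM2r npos) -expr2 L2norm_sqr// E.
rewrite (le_trans (ler_norm _))// (le_trans (ip_le mI (L2B (z'2 c) (z'2 t)) phi2))//.
by rewrite ler_wpM2r ?L2norm_ge0.
Unshelve. all: by end_near. Qed.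

End L2_derivatives.

(** * Numerical inequalities *)

Opaque Defs.wderiv Defs.L2norm inner cvgL2 cvgLinf Linf.

(** With [l^2 = 8 m + 1], where [m] is the mass, and [r = 1/l], the gradient term
produced by the Gagliardo-Nirenberg inequality has a coefficient at most [1/2], so
that the energy absorbs it. *)
Lemma interaction_arith {R : realFieldType} (A B A1 B1 V AA BB P N l r : R) :
  l ^+ 2 = 8 * (A ^+ 2 + B ^+ 2) + 1 -> r ^+ 2 * (8 * (A ^+ 2 + B ^+ 2) + 1) = 1 ->
  0 <= A ^+ 2 + B ^+ 2 ->
  AA <= (l * A + r * A1) * A -> BB <= (l * B + r * B1) * B -> P <= AA + BB -> N <= V * P ->
  0 <= V ->
  N <= 4^-1 * V ^+ 2 + 2^-1 * (A1 ^+ 2 + B1 ^+ 2) +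
    4 * (A ^+ 2 + B ^+ 2) ^+ 2 * (8 * (A ^+ 2 + B ^+ 2) + 1).
Proof.
move=> lE rE m0 hA hB hP hN V0.
set m := A ^+ 2 + B ^+ 2 in lE rE m0 *.
set Sa := l * A + r * A1 in hA; set Sb := l * B + r * B1 in hB.
set Q := Sa * A + Sb * B.
have PQ : P <= Q by rewrite /Q; lra.
have NQ : N <= V * Q by rewrite (le_trans hN)// ler_wpM2l.
have VQ : V * Q <= 4^-1 * V ^+ 2 + Q ^+ 2.
  by have := sqr_ge0 (2^-1 * V - Q); rewrite sqrrB; lra.
have Q2 : Q ^+ 2 <= m * (Sa ^+ 2 + Sb ^+ 2).
  rewrite -subr_ge0 (_ : _ - _ = (Sa * B - Sb * A) ^+ 2) ?sqr_ge0//.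
  by rewrite /Q /m; ring.
have S2 : Sa ^+ 2 + Sb ^+ 2 <= 2 * (l ^+ 2 * m + r ^+ 2 * (A1 ^+ 2 + B1 ^+ 2)).
  rewrite -subr_ge0 (_ : _ - _ = (l * A - r * A1) ^+ 2 + (l * B - r * B1) ^+ 2).
    by rewrite addr_ge0// sqr_ge0.
  by rewrite /Sa /Sb /m; ring.
have H1 : m * (Sa ^+ 2 + Sb ^+ 2) <= m * (2 * (l ^+ 2 * m + r ^+ 2 * (A1 ^+ 2 + B1 ^+ 2))).
  exact: ler_wpM2l.
have rm : 4 * m * r ^+ 2 <= 1 by have := sqr_ge0 r; have := mulr_ge0 m0 (sqr_ge0 r); lra.
have D0 : 0 <= A1 ^+ 2 + B1 ^+ 2 by rewrite addr_ge0// sqr_ge0.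
have H2 : (4 * m * r ^+ 2) * (A1 ^+ 2 + B1 ^+ 2) <= 1 * (A1 ^+ 2 + B1 ^+ 2).
  exact: ler_wpM2r.
have H3 : m * (l ^+ 2 * m) = m ^+ 2 * (8 * m + 1) by rewrite lE; ring.
have H4 : 0 <= m ^+ 2 * (8 * m + 1) by rewrite mulr_ge0 ?sqr_ge0//; lra.
have H5 : m * (2 * (l ^+ 2 * m + r ^+ 2 * (A1 ^+ 2 + B1 ^+ 2))) =
  2 * (m * (l ^+ 2 * m)) + 2^-1 * (4 * m * r ^+ 2 * (A1 ^+ 2 + B1 ^+ 2)) by field.
rewrite H3 in H5.
by lra.
Qed.

Section constants.
Context {R : realFieldType}.
Implicit Types x m X S y r n : R.

(** Bounds in terms of the sum [X] of the squared norms of the initial data: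
[low_bound] for the low-order norms at all times, [growth_rate] for the derivative
of the fourth root of the second-order energy, [initial_energy2] for that energy at
time 0. *)
Definition quartic m := 4 * m ^+ 2 * (8 * m + 1).

Definition low_bound X := 12 * X + 8 * quartic X + 1.

Definition growth_rate S := 8 * S ^+ 3 + 2 * ((S + 2 + 4 * S ^+ 2) * S).

Definition initial_energy2 X S := 4 * (X + 1 + 2 * S ^+ 2) ^+ 2 + 2 * X.

Definition growth_const X := let S := low_bound X in
  2 * ((1 + initial_energy2 X S) ^+ 2 + growth_rate S ^+ 2) + S + 2 * S ^+ 2.

Lemma ler_sqr1 x n : x ^+ 2 <= n -> x <= n + 1.
Proof. by move=> h; have := sqr_ge0 (x - 2^-1); lra. Qed.

Lemma quartic_ge0 m : 0 <= m -> 0 <= quartic m.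
Proof. by move=> m0; rewrite /quartic mulr_ge0 ?mulr_ge0 ?sqr_ge0//; lra. Qed.

Lemma quartic_mono m x : 0 <= m -> m <= x -> quartic m <= quartic x.
Proof.
move=> m0 mx; have x0 := le_trans m0 mx; rewrite /quartic -(mulrA 4) -(mulrA 4) ler_wpM2l//.
have h1 : m ^+ 2 <= x ^+ 2 by rewrite lerXn2r ?nnegrE.
have h2 : 0 <= 8 * m + 1 by rewrite addr_ge0 ?mulr_ge0.
by apply: ler_pM; rewrite ?sqr_ge0 ?lerD2r ?ler_wpM2l.
Qed.

Lemma gradient_arith S y r n1 n2 m : 0 <= S -> 1 <= y -> 0 < r -> r <= 1 -> r * y = 1 ->
  n1 <= S -> n2 <= m + 2 * S ^+ 2 -> m <= y ^+ 2 ->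
  y * n1 + 2 * r * n2 <= y * (S + 2 + 4 * S ^+ 2).
Proof.
move=> S0 y1 r0 r1 ry h1 h2 h3.
have y0 : 0 <= y by lra.
have S2 := sqr_ge0 S.
have A1 := ler_wpM2l y0 h1.
have A2 : 2 * r * n2 <= 2 * r * (y ^+ 2 + 2 * S ^+ 2).
  by rewrite ler_wpM2l ?mulr_ge0 ?(ltW r0)//; lra.
have A3 : r * y ^+ 2 = y by rewrite expr2 mulrA ry mul1r.
have A4 : r * S ^+ 2 <= y * S ^+ 2 by rewrite ler_wpM2r//; lra.
have -> : y * (S + 2 + 4 * S ^+ 2) = y * S + 2 * y + 4 * (y * S ^+ 2) by ring.
have A5 : 2 * r * (y ^+ 2 + 2 * S ^+ 2) = 2 * (r * y ^+ 2) + 4 * (r * S ^+ 2) by ring.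
by rewrite A3 in A5; lra.
Qed.

Lemma rate_arith S y : 0 <= S -> 1 <= y ->
  y ^+ 2 * (8 * S ^+ 3 + 2 * (y * (S + 2 + 4 * S ^+ 2) * S)) <= growth_rate S * y ^+ 3.
Proof.
move=> S0 y1; have y0 : 0 <= y by lra.
have S3 : 0 <= S ^+ 3 by exact: exprn_ge0.
have y2 := sqr_ge0 y.
rewrite -subr_ge0 (_ : _ - _ = 8 * S ^+ 3 * y ^+ 2 * (y - 1)); last by rewrite /growth_rate; ring.
by rewrite mulr_ge0 ?subr_ge0// mulr_ge0// mulr_ge0.
Qed.

Lemma growth_arith X y t : 0 <= X -> 0 <= low_bound X -> 0 <= y ->
  y <= 1 + initial_energy2 X (low_bound X) + growth_rate (low_bound X) * t ->
  0 <= t ->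
  low_bound X + y ^+ 2 + 2 * low_bound X ^+ 2 <= growth_const X * (1 + t ^+ 2).
Proof.
rewrite /growth_const; set S := low_bound X; set A := initial_energy2 X S.
set c := growth_rate S => X0 S0 y0 yA t0.
have t2 := sqr_ge0 t; have S2 := sqr_ge0 S.
have B0 : 0 <= 1 + A + c * t by exact: le_trans yA.
have h1 : y ^+ 2 <= (1 + A + c * t) ^+ 2 by rewrite lerXn2r ?nnegrE.
have h2 : (1 + A + c * t) ^+ 2 <= 2 * ((1 + A) ^+ 2 + c ^+ 2) * (1 + t ^+ 2).
  rewrite -subr_ge0 (_ : _ - _ = ((1 + A) - c * t) ^+ 2 +
    2 * ((1 + A) ^+ 2 * t ^+ 2) + 2 * c ^+ 2); last by ring.
  have p1 := sqr_ge0 (1 + A - c * t); have p2 := sqr_ge0 c.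
  have p3 := mulr_ge0 (sqr_ge0 (1 + A)) t2.
  exact: addr_ge0 (addr_ge0 p1 (mulr_ge0 (ler0n _ 2) p3)) (mulr_ge0 (ler0n _ 2) p2).
have h3 : 0 <= S * t ^+ 2 by rewrite mulr_ge0.
have h4 : 0 <= S ^+ 2 * t ^+ 2 by rewrite mulr_ge0.
have -> : (2 * ((1 + A) ^+ 2 + c ^+ 2) + S + 2 * S ^+ 2) * (1 + t ^+ 2) =
  2 * ((1 + A) ^+ 2 + c ^+ 2) * (1 + t ^+ 2) + S + 2 * S ^+ 2 + S * t ^+ 2 + 2 * (S ^+ 2 * t ^+ 2) by ring.
by lra.
Qed.

Lemma growth_const_gt0 X : 0 <= X -> 0 < growth_const X.
Proof.
move=> X0; have q0 := quartic_ge0 X0; rewrite /growth_const.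
have S0 : 1 <= low_bound X by rewrite /low_bound; lra.
set S := low_bound X in S0 *.
have := sqr_ge0 S; have := sqr_ge0 (1 + initial_energy2 X S); have := sqr_ge0 (growth_rate S).
by lra.
Qed.

Lemma low_order_arith m q qX X d1 d2 v w n d10 d20 v0 w0 n0 v1 w1 :
  0 <= m -> m <= X -> q <= qX -> 0 <= qX ->
  - (4^-1 * v + 2^-1 * (d1 + d2) + q) <= n ->
  n0 <= 4^-1 * v0 + 2^-1 * (d10 + d20) + q ->
  d1 + d2 + n + 2^-1 * (v + w) = d10 + d20 + n0 + 2^-1 * (v0 + w0) ->
  0 <= d1 -> 0 <= d2 -> 0 <= v -> 0 <= w -> 0 <= v0 -> 0 <= w0 -> 0 <= v1 -> 0 <= w1 ->
  d10 + d20 <= X -> v0 + v1 <= X -> w0 + w1 <= X ->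
  [/\ m <= 12 * X + 8 * qX, d1 + d2 <= 12 * X + 8 * qX,
      v <= 12 * X + 8 * qX & w <= 12 * X + 8 * qX].
Proof.
move=> m0 mX qX0 q0 h1 h2 h3 p1 p2 p3 p4 p5 p6 p7 p8 p9 p10 p11.
by split; lra.
Qed.

Lemma le_weighted_sum x1 x2 x3 x4 : 0 <= x1 -> 0 <= x2 -> 0 <= x3 -> 0 <= x4 ->
  [/\ x1 <= 2 * (x1 + x2) + (x3 + x4), x2 <= 2 * (x1 + x2) + (x3 + x4),
      x3 <= 2 * (x1 + x2) + (x3 + x4) & x4 <= 2 * (x1 + x2) + (x3 + x4)].
Proof. by move=> h1 h2 h3 h4; split; lra. Qed.

Lemma initial_energy2_arith X S x1 x2 x3 x4 y1 y2 :
  x1 <= (X + 1 + 2 * S ^+ 2) ^+ 2 -> x2 <= (X + 1 + 2 * S ^+ 2) ^+ 2 ->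
  y1 + x4 <= X -> y2 + x3 <= X -> 0 <= y1 -> 0 <= y2 ->
  2 * (x1 + x2) + (x3 + x4) <= initial_energy2 X S.
Proof.
rewrite /initial_energy2; set Q := (_ + _ + _) ^+ 2 => h1 h2 h3 h4 h5 h6.
by move: Q h1 h2 => Q h1 h2; lra.
Qed.

End constants.

(** * Conservation of mass and energy *)

Section zakharov_flow.
Context {R : realType} (I : set R) (oI : open I) (iI : is_interval I).
Context (a a1 a2 b b1 b2 v v1 w w1 : R -> R -> R).
Local Notation L2 := (L2 I).
Local Notation L2norm := (L2norm I).
Local Notation ip := (inner I).
Local Notation H1 := (H1 I).
Local Notation H10 := (H10 I).
Local Notation wderiv := (wderiv I).
Implicit Types t s h : R.

Let mI : measurable I := open_measurable oI.

Definition dens t : R -> R := a t * a t + b t * b t.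
Definition dens1 t : R -> R := 2 *: (a t * a1 t + b t * b1 t).
Definition dens2 t : R -> R := 2 *: ((a t * a2 t + a1 t * a1 t) + (b t * b2 t + b1 t * b1 t)).

Definition a_t t : R -> R := v t * b t - b2 t.
Definition b_t t : R -> R := a2 t - v t * a t.
Definition v_t t : R -> R := - w1 t.
Definition w_t t : R -> R := - v1 t - dens1 t.

(** The system in real form, with [u = a + i b]. The space derivatives [a1], [a2], ...
of the unknowns are separate curves, tied to them by equations. *)
Record zakharov : Prop := Zakharov {
  zak_a : forall t, [/\ H10 (a t), H1 (a1 t), a1 t = wderiv (a t) & a2 t = wderiv (a1 t)];
  zak_b : forall t, [/\ H10 (b t), H1 (b1 t), b1 t = wderiv (b t) & b2 t = wderiv (b1 t)];
  zak_v : forall t, H10 (v t) /\ v1 t = wderiv (v t);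
  zak_w : forall t, H10 (w t) /\ w1 t = wderiv (w t);
  cont_a : [/\ contL2 I a, contL2 I a1 & contL2 I a2];
  cont_b : [/\ contL2 I b, contL2 I b1 & contL2 I b2];
  cont_v : contL2 I v /\ contL2 I v1;
  cont_w : contL2 I w /\ contL2 I w1;
  der_a : derL2 I a a_t;
  der_b : derL2 I b b_t;
  der_v : derL2 I v v_t;
  der_w : derL2 I w w_t }.

Context (Z : zakharov).

Let Ha t : H10 (a t). Proof. by case: (zak_a Z t). Qed.
Let Hb t : H10 (b t). Proof. by case: (zak_b Z t). Qed.
Let Hv t : H10 (v t). Proof. by case: (zak_v Z t). Qed.
Let Hw t : H10 (w t). Proof. by case: (zak_w Z t). Qed.
Let H1a t : H1 (a t). Proof. exact: H10_H1. Qed.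
Let H1b t : H1 (b t). Proof. exact: H10_H1. Qed.
Let H1v t : H1 (v t). Proof. exact: H10_H1. Qed.
Let H1w t : H1 (w t). Proof. exact: H10_H1. Qed.
Let H1a1 t : H1 (a1 t). Proof. by case: (zak_a Z t). Qed.
Let H1b1 t : H1 (b1 t). Proof. by case: (zak_b Z t). Qed.
Let Ea1 t : a1 t = wderiv (a t). Proof. by case: (zak_a Z t). Qed.
Let Ea2 t : a2 t = wderiv (a1 t). Proof. by case: (zak_a Z t). Qed.
Let Eb1 t : b1 t = wderiv (b t). Proof. by case: (zak_b Z t). Qed.
Let Eb2 t : b2 t = wderiv (b1 t). Proof. by case: (zak_b Z t). Qed.
Let Ev1 t : v1 t = wderiv (v t). Proof. by case: (zak_v Z t). Qed.
Let Ew1 t : w1 t = wderiv (w t). Proof. by case: (zak_w Z t). Qed.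
Let La t : L2 (a t). Proof. exact: H1_L2. Qed.
Let Lb t : L2 (b t). Proof. exact: H1_L2. Qed.
Let Lv t : L2 (v t). Proof. exact: H1_L2. Qed.
Let Lw t : L2 (w t). Proof. exact: H1_L2. Qed.
Let La1 t : L2 (a1 t). Proof. exact: H1_L2. Qed.
Let Lb1 t : L2 (b1 t). Proof. exact: H1_L2. Qed.
Let La2 t : L2 (a2 t). Proof. by rewrite Ea2; exact: L2_wderiv. Qed.
Let Lb2 t : L2 (b2 t). Proof. by rewrite Eb2; exact: L2_wderiv. Qed.
Let Lv1 t : L2 (v1 t). Proof. by rewrite Ev1; exact: L2_wderiv. Qed.
Let Lw1 t : L2 (w1 t). Proof. by rewrite Ew1; exact: L2_wderiv. Qed.
Let Ia t : Linf I (a t). Proof. exact: H10_Linf. Qed.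
Let Ib t : Linf I (b t). Proof. exact: H10_Linf. Qed.
Let Iv t : Linf I (v t). Proof. exact: H10_Linf. Qed.
Let Ia1 t : Linf I (a1 t).
Proof. by rewrite Ea1; apply: wderiv_Linf => //; rewrite -Ea1. Qed.
Let Ib1 t : Linf I (b1 t).
Proof. by rewrite Eb1; apply: wderiv_Linf => //; rewrite -Eb1. Qed.

Ltac L2_tac := repeat match goal with
  | |- Defs.L2 _ (_ + _) => apply: L2D
  | |- Defs.L2 _ (- _) => apply: L2N
  | |- Defs.L2 _ (_ *: _) => apply: L2Z
  | |- Defs.L2 _ (_ * _) => apply: L2_Linf
  | |- Defs.L2 _ (a _) => exact: La
  | |- Defs.L2 _ (a1 _) => exact: La1
  | |- Defs.L2 _ (a2 _) => exact: La2
  | |- Defs.L2 _ (b _) => exact: Lb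
  | |- Defs.L2 _ (b1 _) => exact: Lb1
  | |- Defs.L2 _ (b2 _) => exact: Lb2
  | |- Defs.L2 _ (v _) => exact: Lv
  | |- Defs.L2 _ (v1 _) => exact: Lv1
  | |- Defs.L2 _ (w _) => exact: Lw
  | |- Defs.L2 _ (w1 _) => exact: Lw1
  | |- Linf _ (a1 _) => exact: Ia1
  | |- Linf _ (b1 _) => exact: Ib1
  | |- Linf _ (a _) => exact: Ia
  | |- Linf _ (b _) => exact: Ib
  | |- Linf _ (v _) => exact: Iv
  | |- Linf _ (_ + _) => apply: LinfD
  | |- open _ => exact: oI
  | |- measurable _ => exact: mI
  | H : Defs.L2 _ ?f |- Defs.L2 _ ?f => exact: H
  | H : Linf _ ?f |- Linf _ ?f => exact: H
  end.

Let La_t t : L2 (a_t t). Proof. rewrite /a_t; L2_tac. Qed.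
Let Lb_t t : L2 (b_t t). Proof. rewrite /b_t; L2_tac. Qed.
Let Lv_t t : L2 (v_t t). Proof. rewrite /v_t; L2_tac. Qed.
Let Ldens t : L2 (dens t). Proof. rewrite /dens; L2_tac. Qed.
Let Ldens1 t : L2 (dens1 t). Proof. rewrite /dens1; L2_tac. Qed.
Let Ldens2 t : L2 (dens2 t). Proof. rewrite /dens2; L2_tac. Qed.
Let Lw_t t : L2 (w_t t). Proof. rewrite /w_t; apply: L2B; [L2_tac|exact: Ldens1]. Qed.

Let ipE := (ipBl mI, ipBr mI, ipDl mI, ipDr mI, ipNl mI, ipNr mI, ipZl mI, ipZr mI).

Ltac L2_all := repeat match goal with
  | |- Defs.L2 _ (a_t _) => exact: La_t
  | |- Defs.L2 _ (b_t _) => exact: Lb_t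
  | |- Defs.L2 _ (v_t _) => exact: Lv_t
  | |- Defs.L2 _ (w_t _) => exact: Lw_t
  | |- Defs.L2 _ (dens _) => exact: Ldens
  | |- Defs.L2 _ (dens1 _) => exact: Ldens1
  | |- Defs.L2 _ (dens2 _) => exact: Ldens2
  | _ => progress L2_tac
  end.

Ltac ip_expand := rewrite ?ipE; try solve [L2_all].

Section uniform_limits.
Context {T : Type} (F : set_system T) {FF : Filter F} (g : T -> R) (t : R).
Context (gt : g p @[p --> F] --> t).

Lemma cvgLinf_jet (z z1 : R -> R -> R) : (forall s, H10 (z s) /\ z1 s = wderiv (z s)) ->
  contL2 I z -> contL2 I z1 -> cvgLinf I F (fun p => z (g p)) (z t).
Proof.
move=> Hz c0 c1; have H s : H10 (z s) by case: (Hz s).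
have E : z1 = (fun s => wderiv (z s)) by apply/funext => s; case: (Hz s).
apply: cvgLinf_H10 => //; first exact: (cvgL2_comp c0 gt).
by have := cvgL2_comp c1 gt; rewrite E.
Qed.

Lemma cvgLinf_jet1 (z z1 z2 : R -> R -> R) :
  (forall s, [/\ H10 (z s), H1 (z1 s), z1 s = wderiv (z s) & z2 s = wderiv (z1 s)]) ->
  contL2 I z1 -> contL2 I z2 -> cvgLinf I F (fun p => z1 (g p)) (z1 t).
Proof.
move=> Hz c1 c2.
have E1 : z1 = (fun s => wderiv (z s)) by apply/funext => s; case: (Hz s).
have E2 : z2 = (fun s => wderiv (z1 s)) by apply/funext => s; case: (Hz s).
have := cvgL2_comp c2 gt; have := cvgL2_comp c1 gt; rewrite {}E2 {c1 c2}.
have H s : H10 (z s) /\ H1 (z1 s) by case: (Hz s).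
subst z1 => C1 C2; apply: cvgLinf_wderiv => //; [by case: (H t)|by case: (H t)].
Qed.

Lemma cvg_a_unif : cvgLinf I F (fun p => a (g p)) (a t).
Proof.
have [c0 c1 _] := cont_a Z; apply: cvgLinf_jet c0 c1.
by move=> s; split; [exact: Ha|exact: Ea1].
Qed.

Lemma cvg_b_unif : cvgLinf I F (fun p => b (g p)) (b t).
Proof.
have [c0 c1 _] := cont_b Z; apply: cvgLinf_jet c0 c1.
by move=> s; split; [exact: Hb|exact: Eb1].
Qed.

Lemma cvg_v_unif : cvgLinf I F (fun p => v (g p)) (v t).
Proof.
have [c0 c1] := cont_v Z; apply: cvgLinf_jet c0 c1.
by move=> s; split; [exact: Hv|exact: Ev1].
Qed.

Lemma cvg_a1_unif : cvgLinf I F (fun p => a1 (g p)) (a1 t).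
Proof. by have [_ c1 c2] := cont_a Z; apply: cvgLinf_jet1 c1 c2; exact: zak_a. Qed.

Lemma cvg_b1_unif : cvgLinf I F (fun p => b1 (g p)) (b1 t).
Proof. by have [_ c1 c2] := cont_b Z; apply: cvgLinf_jet1 c1 c2; exact: zak_b. Qed.

Lemma cvg_dens1 : cvgL2 I F (fun p => dens1 (g p)) (dens1 t).
Proof.
have [_ c1 c2] := cont_a Z; have [_ d1 d2] := cont_b Z.
apply: cvgL2_Z => //; apply: cvgL2_D => //; apply: cvgL2_M => //.
- exact: cvg_a_unif.
- exact: (cvgL2_comp c1 gt).
- exact: cvg_b_unif.
- exact: (cvgL2_comp d1 gt).
Qed.

Lemma cvg_dens2 : cvgL2 I F (fun p => dens2 (g p)) (dens2 t).
Proof.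
have [_ c1 c2] := cont_a Z; have [_ d1 d2] := cont_b Z.
apply: cvgL2_Z => //; apply: cvgL2_D => //; apply: cvgL2_D => //; apply: cvgL2_M => //.
- exact: cvg_a_unif.
- exact: (cvgL2_comp c2 gt).
- exact: cvg_a1_unif.
- exact: (cvgL2_comp c1 gt).
- exact: cvg_b_unif.
- exact: (cvgL2_comp d2 gt).
- exact: cvg_b1_unif.
- exact: (cvgL2_comp d1 gt).
Qed.

End uniform_limits.

Lemma cont_a_t : contL2 I a_t.
Proof.
have [_ _ d2] := cont_b Z; have [d0 _ _] := cont_b Z => t.
have V := @cvg_v_unif _ (nbhs t) (nbhs_filter t) id t cvg_id.
exact: (cvgL2_B oI (cvgL2_M oI V (d0 t)) (d2 t)).
Qed.

Lemma cont_b_t : contL2 I b_t.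
Proof.
have [_ _ c2] := cont_a Z; have [c0 _ _] := cont_a Z => t.
have V := @cvg_v_unif _ (nbhs t) (nbhs_filter t) id t cvg_id.
exact: (cvgL2_B oI (c2 t) (cvgL2_M oI V (c0 t))).
Qed.

Lemma cont_v_t : contL2 I v_t.
Proof. by have [_ d1] := cont_w Z => t; exact: (cvgL2_N oI (d1 t)). Qed.

Lemma a_tE t : a_t t = v t * b t - b2 t. Proof. by []. Qed.
Lemma b_tE t : b_t t = a2 t - v t * a t. Proof. by []. Qed.
Lemma v_tE t : v_t t = - w1 t. Proof. by []. Qed.
Lemma w_tE t : w_t t = - v1 t - dens1 t. Proof. by []. Qed.

Lemma densE t : dens t = a t * a t + b t * b t. Proof. by []. Qed.
Lemma dens2E t : dens2 t =
  2 *: ((a t * a2 t + a1 t * a1 t) + (b t * b2 t + b1 t * b1 t)).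
Proof. by []. Qed.

Opaque a_t b_t v_t w_t dens dens1 dens2.

Lemma ibp_ab2 s t : ip (a s) (b2 t) = - ip (a1 s) (b1 t).
Proof. by rewrite Eb2 Ea1; exact: ibp. Qed.

Lemma ibp_ba2 s t : ip (b s) (a2 t) = - ip (b1 s) (a1 t).
Proof. by rewrite Ea2 Eb1; exact: ibp. Qed.

Lemma ibp_wv s t : ip (w s) (v1 t) = - ip (w1 s) (v t).
Proof. by rewrite Ev1 Ew1; exact: ibp. Qed.

(** The potential [v] acts as a real multiplier and the Laplacian is symmetric; the
contributions of [a] and [b] cancel. *)
Lemma mass_conserved t : ip (a t) (a t) + ip (b t) (b t) = ip (a 0) (a 0) + ip (b 0) (b 0).
Proof.
apply: (derive0_cst (f := fun t => ip (a t) (a t) + ip (b t) (b t))) => {}t.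
have [ca _ _] := cont_a Z; have [cb _ _] := cont_b Z.
have D1 := derL2_sqr oI t ca (der_a Z); have D2 := derL2_sqr oI t cb (der_b Z).
apply: is_derive_eq (is_deriveD D1 D2) _.
rewrite a_tE b_tE; ip_expand.
rewrite (ip_swap I (b t) (a t)) ibp_ab2 ibp_ba2.
by rewrite (ipC I (b1 t)); ring.
Qed.

(** Formally the derivative of [|z_x|^2] is [2 <z_x, z'_x> = - 2 <z', z_xx>]; the
curve [z'] takes values in L2 only, so the integration by parts is done on the
difference quotients, before the limit. *)
Lemma is_derive_dirichlet (z z1 z2 z' : R -> R -> R) t :
  (forall s, [/\ H10 (z s), H1 (z1 s), z1 s = wderiv (z s) & z2 s = wderiv (z1 s)]) ->
  contL2 I z2 -> derL2 I z z' ->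
  is_derive t (1 : R) (fun t => ip (z1 t) (z1 t)) (- 2 * ip (z' t) (z2 t)).
Proof.
move=> Hz c2 dz.
have L2z s : L2 (z s) by case: (Hz s) => /H10_H1/H1_L2.
have L2z1 s : L2 (z1 s) by case: (Hz s) => _ /H1_L2.
have L2z2 s : L2 (z2 s) by exact: contL2_L2.
have IBP s r : ip (z s) (z2 r) = - ip (z1 s) (z1 r).
  have [Hs _ E1 _] := Hz s; have [_ Hr _ E2] := Hz r.
  by rewrite E2 E1; exact: ibp.
apply: is_derive_lim.
rewrite (_ : (fun h => _) = (fun h => - ip (diffq z h t) (z2 (t + h) + z2 t))); last first.
  apply/funext => h; rewrite /diffq; move: (t + h) => s.
  have [Ls Lt] := (L2z s, L2z t); have [Ls2 Lt2] := (L2z2 s, L2z2 t).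
  ip_expand; rewrite !IBP.
  by rewrite (ipC I (z1 s) (z1 t)); ring.
rewrite (_ : - 2 * _ = - ip (z' t) (z2 t + z2 t)); last first.
  by rewrite (ipDr mI) //; [ring|exact: derL2_L2 dz t].
have C1 : cvgL2 I (0 : R)^' (fun h => z2 (t + h)) (z2 t).
  exact: (cvgL2_comp c2 (@cvg_shift0 _ t)).
have C2 : cvgL2 I (0 : R)^' (fun=> z2 t) (z2 t) by apply: cvgL2_cst.
by apply: cvgN; apply: (cvgL2_ip oI (dz t)); apply: cvgL2_D.
Qed.

Lemma derL2_sqr_fun (z z1 z' : R -> R -> R) : (forall s, H10 (z s) /\ z1 s = wderiv (z s)) ->
  contL2 I z -> contL2 I z1 ->
  derL2 I z z' -> derL2 I (fun t => z t * z t) (fun t => (z t + z t) * z' t).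
Proof.
move=> Hz c0 c1 dz t.
rewrite (_ : (fun h => _) = (fun h => (z (t + h) + z t) * diffq z h t)); last first.
  apply/funext => h; rewrite /diffq; move: (t + h) => s; apply/funext => x.
  by rewrite !fctE /GRing.scale/=; ring.
have C0 : cvgLinf I (0 : R)^' (fun h => z (t + h)) (z t).
  by apply: (cvgLinf_jet (@cvg_shift0 _ t) Hz c0 c1).
have C1 : cvgLinf I (0 : R)^' (fun=> z t) (z t).
  by apply: cvgLinf_cst; apply: H10_Linf => //; case: (Hz t).
have C2 : cvgLinf I (0 : R)^' (fun h => z (t + h) + z t) (z t + z t) by apply: cvgLinf_D.
by apply: (cvgL2_M oI C2 (dz t)).
Qed.

(** The product rule applies because [c] and [c1] are bounded: the derivative of [c c1]
is square integrable. *)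
Lemma ibp_prod f c c1 c2 : H10 f -> H10 c -> H1 c1 -> c1 = wderiv c -> c2 = wderiv c1 ->
  ip (wderiv f) (c * c1) = - ip f (c * c2 + c1 * c1).
Proof.
move=> f0 c0 Hc1 E1 E2.
have Lf : L2 f by exact/H1_L2/H10_H1.
have Lf' : L2 (wderiv f) by exact: L2_wderiv.
have Lc : L2 c by exact/H1_L2/H10_H1.
have Ic : Linf I c by exact: H10_Linf.
have Ic1 : Linf I c1 by rewrite E1; apply: wderiv_Linf => //; rewrite -E1.
have Lc1 : L2 c1 by exact: H1_L2.
have Lc2 : L2 c2 by rewrite E2; exact: L2_wderiv.
have W := weakM oI iI Hc1 c0; rewrite -E1 -E2 in W.
have P2 : L2 (c1 * c) by L2_tac.
have Q2 : L2 (c2 * c + c1 * c1) by rewrite (mulrC _ c); L2_tac.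
have := ibp oI iI f0 (H1_intro P2 Q2 W).
rewrite ipC (ip_ae mI (L2_wderiv I (c1 * c)) Q2 Lf (wderiv_ae oI Q2 W P2)) ipC.
by rewrite (mulrC _ c) (mulrC c1 c) => ->; rewrite opprK.
Qed.

Lemma ibp_sqr f c c1 : H10 f -> H10 c -> c1 = wderiv c ->
  ip (wderiv f) (c * c) = - 2 * ip f (c * c1).
Proof.
move=> f0 c0 E1.
have Lf : L2 f by exact/H1_L2/H10_H1.
have Lc : L2 c by exact/H1_L2/H10_H1.
have Ic : Linf I c by exact: H10_Linf.
have Lc1 : L2 c1 by rewrite E1; exact: L2_wderiv.
have W := weakM oI iI (H10_H1 c0) c0; rewrite -E1 in W.
have P2 : L2 (c * c) by L2_tac.
have C2 : L2 (c * c1) by L2_tac.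
have Q2 : L2 (c1 * c + c * c1) by rewrite (mulrC _ c); L2_tac.
have := ibp oI iI f0 (H1_intro P2 Q2 W).
rewrite ipC (ip_ae mI (L2_wderiv I (c * c)) Q2 Lf (wderiv_ae oI Q2 W P2)) ipC.
rewrite (mulrC _ c) (ipDr mI)//.
by move=> E; rewrite -[LHS]opprK -E; ring.
Qed.

Transparent dens dens1 dens2.

Lemma ibp_dens1 f t : H10 f -> ip (wderiv f) (dens1 t) = - ip f (dens2 t).
Proof.
move=> f0; have Lf : L2 f by exact/H1_L2/H10_H1.
have Lf' : L2 (wderiv f) by exact: L2_wderiv.
have E1 := ibp_prod f0 (Ha t) (H1a1 t) (Ea1 t) (Ea2 t).
have E2 := ibp_prod f0 (Hb t) (H1b1 t) (Eb1 t) (Eb2 t).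
rewrite /dens1 /dens2 (ipZr mI) ?(ipDr mI) ?E1 ?E2; try solve [L2_tac].
have P1 : L2 (a t * a2 t + a1 t * a1 t) by L2_tac.
have P2 : L2 (b t * b2 t + b1 t * b1 t) by L2_tac.
rewrite (ipZr mI) ?(ipDr mI P1 P2)//; first ring.
exact: L2D.
Qed.

Lemma ibp_dens f t : H10 f -> ip (wderiv f) (dens t) = - ip f (dens1 t).
Proof.
move=> f0; have Lf : L2 f by exact/H1_L2/H10_H1.
have Lf' : L2 (wderiv f) by exact: L2_wderiv.
have E1 := ibp_sqr f0 (Ha t) (Ea1 t); have E2 := ibp_sqr f0 (Hb t) (Eb1 t).
rewrite /dens1 /dens (ipDr mI) ?E1 ?E2; try solve [L2_tac].
rewrite (ipZr mI) ?(ipDr mI); try solve [L2_tac].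
ring.
Qed.

Opaque dens dens1 dens2.

Lemma ibp_v1_dens1 s t : ip (v1 s) (dens1 t) = - ip (v s) (dens2 t).
Proof. by rewrite Ev1 ibp_dens1. Qed.

Definition energy t := ip (a1 t) (a1 t) + ip (b1 t) (b1 t) + ip (v t) (dens t)
  + 2^-1 * (ip (v t) (v t) + ip (w t) (w t)).

Lemma der_dens : derL2 I dens (fun t => (a t + a t) * a_t t + (b t + b t) * b_t t).
Proof.
have [ca ca1 _] := cont_a Z; have [cb cb1 _] := cont_b Z.
have Hz1 s : H10 (a s) /\ a1 s = wderiv (a s) by split; [exact: Ha|exact: Ea1].
have Hz2 s : H10 (b s) /\ b1 s = wderiv (b s) by split; [exact: Hb|exact: Eb1].
have D1 := derL2_sqr_fun Hz1 ca ca1 (der_a Z).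
have D2 := derL2_sqr_fun Hz2 cb cb1 (der_b Z).
exact: (derL2_D oI D1 D2).
Qed.

Lemma cont_dens : contL2 I dens.
Proof.
have [ca _ _] := cont_a Z; have [cb _ _] := cont_b Z => s.
have V1 := @cvg_a_unif _ (nbhs s) (nbhs_filter s) id s cvg_id.
have V2 := @cvg_b_unif _ (nbhs s) (nbhs_filter s) id s cvg_id.
exact: (cvgL2_D oI (cvgL2_M oI V1 (ca s)) (cvgL2_M oI V2 (cb s))).
Qed.

Lemma energy_conserved t : energy t = energy 0.
Proof.
apply: derive0_cst => {}t.
have [ca ca1 ca2] := cont_a Z; have [cb cb1 cb2] := cont_b Z.
have [cv cv1] := cont_v Z; have [cw cw1] := cont_w Z.
have D1 := is_derive_dirichlet t (zak_a Z) ca2 (der_a Z).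
have D2 := is_derive_dirichlet t (zak_b Z) cb2 (der_b Z).
have D3 := derL2_ip oI t cv cont_dens (der_v Z) der_dens.
have D4 := derL2_sqr oI t cv (der_v Z); have D5 := derL2_sqr oI t cw (der_w Z).
have D := is_deriveD (is_deriveD (is_deriveD D1 D2) D3) (is_deriveZ (2^-1) (is_deriveD D4 D5)).
apply: is_derive_eq D _.
have a2E : a2 t = b_t t + v t * a t by rewrite b_tE subrK.
have b2E : b2 t = v t * b t - a_t t by rewrite a_tE; ring.
have -> : ip (v t) ((a t + a t) * a_t t + (b t + b t) * b_t t) =
    2 * ip (a_t t) (v t * a t) + 2 * ip (b_t t) (v t * b t).
  have -> : (a t + a t) * a_t t + (b t + b t) * b_t t = 2 *: (a t * a_t t) + 2 *: (b t * b_t t).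
    by apply/funext => x; rewrite !fctE /GRing.scale/=; ring.
  rewrite (ipDr mI) ?(ipZr mI); try solve [L2_all].
  by congr (2 * _ + 2 * _); rewrite ip_swap (mulrC (v t)).
rewrite a2E b2E v_tE w_tE /GRing.scale/=.
have K1 := ibp_dens t (Hw t); rewrite -Ew1 in K1.
have [LA LB Ld Ld1] := And4 (La_t t) (Lb_t t) (Ldens t) (Ldens1 t).
move: (a_t t) (b_t t) (dens t) (dens1 t) LA LB Ld Ld1 K1 => A B d d1 LA LB Ld Ld1 K1.
ip_expand.
rewrite (ipC I B A) ibp_wv K1 (ipC I (v t) (w1 t)).
by field.
Qed.

(** * The second-order energy *)

(** The difference quotients of [u] solve the Schrodinger equation with the source
[- i u D v], where [D v] is the difference quotient of [v]; only the source
contributes to the variation of their norm. *)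
Lemma diffq_balance (c r s : R) :
  ip (c *: (a r - a s)) (c *: (a_t r - a_t s)) + ip (c *: (b r - b s)) (c *: (b_t r - b_t s)) =
  ip (c *: (a r - a s)) (b s * (c *: (v r - v s))) - ip (c *: (b r - b s)) (a s * (c *: (v r - v s))).
Proof.
have -> : a_t r - a_t s = v r * (b r - b s) + b s * (v r - v s) - (b2 r - b2 s).
  by rewrite !a_tE; ring.
have -> : b_t r - b_t s = (a2 r - a2 s) - v r * (a r - a s) - a s * (v r - v s).
  by rewrite !b_tE; ring.
have scaleMr (f g : R -> R) : f * (c *: g) = c *: (f * g).
  by apply/funext => x; rewrite !fctE /GRing.scale/=; ring.
rewrite !scaleMr.
have EA : ip (a r - a s) (b2 r - b2 s) = - ip (a1 r - a1 s) (b1 r - b1 s).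
  by ip_expand; rewrite !ibp_ab2; ring.
have EB : ip (b r - b s) (a2 r - a2 s) = - ip (a1 r - a1 s) (b1 r - b1 s).
  by ip_expand; rewrite !ibp_ba2 !(ipC I (b1 _) (a1 _)); ring.
have LA : L2 (a r - a s) by L2_tac.
have LB : L2 (b r - b s) by L2_tac.
have LV : L2 (v r - v s) by L2_tac.
have LA2 : L2 (a2 r - a2 s) by L2_tac.
have LB2 : L2 (b2 r - b2 s) by L2_tac.
have SW := ip_swap I (a r - a s) (b r - b s) (v r).
move: (a r - a s) (b r - b s) (v r - v s) (a2 r - a2 s) (b2 r - b2 s)
  LA LB LV LA2 LB2 EA EB SW => A B V A2 B2 LA LB LV LA2 LB2 EA EB SW.
have P1 : L2 (v r * B) by L2_tac.
have P2 : L2 (b s * V) by L2_tac.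
have P3 : L2 (v r * A) by L2_tac.
have P4 : L2 (a s * V) by L2_tac.
move: (v r * B) (b s * V) (v r * A) (a s * V) P1 P2 P3 P4 SW => C1 C2 C3 C4 P1 P2 P3 P4 SW.
ip_expand.
by rewrite EA EB SW; ring.
Qed.

(** [u_t] has no time derivative in L2. Its norm is the limit of the norms of the
difference quotients of [u], whose derivatives, given by [diffq_balance], converge. *)
Lemma is_derive_kinetic t : is_derive t (1 : R)
  (fun s => ip (a_t s) (a_t s) + ip (b_t s) (b_t s))
  (2 * ip (a_t t) (b t * v_t t) - 2 * ip (b_t t) (a t * v_t t)).
Proof.
have [ca _ _] := cont_a Z; have [cb _ _] := cont_b Z; have [cv _] := cont_v Z.
have F := joint_filter t.
apply: (@is_derive_regularization _
  (fun h s => ip (diffq a h s) (diffq a h s) + ip (diffq b h s) (diffq b h s))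
  (fun h s => 2 * ip (diffq a h s) (b s * diffq v h s) - 2 * ip (diffq b h s) (a s * diffq v h s))).
- move=> h s _ _.
  have D1 := derL2_sqr oI s (contL2_diffq oI h ca) (derL2_diffq oI h (der_a Z)).
  have D2 := derL2_sqr oI s (contL2_diffq oI h cb) (derL2_diffq oI h (der_b Z)).
  apply: is_derive_eq (is_deriveD D1 D2) _.
  by rewrite -mulrDr diffq_balance mulrBr.
- move=> s _; apply: cvgD.
    exact: (cvgL2_ip oI (der_a Z s) (der_a Z s)).
  exact: (cvgL2_ip oI (der_b Z s) (der_b Z s)).
- have Sa := strict_derL2 oI t ca (der_a Z) cont_a_t.
  have Sb := strict_derL2 oI t cb (der_b Z) cont_b_t.
  have Sv := strict_derL2 oI t cv (der_v Z) cont_v_t.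
  have Ua : cvgLinf I (filter_prod (0 : R)^' (nbhs t)) (fun p => a p.2) (a t).
    by apply: cvg_a_unif; exact: cvg_joint_snd.
  have Ub : cvgLinf I (filter_prod (0 : R)^' (nbhs t)) (fun p => b p.2) (b t).
    by apply: cvg_b_unif; exact: cvg_joint_snd.
  have Pa : cvgL2 I (filter_prod (0 : R)^' (nbhs t)) (fun p => b p.2 * diffq v p.1 p.2)
    (b t * v_t t) by apply: cvgL2_M.
  have Pb : cvgL2 I (filter_prod (0 : R)^' (nbhs t)) (fun p => a p.2 * diffq v p.1 p.2)
    (a t * v_t t) by apply: cvgL2_M.
  apply: cvgB; apply: cvgM; do ?exact: cvg_cst.
    exact: (cvgL2_ip oI Sa Pa).
  exact: (cvgL2_ip oI Sb Pb).
Qed.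

Lemma is_derive_cross (p q t : R) : is_derive t (1 : R) (fun s => ip (w1 (s + p)) (v (s + q)))
  (- ip (w_t (t + p)) (v1 (t + q)) + ip (w1 (t + p)) (v_t (t + q))).
Proof.
have [cv cv1] := cont_v Z; have [cw cw1] := cont_w Z.
apply: is_derive_lim.
rewrite (_ : (fun h => _) = (fun h => - ip (diffq w h (t + p)) (v1 ((t + q) + h)) +
    ip (w1 (t + p)) (diffq v h (t + q)))); last first.
  apply/funext => h; rewrite /diffq (addrAC t h p) (addrAC t h q).
  move: (t + p) (t + q) => P Q; move: (P + h) (Q + h) => Ph Qh.
  by ip_expand; rewrite !ibp_wv; ring.
have C1 : cvgL2 I (0 : R)^' (fun h => v1 ((t + q) + h)) (v1 (t + q)).
  exact: (cvgL2_comp cv1 (@cvg_shift0 _ (t + q))).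
have C2 : cvgL2 I (0 : R)^' (fun=> w1 (t + p)) (w1 (t + p)) by apply: cvgL2_cst => //; L2_tac.
apply: cvgD.
  by apply: cvgN; exact: (cvgL2_ip oI (der_w Z (t + p)) C1).
exact: (cvgL2_ip oI C2 (der_v Z (t + q))).
Qed.

Lemma continuous_cross : continuous (fun s => ip (v1 s) (dens1 s)).
Proof.
have [_ cv1] := cont_v Z => t; have F := nbhs_filter t.
have D := @cvg_dens1 _ (nbhs t) F id t cvg_id.
exact: (cvgL2_ip oI (cv1 t) D).
Qed.

(** The terms with two space derivatives of [v] or [w] cancel by the symmetry of
the wave equation; those with the density are integrated by parts, so that the
right-hand side involves no difference quotient of a derivative. *)
Lemma cross_balance (c s t : R) :
  c * ((- ip (w_t s) (v1 t) + ip (w1 s) (v_t t)) - (- ip (w_t t) (v1 s) + ip (w1 t) (v_t s)))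
    - c * (ip (v1 s) (dens1 s) - ip (v1 t) (dens1 t)) =
  ip (c *: (v s - v t)) (dens2 s + dens2 t).
Proof.
rewrite !w_tE !v_tE.
have E1 := ibp_v1_dens1 s s; have E2 := ibp_v1_dens1 s t.
have E3 := ibp_v1_dens1 t s; have E4 := ibp_v1_dens1 t t.
have [P1 P2 P3 P4] := And4 (Ldens1 s) (Ldens1 t) (Ldens2 s) (Ldens2 t).
move: (dens1 s) (dens1 t) (dens2 s) (dens2 t) P1 P2 P3 P4 E1 E2 E3 E4 =>
  p q p2 q2 P1 P2 P3 P4 E1 E2 E3 E4.
ip_expand.
rewrite (ipC I p (v1 t)) (ipC I q (v1 s)) (ipC I (v1 t) (v1 s)) (ipC I (w1 t) (w1 s)).
by rewrite E1 E2 E3 E4; ring.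
Qed.

(** By the equations for [v_t] and [w_t], the sum of the squared norms of [w_x] and
[v_x] is [<w_x, w_x> - <w_t, v_x> - <v_x, (|u|^2)_x>]. The first two terms are the limit
of an antisymmetric difference quotient of [<w_x, v>], and the last one is the
derivative of a function [K]; the regularization replaces it by the difference
quotient of [K]. *)
Lemma is_derive_wave t : is_derive t (1 : R)
  (fun s => ip (w1 s) (w1 s) + ip (v1 s) (v1 s)) (2 * ip (v_t t) (dens2 t)).
Proof.
have [cv cv1] := cont_v Z; have [cw cw1] := cont_w Z.
have F := joint_filter t.
have [K DK] := continuous_antiderivative continuous_cross t.
apply: (@is_derive_regularization _
  (fun h s => h^-1 * (ip (w1 (s + h)) (v s) - ip (w1 s) (v (s + h))) - h^-1 * (K (s + h) - K s))
  (fun h s => ip (diffq v h s) (dens2 (s + h) + dens2 s))).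
- move=> h s /andP[_ h1] st.
  have := is_derive_cross h 0 s; have := is_derive_cross 0 h s.
  rewrite !addr0 (_ : (fun s => ip (w1 (s + 0)) (v (s + h))) = (fun s => ip (w1 s) (v (s + h)))); last first.
    by apply/funext => r; rewrite addr0.
  rewrite (_ : (fun s => ip (w1 (s + h)) (v (s + 0))) = (fun s => ip (w1 (s + h)) (v s))); last first.
    by apply/funext => r; rewrite addr0.
  move=> D1 D2.
  have s1 : t - 2 < s < t + 2 by move: st; rewrite ltr_norml => /andP[]; lra.
  have s2 : t - 2 < s + h < t + 2.
    by move: st h1; rewrite !ltr_norml => /andP[? ?] /andP[? ?]; apply/andP; split; lra.
  have D3 := is_derive_shift (DK _ s2); have D4 := DK _ s1.
  have D := is_deriveB (is_deriveZ h^-1 (is_deriveB D2 D1)) (is_deriveZ h^-1 (is_deriveB D3 D4)).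
  apply: is_derive_eq D _.
  by rewrite /GRing.scale/= /diffq; move: (s + h) => r; exact: cross_balance.
- move=> s st.
  have s1 : t - 2 < s < t + 2 by move: st; rewrite ltr_norml => /andP[]; lra.
  rewrite (_ : (fun h => _) = (fun h => (- ip (diffq w h s) (v1 s) - ip (w1 s) (diffq v h s))
     - h^-1 * (K (s + h) - K s))); last first.
    apply/funext => h; congr (_ - _); rewrite /diffq; move: (s + h) => r.
    by ip_expand; rewrite !ibp_wv; ring.
  have -> : ip (w1 s) (w1 s) + ip (v1 s) (v1 s) =
      (- ip (w_t s) (v1 s) - ip (w1 s) (v_t s)) - ip (v1 s) (dens1 s).
    rewrite w_tE v_tE; have P := Ldens1 s; move: (dens1 s) P => p P.
    by ip_expand; rewrite (ipC I p); ring.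
  apply: cvgB; last exact: (is_derive_cvg (DK _ s1)).
  have C1 : cvgL2 I (0 : R)^' (fun=> w1 s) (w1 s) by apply: cvgL2_cst => //; L2_tac.
  have C2 : cvgL2 I (0 : R)^' (fun=> v1 s) (v1 s) by apply: cvgL2_cst => //; L2_tac.
  apply: cvgB; last exact: (cvgL2_ip oI C1 (der_v Z s)).
  by apply: cvgN; exact: (cvgL2_ip oI (der_w Z s) C2).
- have Sv := strict_derL2 oI t cv (der_v Z) cont_v_t.
  have Ds := @cvg_dens2 _ (filter_prod (0 : R)^' (nbhs t)) F (fun p => p.2 + p.1) t (@cvg_joint_sum _ t).
  have Dt := @cvg_dens2 _ (filter_prod (0 : R)^' (nbhs t)) F (fun p => p.2) t (@cvg_joint_snd _ t).
  have -> : 2 * ip (v_t t) (dens2 t) = ip (v_t t) (dens2 t + dens2 t).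
    have [P Q] := (Lv_t t, Ldens2 t); move: (v_t t) (dens2 t) P Q => V D P Q.
    by ip_expand; ring.
  exact: (cvgL2_ip oI Sv (cvgL2_D oI Ds Dt)).
Qed.

(** With the weight 2 the terms in [u_t] cancel in the time derivative: by the
Schrodinger equation, [(|u|^2)_xx] is [2 (|u|^2 v + |u_x|^2)] plus a term in [u_t], which
compensates the derivative of the norm of [u_t]. *)
Definition energy2 t := 2 * (ip (a_t t) (a_t t) + ip (b_t t) (b_t t))
  + (ip (w1 t) (w1 t) + ip (v1 t) (v1 t)).

Lemma is_derive_energy2 t : is_derive t (1 : R) energy2
  (4 * ip (v_t t) (dens t * v t + (a1 t * a1 t + b1 t * b1 t))).
Proof.
have D := is_deriveD (is_deriveZ 2 (is_derive_kinetic t)) (is_derive_wave t).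
apply: is_derive_eq D _.
have -> : dens2 t = 2 *: (a t * b_t t - b t * a_t t + (dens t * v t + (a1 t * a1 t + b1 t * b1 t))).
  rewrite b_tE a_tE densE dens2E; apply/funext => x.
  by rewrite !fctE /GRing.scale/=; ring.
rewrite (ip_swap I (a_t t)) (ip_swap I (b_t t)) /GRing.scale/=.
have P1 : L2 (a t * b_t t) by L2_all.
have P2 : L2 (b t * a_t t) by L2_all.
have P3 : L2 (dens t * v t + (a1 t * a1 t + b1 t * b1 t)).
  apply: L2D; last by L2_tac.
  by rewrite mulrC; L2_all.
have P4 := Lv_t t.
move: (v_t t) (a t * b_t t) (b t * a_t t) (dens t * v t + _) P1 P2 P3 P4 => V A B Q P1 P2 P3 P4.
by ip_expand; ring.
Qed.

(** * Growth estimates *)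

Definition mass t := ip (a t) (a t) + ip (b t) (b t).

Lemma L2norm_mul_bounded f g (M : R) : H10 f -> 0 <= M -> L2 g ->
  {ae @lebesgue_measure R, forall x, I x -> `|f x| <= M} -> L2norm (f * g) <= M * L2norm g.
Proof.
move=> f0 M0 g2 fM; apply: (L2norm_mulB mI) => //.
exact: (L2_measurable mI (H1_L2 (H10_H1 f0))).
Qed.

(** The norm of [|u|^2] in L2 is at most the product of the uniform norm and the L2
norm of [u], and the uniform norm is interpolated between the mass and the gradient. *)
Lemma interaction_bound t : `|ip (v t) (dens t)| <=
  4^-1 * ip (v t) (v t) + 2^-1 * (ip (a1 t) (a1 t) + ip (b1 t) (b1 t)) + quartic (mass t).
Proof.
rewrite densE /mass -(L2norm_sqr (Lv t)) -(L2norm_sqr (La t)) -(L2norm_sqr (Lb t))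
  -(L2norm_sqr (La1 t)) -(L2norm_sqr (Lb1 t)).
set m := _ + L2norm (b t) ^+ 2.
have m0 : 0 <= m by rewrite addr_ge0// sqr_ge0.
have l2pos : 0 < 8 * m + 1 by lra.
pose l := Num.sqrt (8 * m + 1).
have l0 : 0 < l by rewrite sqrtr_gt0.
have lE : l ^+ 2 = 8 * m + 1 by rewrite sqr_sqrtr// ltW.
have rE : l^-1 ^+ 2 * (8 * m + 1) = 1 by rewrite -lE -exprMn mulVf ?expr1n// gt_eqF.
have r0 : 0 < l^-1 by rewrite invr_gt0.
have Sa := H10_sup oI iI (Ha t) l0; rewrite -Ea1 in Sa.
have Sb := H10_sup oI iI (Hb t) l0; rewrite -Eb1 in Sb.
have Sa0 : 0 <= l * L2norm (a t) + l^-1 * L2norm (a1 t).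
  by rewrite addr_ge0// mulr_ge0 ?L2norm_ge0// ltW.
have Sb0 : 0 <= l * L2norm (b t) + l^-1 * L2norm (b1 t).
  by rewrite addr_ge0// mulr_ge0 ?L2norm_ge0// ltW.
have na := L2norm_mul_bounded (Ha t) Sa0 (La t) Sa.
have nb := L2norm_mul_bounded (Hb t) Sb0 (Lb t) Sb.
have P1 : L2 (a t * a t) by L2_tac.
have P2 : L2 (b t * b t) by L2_tac.
have nd := L2norm_triangle mI P1 P2.
have nip := ip_le mI (Lv t) (L2D P1 P2).
have V0 := L2norm_ge0 I (v t).
move: na nb nd nip Sa0 Sb0 V0; rewrite /m in m0 l2pos lE rE *.
move: (L2norm (a t)) (L2norm (b t)) (L2norm (a1 t)) (L2norm (b1 t)) (L2norm (v t))
  (L2norm (a t * a t)) (L2norm (b t * b t)) (L2norm (a t * a t + b t * b t))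
  `|ip _ _| (l) (l^-1) lE rE m0 => A B A1 B1 V AA BB P N l' r lE' rE' m0' na nb nd nip Sa0 Sb0 V0.
exact: (interaction_arith lE' rE' m0' na nb nd nip V0).
Qed.

Context (X : R).
Context (X_mass : mass 0 <= X).
Context (X_dir : ip (a1 0) (a1 0) + ip (b1 0) (b1 0) <= X).
Context (X_lap : ip (a2 0) (a2 0) + ip (b2 0) (b2 0) <= X).
Context (X_v : ip (v 0) (v 0) + ip (v1 0) (v1 0) <= X).
Context (X_w : ip (w 0) (w 0) + ip (w1 0) (w1 0) <= X).

Let X0 : 0 <= X.
Proof. by apply: le_trans X_mass; rewrite addr_ge0// ip_ge0. Qed.

Let sq0 f : 0 <= ip f f. Proof. exact: ip_ge0. Qed.

Let S : R := low_bound X.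

Let N0 : 0 <= 12 * X + 8 * quartic X.
Proof. by rewrite addr_ge0// mulr_ge0// quartic_ge0. Qed.

Lemma low_order_bound t : [/\ mass t <= 12 * X + 8 * quartic X,
  ip (a1 t) (a1 t) + ip (b1 t) (b1 t) <= 12 * X + 8 * quartic X,
  ip (v t) (v t) <= 12 * X + 8 * quartic X & ip (w t) (w t) <= 12 * X + 8 * quartic X].
Proof.
have mE : mass t = mass 0 by exact: mass_conserved.
have := energy_conserved t; rewrite /energy.
have := interaction_bound t; have := interaction_bound 0; rewrite mE.
have m0 : 0 <= mass 0 by rewrite addr_ge0// ip_ge0.
have qX : quartic (mass 0) <= quartic X by exact: quartic_mono.
have q0 := quartic_ge0 X0.
rewrite !ler_norml => /andP[_ I1] /andP[I2 _].
have v10 := sq0 (v1 0); have w10 := sq0 (w1 0).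
have vt0 := sq0 (v t); have wt0 := sq0 (w t); have w00 := sq0 (w 0).
have v00 := sq0 (v 0).
have a0 := sq0 (a1 t); have b0 := sq0 (b1 t).
move=> E; exact: (low_order_arith m0 X_mass qX q0 I2 I1 E a0 b0 vt0 wt0 v00 w00 v10 w10
  X_dir X_v X_w).
Qed.

Lemma low_order_norms t :
  [/\ L2norm (a t) <= S, L2norm (b t) <= S, L2norm (a1 t) <= S & L2norm (b1 t) <= S] /\
  (L2norm (v t) <= S /\ L2norm (w t) <= S).
Proof.
have [H1' H2' H3' H4'] := low_order_bound t.
have [p1 p2 p3 p4] := And4 (sq0 (a t)) (sq0 (b t)) (sq0 (a1 t)) (sq0 (b1 t)).
rewrite /mass in H1'.
split; split; apply: ler_sqr1; rewrite L2norm_sqr //; by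
  [apply: le_trans H1'; rewrite ?lerDl ?lerDr|apply: le_trans H2'; rewrite ?lerDl ?lerDr].
Qed.

Lemma sup_bound t : {ae @lebesgue_measure R, forall x, I x -> `|a t x| <= 2 * S} /\
  {ae @lebesgue_measure R, forall x, I x -> `|b t x| <= 2 * S}.
Proof.
have [[na nb na1 nb1] _] := low_order_norms t.
split.
  have := H10_sup oI iI (Ha t) ltr01; rewrite -Ea1; apply: aeS => x /[apply] H.
  by rewrite (le_trans H)// invr1 !mul1r [leRHS]mulrDl mul1r lerD.
have := H10_sup oI iI (Hb t) ltr01; rewrite -Eb1; apply: aeS => x /[apply] H.
by rewrite (le_trans H)// invr1 !mul1r [leRHS]mulrDl mul1r lerD.
Qed.

Let S0 : 0 <= S. Proof. by rewrite /S /low_bound addr_ge0. Qed.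

Lemma norm_dens_v t : L2norm (dens t * v t) <= 8 * S ^+ 3.
Proof.
have [sa sb] := sup_bound t; have [_ [nv _]] := low_order_norms t.
have md : measurable_fun I (dens t) by exact: L2_measurable.
have dS : {ae @lebesgue_measure R, forall x, I x -> `|dens t x| <= 8 * S ^+ 2}.
  apply: aeS (aeI sa sb) => x [ha hb] Ix; rewrite densE.
  have -> : (a t * a t + b t * b t) x = a t x ^+ 2 + b t x ^+ 2 by rewrite !fctE; ring.
  rewrite ger0_norm ?addr_ge0 ?sqr_ge0//.
  have := ha Ix; have := hb Ix; rewrite -ler_sqr ?nnegrE ?mulr_ge0//.
  rewrite real_normK ?num_real// => hb2; rewrite -ler_sqr ?nnegrE ?mulr_ge0//.
  by rewrite real_normK ?num_real// => ha2; lra.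
have := L2norm_mulB mI md (_ : 0 <= 8 * S ^+ 2) dS (Lv t).
rewrite mulr_ge0 ?sqr_ge0// => /(_ isT) /le_trans; apply.
rewrite (_ : 8 * S ^+ 3 = 8 * S ^+ 2 * S); last by ring.
by rewrite ler_wpM2l// mulr_ge0 ?sqr_ge0.
Qed.

Lemma norm_a2 t : L2norm (a2 t) <= L2norm (b_t t) + 2 * S ^+ 2.
Proof.
have [sa _] := sup_bound t; have [_ [nv _]] := low_order_norms t.
have E : a2 t = b_t t + a t * v t by rewrite b_tE mulrC subrK.
have P : L2 (a t * v t) by L2_tac.
rewrite {1}E (le_trans (L2norm_triangle mI (Lb_t t) P))// lerD2l.
have S2 : 0 <= 2 * S by rewrite mulr_ge0.
rewrite (le_trans (L2norm_mul_bounded (Ha t) S2 (Lv t) sa))//.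
by rewrite expr2 mulrA ler_wpM2l.
Qed.

Lemma norm_b2 t : L2norm (b2 t) <= L2norm (a_t t) + 2 * S ^+ 2.
Proof.
have [_ sb] := sup_bound t; have [_ [nv _]] := low_order_norms t.
have E : b2 t = - a_t t + b t * v t by rewrite a_tE (mulrC (b t)); ring.
have P : L2 (b t * v t) by L2_tac.
rewrite {1}E (le_trans (L2norm_triangle mI (L2N (La_t t)) P))// L2normN lerD2l.
have S2 : 0 <= 2 * S by rewrite mulr_ge0.
rewrite (le_trans (L2norm_mul_bounded (Hb t) S2 (Lv t) sb))//.
by rewrite expr2 mulrA ler_wpM2l.
Qed.

Lemma norm_a_t t : L2norm (a_t t) <= L2norm (b2 t) + 2 * S ^+ 2.
Proof.
have [_ sb] := sup_bound t; have [_ [nv _]] := low_order_norms t.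
have E : a_t t = - b2 t + b t * v t by rewrite a_tE (mulrC (b t)); ring.
have P : L2 (b t * v t) by L2_tac.
rewrite {1}E (le_trans (L2norm_triangle mI (L2N (Lb2 t)) P))// L2normN lerD2l.
have S2 : 0 <= 2 * S by rewrite mulr_ge0.
rewrite (le_trans (L2norm_mul_bounded (Hb t) S2 (Lv t) sb))//.
by rewrite expr2 mulrA ler_wpM2l.
Qed.

Lemma norm_b_t t : L2norm (b_t t) <= L2norm (a2 t) + 2 * S ^+ 2.
Proof.
have [sa _] := sup_bound t; have [_ [nv _]] := low_order_norms t.
have E : b_t t = a2 t + - (a t * v t) by rewrite b_tE (mulrC (a t)).
have P : L2 (a t * v t) by L2_tac.
rewrite {1}E (le_trans (L2norm_triangle mI (La2 t) (L2N P)))// L2normN lerD2l.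
have S2 : 0 <= 2 * S by rewrite mulr_ge0.
rewrite (le_trans (L2norm_mul_bounded (Ha t) S2 (Lv t) sa))//.
by rewrite expr2 mulrA ler_wpM2l.
Qed.

(** The derivative of the second-order energy is at most a multiple of its power
[3/4], so that its fourth root has a bounded derivative. *)
Definition root4 t := Num.sqrt (Num.sqrt (1 + energy2 t)).

Lemma energy2_ge0 t : 0 <= energy2 t.
Proof. by rewrite /energy2 addr_ge0 ?mulr_ge0 ?addr_ge0. Qed.

Lemma root4_ge1 t : 1 <= root4 t.
Proof.
have E0 := energy2_ge0 t.
rewrite /root4 -[X in X <= _]sqrtr1 ler_wsqrtr// -[X in X <= _]sqrtr1 ler_wsqrtr//.
by rewrite lerDl.
Qed.

Lemma root4_sqr t : root4 t ^+ 2 = Num.sqrt (1 + energy2 t).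
Proof. by rewrite sqr_sqrtr// sqrtr_ge0. Qed.

Lemma norms_le_root4 t : [/\ L2norm (a_t t) <= root4 t ^+ 2, L2norm (b_t t) <= root4 t ^+ 2,
  L2norm (w1 t) <= root4 t ^+ 2 & L2norm (v1 t) <= root4 t ^+ 2].
Proof.
have [p1 p2 p3 p4] := And4 (sq0 (a_t t)) (sq0 (b_t t)) (sq0 (w1 t)) (sq0 (v1 t)).
have H f : L2 f -> ip f f <= energy2 t -> L2norm f <= root4 t ^+ 2.
  move=> f2 fe; rewrite root4_sqr -[leLHS](ger0_norm (L2norm_ge0 I f)) -sqrtr_sqr.
  by rewrite ler_wsqrtr// L2norm_sqr// (le_trans fe)// lerDr.
by have [] := le_weighted_sum p1 p2 p3 p4; split; apply: H.
Qed.

Let c0 : R := growth_rate S.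

(** The Gagliardo-Nirenberg inequality with parameter [1 / root4 t] bounds the
gradient uniformly by a multiple of [root4 t]. *)
Lemma norm_gradient_sqr t : L2norm (a1 t * a1 t + b1 t * b1 t) <=
  2 * (root4 t * (S + 2 + 4 * S ^+ 2) * S).
Proof.
have [[_ _ na1 nb1] _] := low_order_norms t.
have [nat nbt _ _] := norms_le_root4 t.
have y1 := root4_ge1 t; have y0 : 0 < root4 t by exact: lt_le_trans y1.
have r0 : 0 < (root4 t)^-1 by rewrite invr_gt0.
have r1 : (root4 t)^-1 <= 1 by rewrite invf_le1.
have ry : (root4 t)^-1 * root4 t = 1 by rewrite mulVf// gt_eqF.
have K0 : 0 <= root4 t * (S + 2 + 4 * S ^+ 2).
  apply: (mulr_ge0 (ltW y0)); apply: addr_ge0; first exact: addr_ge0.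
  exact: (mulr_ge0 _ (sqr_ge0 S)).
have GA := gagliardo_nirenberg oI iI (Ha t).
have GB := gagliardo_nirenberg oI iI (Hb t).
rewrite -Ea1 -Ea2 in GA; rewrite -Eb1 -Eb2 in GB.
have arith n1 n2 m : n1 <= S -> n2 <= m + 2 * S ^+ 2 -> m <= root4 t ^+ 2 ->
    (root4 t)^-1^-1 * n1 + 2 * (root4 t)^-1 * n2 <= root4 t * (S + 2 + 4 * S ^+ 2).
  rewrite invrK => h1 h2 h3; exact: (gradient_arith S0 y1 r0 r1 ry h1 h2 h3).
have SA := GA _ (H1a1 t) r0; have SB := GB _ (H1b1 t) r0.
have sa : {ae @lebesgue_measure R, forall x, I x -> `|a1 t x| <= root4 t * (S + 2 + 4 * S ^+ 2)}.
  by apply: aeS SA => x /[apply] /le_trans; apply; exact: arith na1 (norm_a2 t) nbt.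
have sb : {ae @lebesgue_measure R, forall x, I x -> `|b1 t x| <= root4 t * (S + 2 + 4 * S ^+ 2)}.
  by apply: aeS SB => x /[apply] /le_trans; apply; exact: arith nb1 (norm_b2 t) nat.
have P1 : L2 (a1 t * a1 t) by L2_tac.
have P2 : L2 (b1 t * b1 t) by L2_tac.
have ma := L2_measurable mI (La1 t); have mb := L2_measurable mI (Lb1 t).
rewrite (le_trans (L2norm_triangle mI P1 P2))// [leRHS]mulrDl mul1r lerD//.
  by rewrite (le_trans (L2norm_mulB mI ma K0 sa (La1 t)))// ler_wpM2l.
by rewrite (le_trans (L2norm_mulB mI mb K0 sb (Lb1 t)))// ler_wpM2l.
Qed.

Lemma energy2_rate t :
  `|4 * ip (v_t t) (dens t * v t + (a1 t * a1 t + b1 t * b1 t))| <= 4 * c0 * root4 t ^+ 3.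
Proof.
have nd := norm_dens_v t; have ng := norm_gradient_sqr t.
have [_ _ nw _] := norms_le_root4 t; have y1 := root4_ge1 t.
have P1 : L2 (dens t * v t) by rewrite mulrC; L2_all.
have P2 : L2 (a1 t * a1 t + b1 t * b1 t) by L2_tac.
have nv : L2norm (v_t t) <= root4 t ^+ 2 by rewrite v_tE L2normN.
rewrite normrM ger0_norm// -mulrA ler_wpM2l//.
rewrite (le_trans (ip_le mI (Lv_t t) (L2D P1 P2)))//.
rewrite (le_trans (ler_wpM2l (L2norm_ge0 _ _) (L2norm_triangle mI P1 P2)))//.
rewrite (le_trans (ler_wpM2l (L2norm_ge0 _ _) (lerD nd ng)))//.
have Q0 : 0 <= 8 * S ^+ 3 + 2 * (root4 t * (S + 2 + 4 * S ^+ 2) * S).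
  by apply: le_trans (lerD nd ng); rewrite addr_ge0 ?L2norm_ge0.
rewrite (le_trans (ler_wpM2r Q0 nv))//.
exact: rate_arith.
Qed.

Lemma root4_growth t : root4 t <= root4 0 + c0 * `|t|.
Proof.
have D s : is_derive s (1 : R) root4 ((2 * root4 s)^-1 * ((2 * root4 s ^+ 2)^-1 *
    (4 * ip (v_t s) (dens s * v s + (a1 s * a1 s + b1 s * b1 s))))).
  have E0 : 0 < 1 + energy2 s by rewrite ltr_pwDl// energy2_ge0.
  have s0 : 0 < Num.sqrt (1 + energy2 s) by rewrite sqrtr_gt0.
  have D1 : is_derive s (1 : R) (fun s => 1 + energy2 s)
     (4 * ip (v_t s) (dens s * v s + (a1 s * a1 s + b1 s * b1 s))).
    have := is_deriveD (is_derive_cst (1 : R) s (1 : R)) (is_derive_energy2 s).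
    by rewrite add0r.
  have D2 := @is_derive1_comp _ Num.sqrt (fun s => 1 + energy2 s) s _ _ (is_derive1_sqrt E0) D1.
  have D3 := @is_derive1_comp _ Num.sqrt _ s _ _ (is_derive1_sqrt s0) D2.
  by apply: is_derive_eq D3 _; rewrite root4_sqr.
have [c _ E] := MVT_between 0 t D.
rewrite add0r in E; rewrite -lerBlDl E (le_trans (ler_norm _))// normrM ler_wpM2r//.
have y1 := root4_ge1 c; have y0 : 0 < root4 c by exact: lt_le_trans y1.
rewrite !normrM gtr0_norm ?invr_gt0 ?mulr_gt0// gtr0_norm ?invr_gt0 ?mulr_gt0 ?exprn_gt0//.
have H := energy2_rate c; rewrite normrM in H.
rewrite ler_pdivrMl ?mulr_gt0// ler_pdivrMl ?mulr_gt0 ?exprn_gt0//.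
rewrite (le_trans H)// le_eqVlt; apply/orP; left; apply/eqP; ring.
Qed.

Lemma root4_initial : root4 0 <= 1 + initial_energy2 X S.
Proof.
have na := norm_a_t 0; have nb := norm_b_t 0.
have [p1 p2] := (sq0 (a2 0), sq0 (b2 0)); have [p3 p4] := (sq0 (v 0), sq0 (w 0)).
have [p5 p6] := (sq0 (v1 0), sq0 (w1 0)).
have na2 : L2norm (a2 0) <= X + 1.
  by apply: ler_sqr1; rewrite L2norm_sqr// (le_trans _ X_lap)// lerDl.
have nb2 : L2norm (b2 0) <= X + 1.
  by apply: ler_sqr1; rewrite L2norm_sqr// (le_trans _ X_lap)// lerDr.
have sqb (n : R) : 0 <= n -> n <= X + 1 + 2 * S ^+ 2 -> n ^+ 2 <= (X + 1 + 2 * S ^+ 2) ^+ 2.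
  by move=> n0 h; rewrite lerXn2r ?nnegrE// (le_trans n0).
have A1' : ip (a_t 0) (a_t 0) <= (X + 1 + 2 * S ^+ 2) ^+ 2.
  rewrite -L2norm_sqr//; apply: sqb; first exact: L2norm_ge0.
  by rewrite (le_trans na)// lerD2r.
have B1' : ip (b_t 0) (b_t 0) <= (X + 1 + 2 * S ^+ 2) ^+ 2.
  rewrite -L2norm_sqr//; apply: sqb; first exact: L2norm_ge0.
  by rewrite (le_trans nb)// lerD2r.
have e0 : energy2 0 <= initial_energy2 X S.
  exact: initial_energy2_arith A1' B1' X_v X_w p3 p4.
have sqrt1 (z : R) : 1 <= z -> Num.sqrt z <= z.
  move=> z1; rewrite -{2}(@ger0_norm _ z) ?(le_trans _ z1)// -sqrtr_sqr ler_wsqrtr//.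
  by rewrite expr2 ler_peMl// (le_trans _ z1).
have z1 : 1 <= 1 + energy2 0 by rewrite lerDl energy2_ge0.
have z2 : 1 <= Num.sqrt (1 + energy2 0).
  by rewrite -[X in X <= _]sqrtr1 ler_wsqrtr.
by rewrite (le_trans (sqrt1 _ z2))// (le_trans (sqrt1 _ z1))// lerD2l.
Qed.

Lemma zakharov_growth t :
  [/\ [/\ L2norm (a t) <= growth_const X * (1 + t ^+ 2), L2norm (a1 t) <= growth_const X * (1 + t ^+ 2)
    & L2norm (a2 t) <= growth_const X * (1 + t ^+ 2)],
    [/\ L2norm (b t) <= growth_const X * (1 + t ^+ 2), L2norm (b1 t) <= growth_const X * (1 + t ^+ 2)
    & L2norm (b2 t) <= growth_const X * (1 + t ^+ 2)],
    (L2norm (v t) <= growth_const X * (1 + t ^+ 2) /\ L2norm (v1 t) <= growth_const X * (1 + t ^+ 2)) &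
    (L2norm (w t) <= growth_const X * (1 + t ^+ 2) /\ L2norm (w1 t) <= growth_const X * (1 + t ^+ 2))].
Proof.
have [[na nb na1 nb1] [nv nw]] := low_order_norms t.
have [nat nbt nw1 nv1] := norms_le_root4 t.
have na2 := norm_a2 t; have nb2 := norm_b2 t.
have y1 := root4_ge1 t.
have yt := le_trans (root4_growth t) (lerD root4_initial (lexx _)).
have HS : S + root4 t ^+ 2 + 2 * S ^+ 2 <= growth_const X * (1 + t ^+ 2).
  have := growth_arith X0 S0 (le_trans ler01 y1) yt.
  by rewrite real_normK ?num_real// -/S; apply.
have y20 : 0 <= root4 t ^+ 2 by exact: sqr_ge0.
have S20 : 0 <= S ^+ 2 by exact: sqr_ge0.
have S22 : 0 <= 2 * S ^+ 2 by exact: (mulr_ge0 _ S20).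
have B1 n : n <= S -> n <= S + root4 t ^+ 2 + 2 * S ^+ 2.
  by move=> h; rewrite -addrA; apply: (le_trans h); rewrite lerDl addr_ge0.
have B2 n : n <= root4 t ^+ 2 -> n <= S + root4 t ^+ 2 + 2 * S ^+ 2.
  by move=> h; apply: (le_trans h); rewrite addrAC lerDr addr_ge0.
have B3 n m : n <= m + 2 * S ^+ 2 -> m <= root4 t ^+ 2 -> n <= S + root4 t ^+ 2 + 2 * S ^+ 2.
  move=> h k; apply: (le_trans h); rewrite lerD2r; apply: (le_trans k).
  by rewrite lerDr.
split; split; apply: (le_trans _ HS).
- exact: B1.
- exact: B1.
- exact: B3 na2 nbt.
- exact: B1.
- exact: B1.
- exact: B3 nb2 nat.
- exact: B1.
- exact: B2.
- exact: B1.
- exact: B2.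
Qed.

End zakharov_flow.

(** * Complex-valued functions *)

Lemma le_root_sum_sqr {R : realFieldType} (n1 n2 n3 n4 n5 n6 n : R) :
  0 <= n1 -> 0 <= n2 -> 0 <= n3 -> 0 <= n4 -> 0 <= n5 -> 0 <= n6 -> 0 <= n ->
  n ^+ 2 = (n1 ^+ 2 + n2 ^+ 2) + (n3 ^+ 2 + n4 ^+ 2) + (n5 ^+ 2 + n6 ^+ 2) ->
  [/\ n1 <= n, n3 <= n & n5 <= n] /\ [/\ n2 <= n, n4 <= n & n6 <= n].
Proof.
move=> p1 p2 p3 p4 p5 p6 p E.
have q1 := sqr_ge0 n1; have q2 := sqr_ge0 n2; have q3 := sqr_ge0 n3.
have q4 := sqr_ge0 n4; have q5 := sqr_ge0 n5; have q6 := sqr_ge0 n6.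
by split; split; rewrite -ler_sqr ?nnegrE// E; lra.
Qed.

Section complex_parts.
Context {R : realType} (I : set R) (oI : open I).
Local Notation L2 := (L2 I).
Local Notation L2norm := (L2norm I).
Local Notation ip := (inner I).
Local Notation wderiv := (wderiv I).
Local Notation normc := (@ComplexField.Normc.normc R).
Implicit Types (z : R[i]) (f : R -> R[i]).

Let mI : measurable I := open_measurable oI.

Lemma normcE z : normc z = Num.sqrt (complex.Re z ^+ 2 + complex.Im z ^+ 2).
Proof. by case: z. Qed.

Lemma normc_sqr z : normc z ^+ 2 = complex.Re z ^+ 2 + complex.Im z ^+ 2.
Proof. by rewrite normcE sqr_sqrtr// addr_ge0 ?sqr_ge0. Qed.

Lemma normc_sqrE f :
  (fun x => normc (f x) ^+ 2) = ReF f * ReF f + ImF f * ImF f.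
Proof. by apply/funext => x; rewrite normc_sqr !expr2. Qed.

Lemma L2_normc f : L2C I f -> L2 (fun x => normc (f x)).
Proof.
move=> [r2 i2]; apply/(L2P mI); split.
  have -> : (fun x => normc (f x)) = Num.sqrt \o (fun x => normc (f x) ^+ 2).
    apply/funext => x /=; rewrite sqrtr_sqr ger0_norm// normcE; exact: sqrtr_ge0.
  apply: (measurableT_comp (continuous_measurable_fun (@sqrt_continuous R))).
  rewrite normc_sqrE; apply: measurable_funD; apply: measurable_funM;
    exact: L2_measurable.
rewrite (_ : _ ^+ 2 = ReF f * ReF f + ImF f * ImF f); last exact: normc_sqrE.
by apply: L1D => //; apply: L2M.
Qed.

Lemma L2normC_sqr f : L2C I f -> L2normC I f ^+ 2 = L2norm (ReF f) ^+ 2 + L2norm (ImF f) ^+ 2.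
Proof.
move=> f2; have [r2 i2] := f2.
rewrite /L2normC !L2norm_sqr//; last exact: L2_normc.
have -> : ip (fun x => normc (f x)) (fun x => normc (f x)) =
    J I (fun x => normc (f x) ^+ 2).
  by [].
by rewrite normc_sqrE JD//; exact: L2M.
Qed.

Lemma L2C_wderivC f : L2C I (wderivC I f).
Proof. by split; exact: L2_wderiv. Qed.

Lemma H2normC_sqr f : L2C I f -> H2normC I f ^+ 2 =
  (L2norm (ReF f) ^+ 2 + L2norm (ImF f) ^+ 2)
  + (L2norm (wderiv (ReF f)) ^+ 2 + L2norm (wderiv (ImF f)) ^+ 2)
  + (L2norm (wderiv (wderiv (ReF f))) ^+ 2 + L2norm (wderiv (wderiv (ImF f))) ^+ 2).
Proof.
move=> f2; rewrite /H2normC sqr_sqrtr ?addr_ge0 ?sqr_ge0//.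
rewrite !L2normC_sqr//; exact: L2C_wderivC.
Qed.

Lemma ReF_B f g : ReF (f \- g) = ReF f - ReF g.
Proof.
by apply/funext => x; rewrite !fctE /ReF /=; case: (f x) => p q; case: (g x) => r s; reflexivity.
Qed.

Lemma ImF_B f g : ImF (f \- g) = ImF f - ImF g.
Proof.
by apply/funext => x; rewrite !fctE /ImF /=; case: (f x) => p q; case: (g x) => r s; reflexivity.
Qed.

Lemma H1norm_sqr (f : R -> R) : H1norm I f ^+ 2 = L2norm f ^+ 2 + L2norm (wderiv f) ^+ 2.
Proof. by rewrite /H1norm sqr_sqrtr// addr_ge0 ?sqr_ge0. Qed.

Lemma H2normC_ge0 f : 0 <= H2normC I f.
Proof. exact: sqrtr_ge0. Qed.

Lemma L2norm_le_H2normC f : L2C I f ->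
  [/\ L2norm (ReF f) <= H2normC I f, L2norm (wderiv (ReF f)) <= H2normC I f
    & L2norm (wderiv (wderiv (ReF f))) <= H2normC I f] /\
  [/\ L2norm (ImF f) <= H2normC I f, L2norm (wderiv (ImF f)) <= H2normC I f
    & L2norm (wderiv (wderiv (ImF f))) <= H2normC I f].
Proof.
move=> f2.
exact: le_root_sum_sqr (L2norm_ge0 _ _) (L2norm_ge0 _ _) (L2norm_ge0 _ _) (L2norm_ge0 _ _)
  (L2norm_ge0 _ _) (L2norm_ge0 _ _) (H2normC_ge0 f) (H2normC_sqr f2).
Qed.

Lemma H2normC_le f (K : R) : L2C I f -> 0 <= K ->
  [/\ L2norm (ReF f) <= K, L2norm (wderiv (ReF f)) <= K & L2norm (wderiv (wderiv (ReF f))) <= K] ->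
  [/\ L2norm (ImF f) <= K, L2norm (wderiv (ImF f)) <= K & L2norm (wderiv (wderiv (ImF f))) <= K] ->
  H2normC I f <= 3 * K.
Proof.
move=> f2 K0 [h1 h2 h3] [h4 h5 h6].
have sq n : L2norm n <= K -> L2norm n ^+ 2 <= K ^+ 2.
  by move=> h; rewrite ler_sqr ?nnegrE// L2norm_ge0.
rewrite -ler_sqr ?nnegrE ?H2normC_ge0// ?mulr_ge0// H2normC_sqr//.
have -> : (3 * K) ^+ 2 = 3 * K ^+ 2 + 6 * K ^+ 2 by ring.
rewrite -[leLHS]add0r lerD// ?mulr_ge0 ?sqr_ge0//.
have -> : 6 * K ^+ 2 = (K ^+ 2 + K ^+ 2) + (K ^+ 2 + K ^+ 2) + (K ^+ 2 + K ^+ 2) by ring.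
by rewrite !lerD ?sq.
Qed.

Lemma H1norm_le (f : R -> R) (K : R) : 0 <= K -> L2norm f <= K -> L2norm (wderiv f) <= K ->
  H1norm I f <= 2 * K.
Proof.
move=> K0 h1 h2; rewrite -ler_sqr ?nnegrE ?sqrtr_ge0// ?mulr_ge0// H1norm_sqr.
have sq n : L2norm n <= K -> L2norm n ^+ 2 <= K ^+ 2.
  by move=> h; rewrite ler_sqr ?nnegrE// L2norm_ge0.
have -> : (2 * K) ^+ 2 = 2 * K ^+ 2 + (K ^+ 2 + K ^+ 2) by ring.
by rewrite -[leLHS]add0r lerD ?mulr_ge0 ?sqr_ge0// lerD ?sq.
Qed.

Lemma contL2_squeeze (z : R -> R -> R) (N : R -> R -> R) : (forall t, L2 (z t)) ->
  (forall s t, L2norm (z s - z t) <= N s t) -> (forall t, N s t @[s --> t] --> (0 : R)) ->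
  contL2 I z.
Proof.
move=> z2 zN N0 t; apply: (@cvgL2_squeeze _ _ _ _ (nbhs_filter t) _ _ (fun s => N s t)) => //.
by apply: nearW => s; exact: zN.
Qed.

(** The equations hold almost everywhere, so that the time derivative [d] is exchanged
for the right-hand side [z'] of the equation. *)
Lemma derL2_squeeze (z z' d : R -> R -> R) (N : R -> R -> R) :
  (forall t, L2 (z t)) -> (forall t, L2 (d t)) -> (forall t, L2 (z' t)) ->
  (forall t, {ae @lebesgue_measure R, forall x, I x -> d t x = z' t x}) ->
  (forall h t, L2norm (diffq z h t - d t) <= N h t) ->
  (forall t, N h t @[h --> (0 : R)^'] --> (0 : R)) -> derL2 I z z'.
Proof.
move=> z2 d2 z'2 dz zN N0 t; apply: (@cvgL2_squeeze _ _ _ _ _ _ _ (fun h => N h t)) => //.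
  by move=> h; exact: L2_diffq.
apply: nearW => h; rewrite (le_trans _ (zN h t))// le_eqVlt; apply/orP; left; apply/eqP.
apply: (L2norm_ae oI) => //; do ?[apply: L2B => //; exact: L2_diffq].
by apply: aeS (dz t) => x /[apply] E; rewrite !fctE E.
Qed.

End complex_parts.

(** * Reduction to the real system *)

Lemma initial_arith {R : realFieldType} (n1 n2 n3 n4 n5 n6 m1 m2 k1 k2 A B C : R)
    (x1 x2 x3 x4 x5 x6 y1 y2 z1 z2 : R) :
  A ^+ 2 = (n1 ^+ 2 + n2 ^+ 2) + (n3 ^+ 2 + n4 ^+ 2) + (n5 ^+ 2 + n6 ^+ 2) ->
  B ^+ 2 = m1 ^+ 2 + m2 ^+ 2 -> C ^+ 2 = k1 ^+ 2 + k2 ^+ 2 ->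
  x1 = n1 ^+ 2 -> x2 = n2 ^+ 2 -> x3 = n3 ^+ 2 -> x4 = n4 ^+ 2 -> x5 = n5 ^+ 2 ->
  x6 = n6 ^+ 2 -> y1 = m1 ^+ 2 -> y2 = m2 ^+ 2 -> z1 = k1 ^+ 2 -> z2 = k2 ^+ 2 ->
  [/\ x1 + x2 <= A ^+ 2 + B ^+ 2 + C ^+ 2, x3 + x4 <= A ^+ 2 + B ^+ 2 + C ^+ 2,
      x5 + x6 <= A ^+ 2 + B ^+ 2 + C ^+ 2, y1 + y2 <= A ^+ 2 + B ^+ 2 + C ^+ 2
    & z1 + z2 <= A ^+ 2 + B ^+ 2 + C ^+ 2].
Proof.
move=> -> -> -> -> -> -> -> -> -> -> -> -> ->.
have [p1 p2] := (sqr_ge0 n1, sqr_ge0 n2); have [p3 p4] := (sqr_ge0 n3, sqr_ge0 n4).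
have [p5 p6] := (sqr_ge0 n5, sqr_ge0 n6); have [p7 p8] := (sqr_ge0 m1, sqr_ge0 m2).
have [p9 p10] := (sqr_ge0 k1, sqr_ge0 k2).
by split; lra.
Qed.

Lemma schrodinger_parts {R : realType} (d z : R[i]) (c : R) :
  complex.Re ('i * d - 'i * c%:C * z) = c * complex.Im z - complex.Im d /\
  complex.Im ('i * d - 'i * c%:C * z) = complex.Re d - c * complex.Re z.
Proof. by case: d z => p q [r s] /=; split; ring. Qed.

Section solutions.
Context {R : realType} (I : set R) (oI : open I) (iI : is_interval I).
Context (u0 : R -> R[i]) (v0 w0 : R -> R) (u : R -> R -> R[i]) (v w : R -> R -> R).
Context (sol : is_solution I u0 v0 w0 u v w).
Local Notation L2 := (L2 I).
Local Notation L2norm := (L2norm I).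
Local Notation wderiv := (wderiv I).
Implicit Types (s t h : R).

Let mI : measurable I := open_measurable oI.

Definition re t : R -> R := ReF (u t).
Definition im t : R -> R := ImF (u t).

Lemma solution_regular t :
  [/\ Defs.H10 I (re t), H1 I (wderiv (re t)), Defs.H10 I (im t) & H1 I (wderiv (im t))] /\
  (Defs.H10 I (v t) /\ Defs.H10 I (w t)).
Proof.
have [du [dv [dw [[reg _ _ _ _] _ _ _ _]]]] := sol.
have [[[_ r1] [_ i1]] [r0 i0] hv hw] := reg t.
exact: conj (And4 r0 r1 i0 i1) (conj hv hw).
Qed.

Let Hre t : Defs.H10 I (re t). Proof. by have [[h _ _ _] _] := solution_regular t; exact: h. Qed.
Let Him t : Defs.H10 I (im t). Proof. by have [[_ _ h _] _] := solution_regular t; exact: h. Qed.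
Let Hre1 t : H1 I (wderiv (re t)). Proof. by have [[_ h _ _] _] := solution_regular t; exact: h. Qed.
Let Him1 t : H1 I (wderiv (im t)). Proof. by have [[_ _ _ h] _] := solution_regular t; exact: h. Qed.
Let Hv t : Defs.H10 I (v t). Proof. by have [_ [h _]] := solution_regular t; exact: h. Qed.
Let Hw t : Defs.H10 I (w t). Proof. by have [_ [_ h]] := solution_regular t; exact: h. Qed.
Let H1re t : H1 I (re t). Proof. exact: H10_H1. Qed.
Let H1im t : H1 I (im t). Proof. exact: H10_H1. Qed.
Let H1v t : H1 I (v t). Proof. exact: H10_H1. Qed.
Let H1w t : H1 I (w t). Proof. exact: H10_H1. Qed.
Let L2C_u t : L2C I (u t). Proof. exact: conj (H1_L2 (H1re t)) (H1_L2 (H1im t)). Qed.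

Let N s t := H2normC I (u s \- u t).

Lemma re_sub s t : ReF (u s \- u t) = re s - re t. Proof. exact: ReF_B. Qed.
Lemma im_sub s t : ImF (u s \- u t) = im s - im t. Proof. exact: ImF_B. Qed.

Lemma norm_differences s t :
  [/\ L2norm (re s - re t) <= N s t, L2norm (wderiv (re s) - wderiv (re t)) <= N s t
    & L2norm (wderiv (wderiv (re s)) - wderiv (wderiv (re t))) <= N s t] /\
  [/\ L2norm (im s - im t) <= N s t, L2norm (wderiv (im s) - wderiv (im t)) <= N s t
    & L2norm (wderiv (wderiv (im s)) - wderiv (wderiv (im t))) <= N s t].
Proof.
have d2 : L2C I (u s \- u t).
  by split; rewrite ?re_sub ?im_sub; apply: L2B; exact: H1_L2.
have eq_le (x y z : R) : x = y -> x <= z -> y <= z by move=> ->.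
have := L2norm_le_H2normC oI d2; rewrite -/(N s t) re_sub im_sub => -[[r0 r1 r2] [i0 i1 i2]].
split; split.
- exact: r0.
- exact: eq_le (L2norm_wderivB oI (H1re s) (H1re t)) r1.
- exact: eq_le (L2norm_wderiv2B oI (H1re s) (H1re t) (Hre1 s) (Hre1 t)) r2.
- exact: i0.
- exact: eq_le (L2norm_wderivB oI (H1im s) (H1im t)) i1.
- exact: eq_le (L2norm_wderiv2B oI (H1im s) (H1im t) (Him1 s) (Him1 t)) i2.
Qed.

Lemma continuous_re_im :
  [/\ contL2 I re, contL2 I (fun t => wderiv (re t)) & contL2 I (fun t => wderiv (wderiv (re t)))]
  /\ [/\ contL2 I im, contL2 I (fun t => wderiv (im t))
       & contL2 I (fun t => wderiv (wderiv (im t)))].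
Proof.
have [du [dv [dw [[_ [cu _ _] _ _ _] _ _ _ _]]]] := sol.
have N0 t : N s t @[s --> t] --> (0 : R) := cu t.
split; split; apply: (contL2_squeeze _ _ N0) => [t|s t];
  try exact: L2_wderiv; try exact: H1_L2.
- by have [[h _ _] _] := norm_differences s t; exact: h.
- by have [[_ h _] _] := norm_differences s t; exact: h.
- by have [[_ _ h] _] := norm_differences s t; exact: h.
- by have [_ [h _ _]] := norm_differences s t; exact: h.
- by have [_ [_ h _]] := norm_differences s t; exact: h.
- by have [_ [_ _ h]] := norm_differences s t; exact: h.
Qed.

Lemma continuous_real_part (z : R -> R -> R) : (forall t, H1 I (z t)) ->
  @curve_continuous R R^o (H1norm I) z -> contL2 I z /\ contL2 I (fun t => wderiv (z t)).
Proof.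
move=> z1 cz; split; apply: (@contL2_squeeze _ _ _ (fun s t => H1norm I (z s \- z t))) => //.
- by move=> t; exact: H1_L2.
- by move=> s t; exact: L2norm_le_H1norm.
- by move=> t; exact: L2_wderiv.
- move=> s t; rewrite -L2norm_wderivB//; exact: L2norm_wderiv_le_H1norm.
Qed.

Lemma derivative_real_part (z dz z' : R -> R -> R) : (forall t, L2 (z t)) ->
  (forall t, L2 (dz t)) -> (forall t, L2 (z' t)) ->
  (forall t, {ae @lebesgue_measure R, forall x, I x -> dz t x = z' t x}) ->
  @curve_derivative R R^o (L2norm) z dz -> derL2 I z z'.
Proof.
move=> z2 dz2 z'2 E D.
by apply: (@derL2_squeeze _ _ oI _ _ dz
  (fun h t => L2norm (fun x => h^-1 *: (z (t + h) x - z t x : R^o) - dz t x))).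
Qed.

Lemma derivative_re_im (du : R -> R -> R[i]) (a' b' : R -> R -> R) :
  (forall t, L2C I (du t)) -> (forall t, L2 (a' t)) -> (forall t, L2 (b' t)) ->
  (forall t, {ae @lebesgue_measure R, forall x, I x -> complex.Re (du t x) = a' t x}) ->
  (forall t, {ae @lebesgue_measure R, forall x, I x -> complex.Im (du t x) = b' t x}) ->
  @curve_derivative R (Rcomplex R) (L2normC I) u du -> derL2 I re a' /\ derL2 I im b'.
Proof.
move=> du2 a2 b2 Ea Eb D.
pose q h t : R -> R[i] := fun x => h^-1 *: (u (t + h) x - u t x : Rcomplex R) - du t x.
have qr h t : ReF (q h t) = diffq re h t - ReF (du t).
  apply/funext => x; rewrite /q /diffq !fctE /re /ReF /=.
  by case: (u (t + h) x) => ? ?; case: (u t x) => ? ?; case: (du t x).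
have qi h t : ImF (q h t) = diffq im h t - ImF (du t).
  apply/funext => x; rewrite /q /diffq !fctE /im /ImF /=.
  by case: (u (t + h) x) => ? ?; case: (u t x) => ? ?; case: (du t x).
have Lr h t : L2 (diffq re h t) by apply: L2_diffq => s; exact: H1_L2.
have Li h t : L2 (diffq im h t) by apply: L2_diffq => s; exact: H1_L2.
have q2 h t : L2C I (q h t).
  by have [? ?] := du2 t; split; rewrite ?qr ?qi; exact: L2B.
have [qn1 qn2] : (forall h t, L2norm (diffq re h t - ReF (du t)) <= L2normC I (q h t)) /\
    (forall h t, L2norm (diffq im h t - ImF (du t)) <= L2normC I (q h t)).
  split=> h t; rewrite -?qr -?qi -ler_sqr ?nnegrE ?L2norm_ge0// L2normC_sqr//.
    by rewrite lerDl sqr_ge0.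
  by rewrite lerDr sqr_ge0.
split.
  apply: (@derL2_squeeze _ _ oI _ _ (fun t => ReF (du t)) (fun h t => L2normC I (q h t))) => //.
  - by move=> t; exact: H1_L2.
  - by move=> t; case: (du2 t).
apply: (@derL2_squeeze _ _ oI _ _ (fun t => ImF (du t)) (fun h t => L2normC I (q h t))) => //.
- by move=> t; exact: H1_L2.
- by move=> t; case: (du2 t).
Qed.

Let a1 t : R -> R := wderiv (re t).
Let a2 t : R -> R := wderiv (a1 t).
Let b1 t : R -> R := wderiv (im t).
Let b2 t : R -> R := wderiv (b1 t).
Let v1 t : R -> R := wderiv (v t).
Let w1 t : R -> R := wderiv (w t).

Let L2_mul f g : Defs.H10 I f -> L2 g -> L2 (f * g).
Proof. by move=> f0 g2; apply: L2_Linf => //; exact: H10_Linf. Qed.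

Lemma wderiv_dens t : {ae @lebesgue_measure R, forall x, I x ->
  wderiv (fun y => ComplexField.Normc.normc (u t y) ^+ 2) x = dens1 re a1 im b1 t x}.
Proof.
have rr : L2 (re t * re t) by apply: L2_mul => //; exact: H1_L2.
have ii : L2 (im t * im t) by apply: L2_mul => //; exact: H1_L2.
have r1 : L2 (wderiv (re t) * re t + re t * wderiv (re t)).
  by apply: L2D; [rewrite mulrC|]; apply: L2_mul => //; exact: L2_wderiv.
have i1 : L2 (wderiv (im t) * im t + im t * wderiv (im t)).
  by apply: L2D; [rewrite mulrC|]; apply: L2_mul => //; exact: L2_wderiv.
have W := weakD oI rr ii r1 i1 (weakM oI iI (H1re t) (Hre t)) (weakM oI iI (H1im t) (Him t)).
rewrite normc_sqrE; apply: aeS (wderiv_ae oI (L2D r1 i1) W (L2D rr ii)) => x /[apply].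
rewrite -/(re t) -/(im t) => ->.
by rewrite /dens1 !fctE /GRing.scale/= -/(a1 t) -/(b1 t); ring.
Qed.

Lemma solution_zakharov : zakharov I re a1 a2 im b1 b2 v v1 w w1.
Proof.
have [du [dv [dw [[_ [_ cv cw] du2 _ [Du Dv Dw]] Eu Ev Ew _]]]] := sol.
have [cre cim] := continuous_re_im.
have Lv t : L2 (v t) by exact: H1_L2.
have Lw t : L2 (w t) by exact: H1_L2.
have Lat t : L2 (a_t im b2 v t).
  by apply: L2B; [apply: L2_mul => //; exact: H1_L2|exact: L2_wderiv].
have Lbt t : L2 (b_t re a2 v t).
  by apply: L2B; [exact: L2_wderiv|apply: L2_mul => //; exact: H1_L2].
have Lvt t : L2 (v_t w1 t) by apply: L2N; exact: L2_wderiv.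
have Lwt t : L2 (w_t re a1 im b1 v1 t).
  apply: L2B; first by apply: L2N; exact: L2_wderiv.
  by apply: L2Z; apply: L2D; apply: L2_mul => //; exact: L2_wderiv.
have duE t : {ae @lebesgue_measure R, forall x, I x ->
    complex.Re (du t x) = a_t im b2 v t x /\ complex.Im (du t x) = b_t re a2 v t x}.
  apply: aeS (Eu t) => x /[apply] ->.
  exact: schrodinger_parts.
have [da db] : derL2 I re (a_t im b2 v) /\ derL2 I im (b_t re a2 v).
  apply: (derivative_re_im _ Lat Lbt _ _ Du) => t.
  - by have [] := du2 t.
  - by apply: aeS (duE t) => x /[apply] -[].
  - by apply: aeS (duE t) => x /[apply] -[].
have dvv : derL2 I v (v_t w1).
  by apply: (derivative_real_part Lv _ Lvt _ Dv) => t; have [] := du2 t.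
have dww : derL2 I w (w_t re a1 im b1 v1).
  apply: (derivative_real_part Lw _ Lwt _ Dw) => t; first by have [] := du2 t.
  apply: aeS (aeI (Ew t) (wderiv_dens t)) => x [h1 h2] Ix.
  by rewrite (h1 Ix) (h2 Ix).
split.
- by move=> t; exact: And4 (Hre t) (Hre1 t) erefl erefl.
- by move=> t; exact: And4 (Him t) (Him1 t) erefl erefl.
- by move=> t; exact: conj (Hv t) erefl.
- by move=> t; exact: conj (Hw t) erefl.
- exact: cre.
- exact: cim.
- exact: continuous_real_part H1v cv.
- exact: continuous_real_part H1w cw.
- exact: da.
- exact: db.
- exact: dvv.
- exact: dww.
Qed.

Context (u0_H2 : H2C I u0) (v0_H10 : Defs.H10 I v0) (w0_H10 : Defs.H10 I w0).

Let u0_L2 : L2C I u0. Proof. by have [[[h _] _] [[k _] _]] := u0_H2; exact: conj h k. Qed.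

Lemma initial_values :
  [/\ {ae @lebesgue_measure R, forall x, I x -> re 0 x = ReF u0 x},
      {ae @lebesgue_measure R, forall x, I x -> im 0 x = ImF u0 x},
      {ae @lebesgue_measure R, forall x, I x -> v 0 x = v0 x} &
      {ae @lebesgue_measure R, forall x, I x -> w 0 x = w0 x}].
Proof.
have [du [dv [dw [_ _ _ _ E]]]] := sol.
by split; apply: aeS E => x /[apply] -[e1 e2 e3]; rewrite ?/re ?/im /ReF /ImF ?e1.
Qed.

Let X : R := H2normC I u0 ^+ 2 + H1norm I v0 ^+ 2 + H1norm I w0 ^+ 2.

Lemma initial_bounds :
  [/\ mass I re im 0 <= X,
      inner I (a1 0) (a1 0) + inner I (b1 0) (b1 0) <= X,
      inner I (a2 0) (a2 0) + inner I (b2 0) (b2 0) <= X,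
      inner I (v 0) (v 0) + inner I (v1 0) (v1 0) <= X &
      inner I (w 0) (w 0) + inner I (w1 0) (w1 0) <= X].
Proof.
have [Er Ei Ev Ew] := initial_values; have [r2 i2] := u0_L2.
have La : L2 (re 0) by exact: H1_L2.
have Lb : L2 (im 0) by exact: H1_L2.
have Lv : L2 (v 0) by exact: H1_L2.
have Lw : L2 (w 0) by exact: H1_L2.
have v2 : L2 v0 by exact/H1_L2/H10_H1.
have w2 : L2 w0 by exact/H1_L2/H10_H1.
have sqr_eq f g : f = g -> L2 g -> inner I f f = L2norm g ^+ 2.
  by move=> -> /L2norm_sqr ->.
have sqr_ae f g : {ae @lebesgue_measure R, forall x, I x -> f x = g x} -> L2 f -> L2 g ->
    inner I f f = L2norm g ^+ 2.
  by move=> fg f2 g2; rewrite -(L2norm_ae oI fg f2 g2) L2norm_sqr.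
have ea1 : a1 0 = wderiv (ReF u0) := wderiv_congr oI La r2 Er.
have eb1 : b1 0 = wderiv (ImF u0) := wderiv_congr oI Lb i2 Ei.
have ev1 : v1 0 = wderiv v0 := wderiv_congr oI Lv v2 Ev.
have ew1 : w1 0 = wderiv w0 := wderiv_congr oI Lw w2 Ew.
exact: initial_arith (H2normC_sqr oI u0_L2) (H1norm_sqr I v0) (H1norm_sqr I w0)
  (sqr_ae _ _ Er La r2) (sqr_ae _ _ Ei Lb i2)
  (sqr_eq _ _ ea1 (L2_wderiv _ _)) (sqr_eq _ _ eb1 (L2_wderiv _ _))
  (sqr_eq _ _ (congr1 wderiv ea1) (L2_wderiv _ _)) (sqr_eq _ _ (congr1 wderiv eb1) (L2_wderiv _ _))
  (sqr_ae _ _ Ev Lv v2) (sqr_eq _ _ ev1 (L2_wderiv _ _))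
  (sqr_ae _ _ Ew Lw w2) (sqr_eq _ _ ew1 (L2_wderiv _ _)).
Qed.

Lemma solution_growth t :
  H2normC I (u t) + H1norm I (v t) + H1norm I (w t) <= 7 * growth_const X * (1 + `|t| ^+ 2).
Proof.
have [B1 B2 B3 B4 B5] := initial_bounds.
have X0 : 0 <= X by rewrite !addr_ge0 ?sqr_ge0.
have [ga gb [gv gv1] [gw gw1]] := zakharov_growth oI iI solution_zakharov B1 B2 B3 B4 B5 t.
rewrite real_normK ?num_real//.
have K0 : 0 <= growth_const X * (1 + t ^+ 2).
  exact: mulr_ge0 (ltW (growth_const_gt0 X0)) (addr_ge0 ler01 (sqr_ge0 t)).
have := lerD (lerD (H2normC_le oI (L2C_u t) K0 ga gb) (H1norm_le K0 gv gv1))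
  (H1norm_le K0 gw gw1).
by move/le_trans; apply; rewrite -mulrA -!mulrDl -!natrD.
Qed.

End solutions.

Theorem theorem1p3 (R : realType) :
  exists C : R -> R -> R -> R,
    (forall a b c : R, 0 < C a b c) /\
    forall (I : set R), open I -> is_interval I ->
    forall (u0 : R -> R[i]) (v0 w0 : R -> R),
      H2C I u0 -> H10C I u0 -> H10 I v0 -> H10 I w0 ->
    forall (u : R -> R -> R[i]) (v w : R -> R -> R),
      is_solution I u0 v0 w0 u v w ->
    forall t : R,
      H2normC I (u t) + H1norm I (v t) + H1norm I (w t) <=
        C (H2normC I u0) (H1norm I v0) (H1norm I w0) * (1 + `|t| ^+ 2).
Proof.
exists (fun a b c => 7 * growth_const (a ^+ 2 + b ^+ 2 + c ^+ 2)); split.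
  by move=> a b c; rewrite mulr_gt0// growth_const_gt0// !addr_ge0 ?sqr_ge0.
move=> I oI iI u0 v0 w0 u0_H2 _ v0_H10 w0_H10 u v w sol t.
exact: (solution_growth oI iI sol u0_H2 v0_H10 w0_H10).
Qed.
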